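(* Let $\omega\in[-\pi,\pi]$, $s>1/2$, $L,L_0>0$, $\alpha>0$, $\delta>0$. Set $\tau_n^2=8\log^{1+\delta}(n)$ and $\tilde\tau_n^2=1024\,\tau_n^6(K+1)$ (with $\tau_n,\tilde\tau_n>0$), and let $\hat f_K(\omega)$ be the sequentially interactive private estimator of $f(\omega)$ defined in the context, computed from a sample $X_1,\dots,X_n$ of a centered stationary Gaussian time series with spectral density $f$. Then, for all sufficiently large $n$: (i) if $K\asymp\left\{\frac1n\vee\frac{\tau_n^6}{n\alpha^2}\right\}^{-\frac1{2s+1}}$, then $$\sup_{f\in W^{s,\infty}(L_0,L)}\mathbb E|\hat f_K(\omega)-f(\omega)|^2\le c_1\left\{\frac1n\vee\frac{\log^{3+3\delta}(n)}{n\alpha^2}\right\}^{\frac{2s}{2s+1}},$$ where the constant $c_1>0$ depends on $s,L_0,L$ and $M$; (ii) if $K\asymp\left\{\frac1n\vee\frac{\tau_n^6}{n\alpha^2}\right\}^{-\frac1{2s}}$, then $$\sup_{f\in W^{s,2}(L)}\mathbb E|\hat f_K(\omega)-f(\omega)|^2\le c_2\left\{\frac1n\vee\frac{\log^{3+3\delta}(n)}{n\alpha^2}\right\}^{\frac{2s-1}{2s}},$$ where the constant $c_2>0$ depends on $s,L$ and $M$. Here $M$ is the constant from the context, and $c_1,c_2$ do not depend on $n$, $\alpha$.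
   Context: Setting: $(X_t)_{t\in\mathbb Z}$ is a real-valued centered stationary Gaussian time series with absolutely summable autocovariances $\sigma_j=\mathrm{Cov}(X_t,X_{t+j})$ and spectral density $f(\omega)=\frac1{2\pi}\sum_{j\in\mathbb Z}\sigma_je^{-\mathrm ij\omega}$, a nonnegative, symmetric, $2\pi$-periodic function. Suprema are over spectral densities in the indicated class. Smoothness classes ($s>1/2$): $f\in W^{s,2}(L)$ iff $\sum_{j}|\sigma_j|^2|j|^{2s}\le L$ and $\sum_j\sigma_j^2\le L$. $f\in W^{s,\infty}(L_0,L)$ iff, as a $2\pi$-periodic function, $\|f\|_\infty<L$, $f^{(0)},\dots,f^{(\ell-1)}$ are continuous and $|f^{(\ell)}(x)-f^{(\ell)}(y)|\le L_0|x-y|^{s-\ell}$ for all $x,y\in[-\pi,\pi]$, where $\ell$ is the largest integer strictly less than $s$. $M>0$ denotes a constant such that $\sum_{j\in\mathbb Z}|\sigma_j|<M$ for all $f$ in the class considered. Notation: $a\vee b=\max$, $a\wedge b=\min$; $\mathrm{Lap}(b)$ has density $\frac1{2b}e^{-|x|/b}$; $a\asymp b$ means $k_1b\le a\le k_2b$ for constants $0<k_1\le k_2$. $K=K_n\in\mathbb N$ with $K<n$. ''Sufficiently large $n$'' means $n\ge n_0$ with $n_0$ allowed to depend on $\alpha$, $\delta$ and the class parameters. Mechanism: let $\xi_1,\dots,\xi_n$ be i.i.d. $\mathrm{Lap}(4\tau_n/\alpha)$ and $\tilde\xi_{K+1},\dots,\tilde\xi_n$ be i.i.d. $\mathrm{Lap}(4\tilde\tau_n/\alpha)$,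 independent of each other and of the data. For $i=1,\dots,n$: $\widetilde X_i=(X_i\wedge\tau_n)\vee(-\tau_n)$, $Z_i=\widetilde X_i+\xi_i$. For $i=K+1,\dots,n$: $V_i=X_i^2+\sum_{1\le|k|\le K}a_kX_iZ_{i-|k|}e^{-\mathrm i\omega k}$ (a real number), where $a_k=1$ for $0\le|k|\le K/2$ and $a_k=2(1-|k|/K)$ for $K/2<|k|\le K$; $\widetilde V_i=(V_i\wedge\tilde\tau_n)\vee(-\tilde\tau_n)$; $\widetilde Z_i=\widetilde V_i+\tilde\xi_i$. Estimator: $\hat f_K(\omega)=\frac1{2\pi(n-K)}\sum_{i=K+1}^n\widetilde Z_i$. *)

(* Defs.v *)
From HB Require Import structures.
From mathcomp Require Import all_boot all_order all_algebra.
From mathcomp Require Import complex.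
From mathcomp Require Import all_classical all_reals all_analysis.

Set Implicit Arguments.
Unset Strict Implicit.
Unset Printing Implicit Defensive.

Import Order.TTheory GRing.Theory Num.Theory.
Import numFieldNormedType.Exports.

Local Open Scope classical_set_scope.
Local Open Scope ring_scope.

(* e^{-ix}; the fields of [Complex] are the real and imaginary parts. *)
Definition expNi (R : realType) (x : R) : R[i] := Complex (cos x) (- sin x).

(* The sum of F over the integers k with 1 <= |k| <= N. *)
Definition sum_punctured (V : zmodType) (N : nat) (F : int -> V) : V :=
  \sum_(1 <= m < N.+1) (F m%:Z + F (- m%:Z)).

(** Spectral densities *)

Section SpectralDensity.
Variable R : realType.
Implicit Types (sigma : int -> R) (f : R -> R).

(* The sum over |j| <= N of sigma_j e^{-ijw}. *)
Definition fourier_partial sigma (w : R) (N : nat) : R[i] :=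
  real_complex R (sigma 0) * expNi 0
  + sum_punctured N (fun j => real_complex R (sigma j) * expNi (j%:~R * w)).

(* For an even sigma the partial sums are real
   ([Im_fourier_partial]), so taking the real part only changes the type. *)
Definition spectral_density sigma (w : R) : R :=
  (2 * pi)^-1 * limn (fun N => complex.Re (fourier_partial sigma w N)).

(* sigma is the autocovariance sequence of a real stationary series and has an
   (everywhere defined) nonnegative spectral density. *)
Definition is_autocov sigma : Prop :=
  [/\ forall j, sigma (- j) = sigma j,
      summable [set: int] (fun j => (sigma j)%:E)
    & forall w, 0 <= spectral_density sigma w].

Definition abs_sum sigma : \bar R := \esum_(j in [set: int]) `|sigma j|%:E.

(* Membership of a spectral density f in a smoothness class is expressed on the
   sequence sigma of its autocovariances, which f and sigma determine mutually. *)
Definition W_2 (s L : R) sigma : Prop :=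
  [/\ is_autocov sigma,
      (\esum_(j in [set: int])
         (`|sigma j| ^+ 2 * `|j|%N%:R `^ (2 * s))%:E <= L%:E)%E
    & (\esum_(j in [set: int]) (sigma j ^+ 2)%:E <= L%:E)%E].

(* [l] is the largest integer strictly less than s (which is >= 0 as s > 0).
   [derive1n] is total, so differentiability is required separately. *)
Definition W_infty (s L0 L : R) sigma : Prop :=
  let f := spectral_density sigma in
  [/\ is_autocov sigma,
      (ereal_sup [set `|f x|%:E | x in [set: R]] < L%:E)%E
    & exists l : nat,
      [/\ l%:R < s <= l.+1%:R,
          forall k, (k < l)%N ->
            continuous (derive1n k f) /\ (forall x, derivable (derive1n k f) x 1)
        & forall x y, - pi <= x <= pi -> - pi <= y <= pi ->
            `|derive1n l f x - derive1n l f y| <= L0 * `|x - y| `^ (s - l%:R)]].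

End SpectralDensity.

(** Random variables *)

Section Probability.
Context d (T : measurableType d) (R : realType) (P : probability T R).

(* The parameter s = 0 gives the point mass at m, since the library's
   [normal_prob m 0] is not the degenerate normal law. *)
Definition normal_law (Y : T -> R) (m s : R) : Prop :=
  forall A : set R, measurable A ->
    P (Y @^-1` A) = if s == 0 then \d_m A else normal_prob m s A.

Definition gaussian_process (X : int -> {RV P >-> R}) : Prop :=
  forall (r : seq int) (c : int -> R), exists m s : R,
    0 <= s /\ normal_law (fun w => \sum_(t <- r) c t * X t w) m s.

Definition centered_stationary_gaussian
    (X : int -> {RV P >-> R}) (sigma : int -> R) : Prop :=
  [/\ gaussian_process X,
      forall t, ('E_P[X t] = 0)%E
    & forall t j, covariance P (X t) (X (t + j)) = (sigma j)%:E].

Definition laplace_pdf (b x : R) : R := (2 * b)^-1 * expR (- (`|x| / b)).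

Definition laplace_law (b : R) (Y : T -> R) : Prop :=
  forall A : set R, measurable A ->
    P (Y @^-1` A) = (\int[lebesgue_measure]_(x in A) (laplace_pdf b x)%:E)%E.

(* Mutual independence of the families of events F i, for i in D. *)
Definition mutually_independent (I : eqType) (D : set I)
    (F : I -> set (set T)) : Prop :=
  forall (r : seq I) (E : I -> set T),
    uniq r -> (forall i, i \in r -> D i /\ F i (E i)) ->
    P (\bigcap_(i in [set` r]) E i) = (\prod_(i <- r) P (E i))%E.

Definition sigma_of (Y : T -> R) : set (set T) :=
  preimage_set_system [set: T] Y measurable.

Definition sigma_sample (X : int -> T -> R) (n : nat) : set (set T) :=
  <<s \bigcup_(i in [set i : nat | (1 <= i <= n)%N]) sigma_of (X i%:Z) >>.

(* The sources of randomness: [inl tt] is the sample X_1, ..., X_n, [inr (inl i)]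
   is xi_i and [inr (inr i)] is xi'_i. *)
Definition source : eqType := (unit + (nat + nat))%type.

Definition source_range (n K : nat) : set source :=
  fun a => match a with
           | inl _ => True
           | inr (inl i) => (1 <= i <= n)%N
           | inr (inr i) => (K.+1 <= i <= n)%N
           end.

Definition source_events (X : int -> T -> R) (xi xi' : nat -> T -> R)
    (n : nat) (a : source) : set (set T) :=
  match a with
  | inl _ => sigma_sample X n
  | inr (inl i) => sigma_of (xi i)
  | inr (inr i) => sigma_of (xi' i)
  end.

Definition privacy_noise (n K : nat) (b b' : R)
    (X : int -> {RV P >-> R}) (xi xi' : nat -> {RV P >-> R}) : Prop :=
  [/\ forall i, (1 <= i <= n)%N -> laplace_law b (xi i),
      forall i, (K.+1 <= i <= n)%N -> laplace_law b' (xi' i)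
    & mutually_independent (source_range n K) (source_events X xi xi' n)].

End Probability.

(** Privacy mechanism and estimator *)

Section Mechanism.
Variable R : realType.

Definition tau (delta : R) (n : nat) : R :=
  Num.sqrt (8 * ln n%:R `^ (1 + delta)).

Definition tau' (delta : R) (n K : nat) : R :=
  Num.sqrt (1024 * tau delta n ^+ 6 * K.+1%:R).

Definition clip (t x : R) : R := Num.max (Num.min x t) (- t).

Definition taper (K : nat) (k : int) : R :=
  if `|k|%N%:R <= K%:R / 2 :> R then 1 else 2 * (1 - `|k|%N%:R / K%:R).

(* Realized values: [x i], [xi i], [xi' i] stand for X_i, xi_i, xi'_i, and
   t, t' for the two truncation levels. *)
Variables (n K : nat) (w t t' : R) (x xi xi' : nat -> R).

Definition release1 (i : nat) : R := clip t (x i) + xi i.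

(* The subtraction on nat is exact for i > K. *)
Definition interaction_complex (i : nat) : R[i] :=
  real_complex R (x i ^+ 2)
  + sum_punctured K (fun k =>
      real_complex R (taper K k * x i * release1 (i - `|k|)%N)
      * expNi (w * k%:~R)).

(* This loses nothing, by [Im_interaction_complex]. *)
Definition interaction (i : nat) : R := complex.Re (interaction_complex i).

Definition release2 (i : nat) : R := clip t' (interaction i) + xi' i.

Definition spectral_estimator : R :=
  (2 * pi * (n - K)%N%:R)^-1 * \sum_(K.+1 <= i < n.+1) release2 i.

End Mechanism.

Section RealValued.
Variable R : realType.

Lemma Im_sum_punctured N (F : int -> R[i]) :
  (forall k, complex.Im (F (- k)) = - complex.Im (F k)) ->
  complex.Im (sum_punctured N F) = 0.
Proof.
move=> FN; rewrite /sum_punctured raddf_sum big1//= => m _.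
by rewrite raddfD/= FN subrr.
Qed.

Lemma Im_fourier_partial (sigma : int -> R) w N :
  (forall j, sigma (- j) = sigma j) ->
  complex.Im (fourier_partial sigma w N) = 0.
Proof.
move=> sN; rewrite /fourier_partial raddfD/= Im_sum_punctured => [|k].
  by rewrite sin0 oppr0 mulr0 mul0r !addr0.
by rewrite /= !mul0r !addr0 sN mulrNz mulNr sinN mulrN.
Qed.

Lemma Im_interaction_complex K (w t : R) (x xi : nat -> R) i :
  complex.Im (interaction_complex K w t x xi i) = 0.
Proof.
rewrite /interaction_complex raddfD/= Im_sum_punctured ?addr0// => k.
by rewrite /= !mul0r !addr0 /taper abszN mulrNz (mulrN w) sinN mulrN.
Qed.

End RealValued.

(** Risk *)

Section Risk.
Variable R : realType.

(* E|f^_K(w) - f(w)|^2 for an underlying probability space. *)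
Definition mean_squared_error d (T : measurableType d) (P : probability T R)
    (alpha delta : R) (n K : nat) (w : R) (sigma : int -> R)
    (X : int -> {RV P >-> R}) (xi xi' : nat -> {RV P >-> R}) : \bar R :=
  ('E_P[fun e => (`| spectral_estimator n K w (tau delta n) (tau' delta n K)
                     (fun i => X i%:Z e) (fun i => xi i e) (fun i => xi' i e)
                   - spectral_density sigma w | ^+ 2)%R])%E.

(* The supremum of the mean squared error over the spectral densities of a class
   (given by their autocovariances); every probability space carrying the data
   and the noise is allowed. *)
Definition worst_risk (class : (int -> R) -> Prop)
    (alpha delta : R) (n K : nat) (w : R) : \bar R :=
  ereal_sup [set r | exists sigma, class sigma /\
    exists d (T : measurableType d) (P : probability T R)
           (X : int -> {RV P >-> R}) (xi xi' : nat -> {RV P >-> R}),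
      [/\ centered_stationary_gaussian X sigma,
          privacy_noise n K (4 * tau delta n / alpha)
            (4 * tau' delta n K / alpha) X xi xi'
        & r = mean_squared_error alpha delta n K w sigma X xi xi'] ].

Definition bandwidth_rate (alpha delta : R) (n : nat) : R :=
  Num.max n%:R^-1 (tau delta n ^+ 6 / (n%:R * alpha ^+ 2)).

Definition risk_rate (alpha delta : R) (n : nat) : R :=
  Num.max n%:R^-1 (ln n%:R `^ (3 + 3 * delta) / (n%:R * alpha ^+ 2)).

End Risk.

(* Main.v *)
(* Write t, t' for the two truncation levels and V_i for the quantity clipped at
   t' in the second release. Clipping is inactive unless one of X_i, ..., X_{i-K}
   exceeds t, or one of the tapered sums of the X_{i-k}, resp. of the xi_{i-k},
   exceeds a multiple of t sqrt(K), resp. of t^2 sqrt(K). All these variables have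
   exponential moments of Gaussian type at the relevant scale, so the truncation
   error is O(1/n) in mean square because t^2 grows faster than log n. Without
   clipping, the sum of the released values splits into its mean and three
   centered sums: the noise xi', the products X_i xi_{i-k}, and the centered
   products X_i X_{i-k}. After division by n their mean squares are of order
   K t^6/(n alpha^2), K t^2/(n alpha^2) and, by Isserlis' formula and the
   summability of sigma, K/n: all are O(K r), r being the
   bandwidth rate.

   The mean is the de la Vallee Poussin mean of f. The operator I - VP is bounded
   and kills the frequencies up to K/2, hence (I - VP) f = (I - VP) (I - J)^l f
   where J is the Jackson mean of degree below K/2. Each factor I - J gains a
   factor 1/K on a derivative, which gives the bias K^(-s) in W^{s,infinity}. In
   W^{s,2} the Cauchy-Schwarz inequality bounds the remaining Fourier tail by
   K^(1/2-s). Balancing K r against the squared bias gives the theorem. *)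

Require Import Defs.
From mathcomp Require Import all_boot all_order all_algebra.
From mathcomp Require Import complex.
From mathcomp Require Import all_classical all_reals all_analysis.
From mathcomp Require Import measurable_realfun.
From mathcomp Require Import ring lra zify.

Set Implicit Arguments.
Unset Strict Implicit.
Unset Printing Implicit Defensive.

Import Order.TTheory GRing.Theory Num.Theory.
Import numFieldNormedType.Exports.

Local Open Scope classical_set_scope.
Local Open Scope ring_scope.

(** * Moments and independence *)

(** Since [t ^+ 2] exceeds every multiple of log n for large n, the Chernoff rate [k] of the
    truncation step may depend on [M] and alpha: apart from the rate itself, alpha then enters only
    through n0 and never the constants.

    Independence is given only as a product formula for events, and Gaussianity only through the
    laws of linear combinations. No joint law is formed: expectations of products come from trading
    indicators for variables one at a time, and mixed fourth moments from polarization of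
    one-dimensional normal laws, whose moments are read off the moment generating function.

    The approximation operators are quadratures on N equispaced nodes instead of convolution
    integrals. They are exact on trigonometric polynomials of degree small compared with N, and
    their norms do not depend on N; so f is compared with its Fourier partial sums while N tends to
    infinity, and no integral over the circle is taken.

    Both classes are handled by one parameter theta, equal to 2s + 1 or 2s, for which the bias is of
    order K^(-(theta - 1) / 2). *)

Section Density.
Local Open Scope ereal_scope.
Context (R : realType).
Import HBNNSimple.

Section Pushforward.
Context d (T : measurableType d) (mu : {measure set T -> \bar R}).
Variables (g F : T -> R).
Hypothesis mg : measurable_fun [set: T] g.
Hypothesis mF : measurable_fun [set: T] F.
Hypothesis F0 : forall x, (0 <= F x)%R.

Lemma integral_nnsfun_density (h : {nnsfun R >-> R}) :
  \int[mu]_x (h (g x) * F x)%:E =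
  \sum_(y \in range h)
    y%:E * \int[mu]_(x in g @^-1` (h @^-1` [set y])) (F x)%:E.
Proof.
transitivity (\int[mu]_x (\sum_(y \in range h)
    ((y * \1_(h @^-1` [set y]) (g x))%:E * (F x)%:E))).
  apply: eq_integral => x _.
  rewrite -ge0_mule_fsuml => [|y]; last exact: nnfun_muleindic_ge0.
  by rewrite fsumEFin // -(fimfunE _ (g x)).
rewrite ge0_integral_fsum//; last 2 first.
  - move=> y; apply: emeasurable_funM => //; apply/measurable_EFinP => //.
    by apply: measurable_funM => //; apply: measurableT_comp mg.
  - by move=> m y Ey; rewrite mule_ge0 ?lee_fin ?F0// -lee_fin nnfun_muleindic_ge0.
apply: eq_fsbigr => r rhn.
have r0 : (0 <= r)%R by move: rhn; rewrite inE => -[t _ <-].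
under eq_integral do rewrite EFinM -muleA.
rewrite ge0_integralZl//; last 2 first.
- apply/measurable_EFinP; apply: measurable_funM => //.
  by apply: measurableT_comp mg.
- by move=> t Et; rewrite mule_ge0 ?lee_fin ?F0.
congr (_ * _); rewrite [RHS]integral_mkcond; apply: eq_integral => x _.
by rewrite muleC epatch_indic.
Qed.

Lemma integral_density_lim (h : R -> R) (u : {nnsfun R >-> R}^nat) :
  nondecreasing_seq (u : (R -> R)^nat) ->
  (forall x, EFin \o u^~ x @ \oo --> (h x)%:E) ->
  \int[mu]_x (h (g x) * F x)%:E =
  limn (fun n => \int[mu]_x (u n (g x) * F x)%:E).
Proof.
move=> ndu uh.
transitivity (\int[mu]_x limn (fun n => (u n (g x) * F x)%:E)).
  apply: eq_integral => x _; apply/esym/cvg_lim => //.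
  exact: (@cvgeZr _ _ _ _ _ (F x)%:E _ (uh (g x))).
apply: monotone_convergence => //.
- move=> n; apply/measurable_EFinP; apply: measurable_funM => //.
  by apply: measurableT_comp mg.
- by move=> n x _; rewrite lee_fin mulr_ge0.
- move=> x _ a b ab /=; rewrite lee_fin ler_wpM2r//.
  exact/lefP/ndu.
Qed.

End Pushforward.

(** An integral of [h \o g] against a density sees the pair only through the mass of the preimages
    under [g]. Two spaces and two densities are carried because the lemma serves both to pass from a
    law to a density ([integral_law]) and to compare two weights on the same space
    ([ev_mul_eq0]). *)
Lemma eq_integral_density d1 (T1 : measurableType d1)
    (mu1 : {measure set T1 -> \bar R})
    d2 (T2 : measurableType d2) (mu2 : {measure set T2 -> \bar R})
    (g1 F1 : T1 -> R) (g2 F2 : T2 -> R) (h : R -> R) :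
  measurable_fun [set: T1] g1 -> measurable_fun [set: T1] F1 ->
  measurable_fun [set: T2] g2 -> measurable_fun [set: T2] F2 ->
  (forall x, 0 <= F1 x)%R -> (forall x, 0 <= F2 x)%R ->
  (forall B : set R, measurable B ->
    \int[mu1]_(x in g1 @^-1` B) (F1 x)%:E =
    \int[mu2]_(x in g2 @^-1` B) (F2 x)%:E) ->
  measurable_fun [set: R] h -> (forall x, 0 <= h x)%R ->
  \int[mu1]_x (h (g1 x) * F1 x)%:E = \int[mu2]_x (h (g2 x) * F2 x)%:E.
Proof.
move=> mg1 mF1 mg2 mF2 F10 F20 H mh h0.
have mEh : measurable_fun [set: R] (EFin \o h) by exact/measurable_EFinP.
pose u := nnsfun_approx measurableT mEh.
have uh x : EFin \o u^~ x @ \oo --> (h x)%:E.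
  have := @cvg_nnsfun_approx _ _ _ _ measurableT _ mEh _ x Logic.I.
  by apply=> y _; rewrite lee_fin.
have ndu := @nd_nnsfun_approx _ _ _ _ measurableT _ mEh.
rewrite (integral_density_lim mu1 mg1 mF1 F10 ndu uh).
rewrite (integral_density_lim mu2 mg2 mF2 F20 ndu uh).
congr (limn _); apply/funext => n.
rewrite (integral_nnsfun_density mu1 mg1 mF1 F10).
rewrite (integral_nnsfun_density mu2 mg2 mF2 F20); apply: eq_fsbigr => y _.
by rewrite H//; exact: measurable_funPTI.
Qed.

End Density.

Section Moments.
Context d (T : measurableType d) (R : realType) (P : probability T R).
Implicit Types (f g : T -> R) (k : nat).

(* Unlike integrability, this property is stable under products. *)
Definition mom f := measurable_fun [set: T] f /\
  forall k, P.-integrable [set: T] (fun x => (`|f x| ^+ k)%:E).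

(** This is the finite part of an extended integral, hence meaningful only for integrable [f]; the
    [mom] hypotheses guarantee this and [ev_EFin] leads back to the extended reals. *)
Definition ev f : R := \int[P]_x f x.

Lemma mom_meas f : mom f -> measurable_fun [set: T] f.
Proof. by case. Qed.

Lemma integrable_le (f : T -> R) (F : T -> R) : measurable_fun [set: T] f ->
  P.-integrable [set: T] (EFin \o F) -> (forall x, `|f x| <= F x) ->
  P.-integrable [set: T] (EFin \o f).
Proof.
move=> mf iF fF; apply: le_integrable iF => //; first exact/measurable_EFinP.
move=> x _ /=; rewrite lee_fin; apply: le_trans (fF x) _; exact: ler_norm.
Qed.

Lemma mom_bound f (F : nat -> T -> R) : measurable_fun [set: T] f ->
  (forall k, P.-integrable [set: T] (EFin \o F k)) ->
  (forall k x, `|f x| ^+ k <= F k x) -> mom f.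
Proof.
move=> mf iF fF; split => // k; apply: (integrable_le _ (iF k)) => [|x].
  by apply: measurable_funX; apply: measurableT_comp mf.
by rewrite normrX normr_id.
Qed.

Lemma mom_integrable f : mom f -> P.-integrable [set: T] (EFin \o f).
Proof.
case=> mf /(_ 1%N) i1; apply: integrable_le mf i1 _ => x.
by rewrite expr1.
Qed.

Lemma mom_le f g : measurable_fun [set: T] f -> mom g ->
  (forall x, `|f x| <= `|g x|) -> mom f.
Proof.
move=> mf [_ ig] fg; apply: mom_bound mf ig _ => k x.
by rewrite lerXn2r// ?nnegrE.
Qed.

Lemma mom_cst (c : R) : mom (cst c).
Proof.
split => [|k]; first exact: measurable_cst.
exact: (finite_measure_integrable_cst P (`|c| ^+ k)).
Qed.

Lemma exprD_le (a b : R) k : 0 <= a -> 0 <= b ->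
  (a + b) ^+ k <= 2 ^+ k * (a ^+ k + b ^+ k).
Proof.
wlog ab : a b / a <= b => [hw a0 b0|a0 b0].
  have [ab|/ltW ba] := leP a b; first exact: hw.
  by rewrite addrC [_ + b ^+ k]addrC; exact: hw.
apply: (@le_trans _ _ ((2 * b) ^+ k)).
  by rewrite lerXn2r ?nnegrE ?addr_ge0 ?mulr_ge0//; lra.
by rewrite exprMn ler_wpM2l ?exprn_ge0// lerDr exprn_ge0.
Qed.

Lemma mom_add f g : mom f -> mom g -> mom (fun x => f x + g x).
Proof.
move=> [mf itf] [mg itg].
apply: (@mom_bound _ (fun k x => 2 ^+ k * (`|f x| ^+ k + `|g x| ^+ k))).
- exact: measurable_funD.
- move=> k; have := integrableZl measurableT (2 ^+ k)
    (integrableD measurableT (itf k) (itg k)).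
  by apply: eq_integrable.
- move=> k x; apply: le_trans (exprD_le _ _ _) => //.
  by rewrite lerXn2r ?nnegrE ?addr_ge0// ler_normD.
Qed.

Lemma mom_mul f g : mom f -> mom g -> mom (fun x => f x * g x).
Proof.
move=> [mf itf] [mg itg].
apply: (@mom_bound _ (fun k x => `|f x| ^+ (k * 2) + `|g x| ^+ (k * 2))).
- exact: measurable_funM.
- move=> k; have := integrableD measurableT (itf (k * 2)%N) (itg (k * 2)%N).
  by apply: eq_integrable.
- move=> k x; rewrite normrM exprMn !exprM.
  set a := `|f x| ^+ k; set b := `|g x| ^+ k.
  have a0 : 0 <= a by apply: exprn_ge0.
  have b0 : 0 <= b by apply: exprn_ge0.
  nra.
Qed.

Lemma mom_scale (c : R) f : mom f -> mom (fun x => c * f x).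
Proof. exact/mom_mul/mom_cst. Qed.

Lemma mom_opp f : mom f -> mom (fun x => - f x).
Proof.
move=> mf; apply: (mom_le _ mf) => [|x]; last by rewrite normrN.
by apply: measurableT_comp => //; exact: mom_meas.
Qed.

Lemma mom_sub f g : mom f -> mom g -> mom (fun x => f x - g x).
Proof. by move=> mf mg; apply: mom_add mf (mom_opp mg). Qed.

Lemma mom_exp f k : mom f -> mom (fun x => f x ^+ k).
Proof.
move=> mf; elim: k => [|k ih]; first exact: mom_cst.
by under eq_fun do rewrite exprS; exact: mom_mul.
Qed.

Lemma mom_sum (I : eqType) (r : seq I) (Q : pred I) (F : I -> T -> R) :
  (forall i, i \in r -> Q i -> mom (F i)) ->
  mom (fun x => \sum_(i <- r | Q i) F i x).
Proof.
elim: r => [|i r ih] H.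
  by under eq_fun do rewrite big_nil; exact: mom_cst.
under eq_fun do rewrite big_cons.
have ihr : mom (fun x => \sum_(i <- r | Q i) F i x).
  by apply: ih => j jr; apply: H; rewrite inE jr orbT.
case: (boolP (Q i)) => // Qi; apply: mom_add => //; apply: H => //.
exact: mem_head.
Qed.

Lemma mom_prod (I : eqType) (r : seq I) (F : I -> T -> R) :
  (forall i, i \in r -> mom (F i)) -> mom (fun x => \prod_(i <- r) F i x).
Proof.
elim: r => [|i r ih] H.
  by under eq_fun do rewrite big_nil; exact: mom_cst.
under eq_fun do rewrite big_cons.
apply: mom_mul; first by apply: H; exact: mem_head.
by apply: ih => j jr; apply: H; rewrite inE jr orbT.
Qed.

Lemma mom_indic (A : set T) : measurable A -> mom (\1_A : T -> R).
Proof.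
move=> mA; apply: (mom_le _ (mom_cst 1)) => // x.
by rewrite indicE normr1 ger0_norm//; case: (_ \in _).
Qed.

Lemma ev_EFin f : mom f -> (\int[P]_x (f x)%:E)%E = (ev f)%:E.
Proof.
by move=> mf; rewrite fineK//; apply: integrable_fin_num => //; exact: mom_integrable.
Qed.

Lemma ev_cst (c : R) : ev (cst c) = c.
Proof.
rewrite /ev Rintegral_cst//.
by rewrite [X in fine X](_ : _ = 1%E) ?mulr1//; exact: probability_setT.
Qed.

Lemma ev_add f g : mom f -> mom g -> ev (fun x => f x + g x) = ev f + ev g.
Proof. by move=> mf mg; apply: RintegralD => //; exact: mom_integrable. Qed.

Lemma ev_sub f g : mom f -> mom g -> ev (fun x => f x - g x) = ev f - ev g.
Proof. by move=> mf mg; apply: RintegralB => //; exact: mom_integrable. Qed.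

Lemma ev_scale (c : R) f : mom f -> ev (fun x => c * f x) = c * ev f.
Proof. by move=> mf; apply: RintegralZl => //; exact: mom_integrable. Qed.

Lemma ev_le f g : mom f -> mom g -> (forall x, f x <= g x) -> ev f <= ev g.
Proof. by move=> mf mg fg; apply: le_Rintegral => //; exact: mom_integrable. Qed.

Lemma ev_ge0 f : (forall x, 0 <= f x) -> 0 <= ev f.
Proof. by move=> f0; apply: Rintegral_ge0. Qed.

Lemma eq_ev f g : f =1 g -> ev f = ev g.
Proof. by move=> /funext ->. Qed.

Lemma ev_sum (I : eqType) (r : seq I) (Q : pred I) (F : I -> T -> R) :
  (forall i, i \in r -> Q i -> mom (F i)) ->
  ev (fun x => \sum_(i <- r | Q i) F i x) = \sum_(i <- r | Q i) ev (F i).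
Proof.
elim: r => [|i r ih] H.
  by rewrite big_nil -[RHS]ev_cst; apply: eq_ev => x; rewrite big_nil.
rewrite (eq_ev (fun x => big_cons _ _ _ _ _ _)).
rewrite big_cons -ih => [|j jr]; last by apply: H; rewrite inE jr orbT.
case: (boolP (Q i)) => // Qi; rewrite ev_add//.
  by apply: H => //; exact: mem_head.
by apply: mom_sum => j jr; apply: H; rewrite inE jr orbT.
Qed.

End Moments.
Arguments eq_ev {d T R P f g}.

(** * Expectations of products of independent variables *)

Section Independence.
Context d (T : measurableType d) (R : realType) (P : probability T R).
Local Notation mom := (mom P).
Local Notation ev := (ev P).

Lemma mom_indic_comp (B : set R) (g : T -> R) : measurable B -> mom g ->
  mom (fun x => \1_B (g x)).
Proof.
move=> mB mg; apply: (@mom_indic _ _ _ P (g @^-1` B)).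
by rewrite -[X in measurable X]setTI; apply: (mom_meas mg).
Qed.

(** The positive and negative parts of [Psi] are two densities giving equal mass to every preimage
    under [g], so [eq_integral_density] identifies their integrals against nonnegative functions of
    [g]; splitting [g] into its own two parts concludes. *)
Lemma ev_mul_eq0 (g Psi : T -> R) : mom g -> mom Psi ->
  (forall B : set R, measurable B -> ev (fun x => \1_B (g x) * Psi x) = 0) ->
  ev (fun x => g x * Psi x) = 0.
Proof.
move=> mg mPsi H.
have mpos (f : T -> R) : mom f -> mom (fun x => Num.max (f x) 0).
  move=> mf; apply: (mom_le _ mf) => [|x].
    by apply: (@measurable_maxr _ _ _ _ f (cst 0)) => //; exact: (mom_meas mf).
  by case: (leP (f x) 0) => // h; rewrite normr0.
pose F1 := fun x => Num.max (Psi x) 0; pose F2 := fun x => Num.max (- Psi x) 0.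
have PsiE x : Psi x = F1 x - F2 x.
  rewrite /F1 /F2; case: (leP (Psi x) 0) => h.
    by rewrite max_l ?oppr_ge0// sub0r opprK.
  by rewrite max_r ?subr0// oppr_le0 ltW.
have F1m : mom F1 by exact: mpos.
have F2m : mom F2 by apply: mpos; exact: mom_opp.
have F10 x : 0 <= F1 x by rewrite /F1 le_max lexx orbT.
have F20 x : 0 <= F2 x by rewrite /F2 le_max lexx orbT.
have F12 (B : set R) : measurable B ->
    (\int[P]_(x in g @^-1` B) (F1 x)%:E = \int[P]_(x in g @^-1` B) (F2 x)%:E)%E.
  move=> mB.
  have E F : mom F -> (\int[P]_(x in g @^-1` B) (F x)%:E =
      (ev (fun x => \1_B (g x) * F x))%:E)%E.
    move=> mF; rewrite -ev_EFin; last by apply: mom_mul => //; exact: mom_indic_comp.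
    rewrite integral_mkcond; apply: eq_integral => x _.
    by rewrite epatch_indic EFinM muleC.
  rewrite !E//; congr EFin; apply/eqP; rewrite -subr_eq0 -ev_sub; last 2 first.
  - by apply: mom_mul => //; exact: mom_indic_comp.
  - by apply: mom_mul => //; exact: mom_indic_comp.
  apply/eqP; rewrite -[RHS](H _ mB); apply: eq_ev => x.
  by rewrite PsiE mulrBr.
(* The bound by [|x|] lets [h \o g] inherit all moments from [g]; [hp] and [hn] both satisfy it. *)
have key (h : R -> R) : measurable_fun [set: R] h -> (forall x, 0 <= h x) ->
    (forall x, h x <= `|x|) -> ev (fun x => h (g x) * Psi x) = 0.
  move=> mh h0 hle.
  have mhg : mom (fun x => h (g x)).
    apply: (mom_le _ mg) => [|x]; last by rewrite ger0_norm.
    by apply: measurableT_comp => //; exact: (mom_meas mg).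
  rewrite (eq_ev (g := fun x => h (g x) * F1 x - h (g x) * F2 x)); last first.
    by move=> x; rewrite PsiE mulrBr.
  rewrite ev_sub; [|exact: mom_mul|exact: mom_mul].
  apply/eqP; rewrite subr_eq0; apply/eqP/EFin_inj.
  rewrite -!ev_EFin; [|exact: mom_mul|exact: mom_mul].
  by apply: eq_integral_density => //; [exact: (mom_meas mg)|exact: (mom_meas F1m)|exact: (mom_meas mg)|exact: (mom_meas F2m)].
pose hp (y : R) := Num.max y 0; pose hn (y : R) := Num.max (- y) 0.
rewrite (eq_ev (g := fun x => hp (g x) * Psi x - hn (g x) * Psi x)); last first.
  move=> x; rewrite -mulrBl; congr (_ * _); rewrite /hp /hn.
  case: (leP (g x) 0) => h.
    by rewrite max_l ?oppr_ge0// sub0r opprK.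
  by rewrite max_r ?subr0// oppr_le0 ltW.
rewrite ev_sub; last 2 first.
- by apply: mom_mul => //; exact: mpos.
- by apply: mom_mul => //; apply: mpos; exact: mom_opp.
have mhp : measurable_fun [set: R] hp.
  exact: (@measurable_maxr _ _ _ _ id (cst 0)).
have mhn : measurable_fun [set: R] hn.
  by apply: (@measurable_maxr _ _ _ _ (@GRing.opp R) (cst 0)).
rewrite (key hp) ?(key hn) ?subr0//.
- by move=> y; rewrite /hn le_max lexx orbT.
- by move=> y; rewrite /hn ge_max normr_ge0 andbT -normrN ler_norm.
- by move=> y; rewrite /hp le_max lexx orbT.
- by move=> y; rewrite /hp ge_max normr_ge0 andbT ler_norm.
Qed.

(** Subtracting [c] from [Phi] reduces this to [ev_mul_eq0]. It is the induction step that turns one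
    indicator into a variable. *)
Lemma ev_mul_indep (g Phi : T -> R) (c : R) : mom g -> mom Phi ->
  (forall B : set R, measurable B ->
    ev (fun x => \1_B (g x) * Phi x) = c * ev (fun x => \1_B (g x))) ->
  ev (fun x => g x * Phi x) = c * ev g.
Proof.
move=> mg mPhi H; apply/eqP; rewrite -subr_eq0 -ev_scale// -ev_sub; last 2 first.
- exact: mom_mul.
- exact: mom_scale.
rewrite (eq_ev (g := fun x => g x * (Phi x - c))); last first.
  by move=> x; rewrite mulrBr [c * _]mulrC.
apply/eqP/ev_mul_eq0 => //; first by apply: mom_sub => //; exact: mom_cst.
move=> B mB; have mBg := mom_indic_comp mB mg.
rewrite (eq_ev (g := fun x => \1_B (g x) * Phi x - c * \1_B (g x))); last first.
  by move=> x; rewrite mulrBr [c * _]mulrC.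
rewrite ev_sub; [|exact: mom_mul|exact: mom_scale].
by rewrite H// ev_scale// subrr.
Qed.

Lemma prod_indic (I : eqType) (r : seq I) (E : I -> set T) x :
  \prod_(i <- r) \1_(E i) x = \1_(\bigcap_(i in [set` r]) E i) x :> R.
Proof.
elim: r => [|i r ih].
  by rewrite big_nil indicE mem_set// => i; rewrite /= in_nil.
rewrite big_cons {}ih -[LHS]/((\1_(E i) \* \1__) x) -indicI; congr (\1__ x).
apply/seteqP; split => [y [Ei Er] j /=|y H].
  by rewrite inE => /orP[/eqP->//|]; exact: Er.
split; first by apply: H; rewrite /= mem_head.
by move=> j /= jr; apply: H; rewrite /= inE jr orbT.
Qed.

Variables (I : eqType) (D : set I) (Fam : I -> set (set T)).
Hypothesis indep : mutually_independent P D Fam.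

Let adapted (u : I -> T -> R) i := [/\ D i, mom (u i)
  & forall B : set R, measurable B -> Fam i (u i @^-1` B)].

Lemma ev_prod_indic (u : I -> T -> R) (r : seq I) (B : I -> set R) :
  (forall i, measurable (B i)) -> uniq r -> (forall i, i \in r -> adapted u i) ->
  ev (fun x => \prod_(i <- r) \1_(B i) (u i x)) =
    \prod_(i <- r) ev (fun x => \1_(B i) (u i x)).
Proof.
move=> mB ur H; apply: EFin_inj.
have mE i : i \in r -> measurable (u i @^-1` B i).
  move=> /H[_ mu _]; rewrite -[X in measurable X]setTI; exact: (mom_meas mu).
have evP i : i \in r -> (ev (fun x => \1_(B i) (u i x)))%:E = P (u i @^-1` B i).
  move=> ir; rewrite -ev_EFin; last by apply: mom_indic_comp; have [] := H _ ir.
  by rewrite (integral_indic P measurableT (mE _ ir)) setIT.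
transitivity (\prod_(i <- r) P (u i @^-1` B i))%E; last first.
  elim: (r) evP => [|i s ih] evP; first by rewrite !big_nil.
  rewrite !big_cons EFinM evP ?mem_head// ih// => j js.
  by rewrite evP// inE js orbT.
rewrite -(indep ur); last by move=> i /H[Di _ Fi]; split => //; exact: Fi.
rewrite -ev_EFin; last first.
  by apply: mom_prod => i ir; apply: mom_indic_comp; have [] := H _ ir.
under eq_integral do rewrite (prod_indic r (fun i => u i @^-1` B i)).
rewrite integral_indic// ?setIT//.
by apply: fin_bigcap_measurable => // i /=; exact: mE.
Qed.

(** The mixed form is the induction hypothesis: for [r1] empty it is the product formula for events,
    and each step moves one index from the indicators to the variables. *)
Lemma ev_prod_prod_indic (u : I -> T -> R) (r1 r2 : seq I) (B : I -> set R) :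
  (forall i, measurable (B i)) -> uniq (r1 ++ r2) ->
  (forall i, i \in r1 ++ r2 -> adapted u i) ->
  ev (fun x => (\prod_(i <- r1) u i x) * \prod_(i <- r2) \1_(B i) (u i x)) =
    (\prod_(i <- r1) ev (u i)) * \prod_(i <- r2) ev (fun x => \1_(B i) (u i x)).
Proof.
elim: r1 r2 B => [|i r1 ih] r2 B mB ur H.
  rewrite big_nil mul1r -ev_prod_indic//; apply: eq_ev => x.
  by rewrite big_nil mul1r.
have [Di mui Fi] := H i (mem_head _ _).
pose Phi x := (\prod_(j <- r1) u j x) * \prod_(j <- r2) \1_(B j) (u j x).
have mPhi : mom Phi.
  apply: mom_mul; apply: mom_prod => j jr; last apply: mom_indic_comp => //;
    by have [] := H j; rewrite // in_cons mem_cat jr ?orbT.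
rewrite (eq_ev (g := fun x => u i x * Phi x)); last first.
  by move=> x; rewrite big_cons /Phi mulrA.
rewrite big_cons -mulrA mulrC.
move: ur; rewrite cat_cons cons_uniq mem_cat negb_or -andbA => /and3P[ir1 ir2 ur].
apply: ev_mul_indep => // A mA.
(* The index [i] is absent from [r2], so its slot in [B] is free to hold the test set [A]. *)
pose B' j := if j == i then A else B j.
have B'i : B' i = A by rewrite /B' eqxx.
have B'r j : j \in r2 -> B' j = B j.
  by rewrite /B'; case: eqP => // -> /(negP ir2).
have mB' j : measurable (B' j) by rewrite /B'; case: eqP.
have H' j : j \in r1 ++ i :: r2 -> adapted u j.
  move=> jr; apply: H; move: jr; rewrite !(inE, mem_cat).
  by case: eqP; case: (j \in r1); case: (j \in r2).
have ur' : uniq (r1 ++ i :: r2).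
  rewrite -cat1s (perm_uniq (permEl (perm_catCA r1 [:: i] r2))) /=.
  by rewrite mem_cat negb_or ir1 ir2.
have := ih (i :: r2) B' mB' ur' H'.
rewrite big_cons B'i => E.
transitivity (ev (fun x => \prod_(j <- r1) u j x *
    \prod_(j <- (i :: r2)) \1_(B' j) (u j x))).
  apply: eq_ev => x; rewrite big_cons B'i mulrCA; congr (_ * (_ * _)).
  by apply: eq_big_seq => j /B'r ->.
rewrite E -mulrA [_ * ev _]mulrC; congr (_ * (_ * _)).
by apply: eq_big_seq => j /B'r ->.
Qed.

Lemma ev_prod (u : I -> T -> R) (r : seq I) : uniq r ->
  (forall i, i \in r -> adapted u i) ->
  ev (fun x => \prod_(i <- r) u i x) = \prod_(i <- r) ev (u i).
Proof.
move=> ur H; have := @ev_prod_prod_indic u r [::] (fun=> setT).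
rewrite cats0 !big_nil mulr1 => <- //.
by apply: eq_ev => x; rewrite big_nil mulr1.
Qed.

End Independence.

Section ProductBound.
Context d (T : measurableType d) (R : realType) (P : probability T R).
Variables (I : eqType) (D : set I) (Fam : I -> set (set T)).
Hypothesis indep : mutually_independent P D Fam.

(* Truncating the factors at [n] makes them bounded, so that [ev_prod] applies. *)
Lemma integral_prod_le (u : I -> T -> R) (B : I -> R) (r : seq I) : uniq r ->
  (forall i, i \in r -> [/\ D i, measurable_fun [set: T] (u i),
    forall x, 0 <= u i x, forall A : set R, measurable A -> Fam i (u i @^-1` A)
    & (\int[P]_x (u i x)%:E <= (B i)%:E)%E]) ->
  (\int[P]_x (\prod_(i <- r) u i x)%:E <= (\prod_(i <- r) B i)%:E)%E.
Proof.
move=> ur H.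
pose v (n : nat) i x := Num.min (u i x) n%:R.
have mmin n : measurable_fun [set: R] (fun y : R => Num.min y n%:R).
  exact: (@measurable_minr _ _ _ _ id (cst n%:R)).
have v0 n i x : i \in r -> 0 <= v n i x.
  by move=> /H[_ _ u0 _ _]; rewrite le_min u0/=.
have mv n i : i \in r -> mom P (v n i).
  move=> ir; have [_ mu u0 _ _] := H _ ir.
  apply: (mom_le _ (mom_cst P n%:R)) => [|x].
    exact: (measurableT_comp (mmin n) mu).
  by rewrite ger0_norm ?v0// ger0_norm// ge_min lexx orbT.
have evv n : ev P (fun x => \prod_(i <- r) v n i x) = \prod_(i <- r) ev P (v n i).
  apply: (ev_prod indep ur) => i ir; have [Di mu _ Fu _] := H _ ir.
  split => // [|A mA]; first exact: mv.
  apply: (Fu ((fun y => Num.min y n%:R) @^-1` A)).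
  by rewrite -[X in measurable X]setTI; exact: mmin.
have lim x : (\prod_(i <- r) v n i x)%:E @[n --> \oo] -->
    (\prod_(i <- r) u i x)%:E.
  apply: cvg_near_cst.
  near=> n; congr EFin; apply: eq_big_seq => i ir; rewrite /v min_l//.
  apply: (@le_trans _ _ (\sum_(j <- r) `|u j x|)).
    rewrite (big_rem i ir)/=; apply: le_trans (ler_norm _) _.
    by rewrite lerDl sumr_ge0.
  by near: n; exact: nbhs_infty_ger.
have -> : (\int[P]_x (\prod_(i <- r) u i x)%:E =
    \int[P]_x limn (fun n => (\prod_(i <- r) v n i x)%:E))%E.
  by apply: eq_integral => x _; apply/esym/cvg_lim => //; exact: lim.
have mprod n : mom P (fun x => \prod_(i <- r) v n i x) by apply: mom_prod => i; exact: mv.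
have nd x : {homo (fun n => (\prod_(i <- r) v n i x)%:E) : a b / (a <= b)%N >-> (a <= b)%E}.
  move=> a b ab; rewrite lee_fin big_seq [leRHS]big_seq; apply: ler_prod => i ir.
  rewrite v0//= /v le_min !ge_min lexx/=.
  by rewrite ler_nat ab orbT.
rewrite monotone_convergence; first last.
- by move=> x _ a b ab; exact: nd.
- by move=> n x _; rewrite lee_fin big_seq; apply: prodr_ge0 => i ir; exact: v0.
- by move=> n; apply/measurable_EFinP; exact: (mom_meas (mprod n)).
- exact: measurableT.
apply: lime_le.
  apply: ereal_nondecreasing_is_cvgn => a b ab; apply: ge0_le_integral => //.
  - by move=> x _; rewrite lee_fin big_seq; apply: prodr_ge0 => i ir; exact: v0.
  - by apply/measurable_EFinP; exact: (mom_meas (mprod a)).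
  - by apply/measurable_EFinP; exact: (mom_meas (mprod b)).
  - by move=> x _; exact: nd.
apply: nearW => n; rewrite ev_EFin ?evv ?lee_fin//.
rewrite big_seq [leRHS]big_seq; apply: ler_prod => i ir; apply/andP; split.
  by apply: ev_ge0 => x; exact: v0.
have [_ mu u0 _ uB] := H _ ir.
rewrite -lee_fin -ev_EFin; last exact: mv.
apply: le_trans uB.
apply: ge0_le_integral => //.
- by move=> x _; rewrite lee_fin v0.
- by apply/measurable_EFinP; exact: (mom_meas (mv n _ ir)).
- exact/measurable_EFinP.
- by move=> x _; rewrite lee_fin ge_min lexx.
Unshelve. all: by end_near. Qed.

End ProductBound.

(** * Normal and Laplace laws *)

Section Exponential.
Context (R : realType).
Implicit Types x y : R.

Lemma exprn_le_expR x n : 0 <= x -> x ^+ n <= n`!%:R * expR x.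
Proof.
move=> x0; case: n => [|n]; first by rewrite fact0 mul1r expr0 -expR0 ler_expR.
rewrite mulrC -ler_pdivrMr ?ltr0n ?fact_gt0//.
by apply: le_trans (expR_ge1Dxn n x0); rewrite lerDr.
Qed.

(** The tail is compared termwise with [|x| ^+ n / n!] times the exponential series, because
    [(k + n)!] is a multiple of [k! n!]. *)
Lemma expR_taylor n x :
  `|expR x - \sum_(0 <= k < n) x ^+ k / k`!%:R| <=
    `|x| ^+ n / n`!%:R * expR `|x|.
Proof.
have cx := is_cvg_series_exp_coeff x.
have c1 : (fun N => `|series (exp_coeff x) N -
    \sum_(0 <= k < n) x ^+ k / k`!%:R|) @ \oo -->
    `|expR x - \sum_(0 <= k < n) x ^+ k / k`!%:R|.
  by apply: cvg_norm; apply: cvgB; [exact: cx|exact: cvg_cst].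
apply: (cvgr_to_le c1).
near=> N; have nN : (n <= N)%N by near: N; exists n.
rewrite /series/= (big_cat_nat (leq0n n) nN)/= addrAC subrr add0r.
apply: (le_trans (ler_norm_sum _ _ _)).
rewrite -{1}(subnK nN) -{1}[n]add0n big_addn addnK.
have -> : expR `|x| = limn (series (exp_coeff `|x|)) by [].
have le2 : series (exp_coeff `|x|) (N - n)%N <= limn (series (exp_coeff `|x|)).
  apply: nondecreasing_cvgn_le; last exact: is_cvg_series_exp_coeff.
  apply/nondecreasing_seqP => k; rewrite /series/= big_nat_recr//= lerDl.
  exact: exp_coeff_ge0.
have n0 : 0 <= `|x| ^+ n / n`!%:R by rewrite mulr_ge0 ?exprn_ge0 ?invr_ge0.
apply: le_trans (ler_wpM2l n0 le2).
rewrite /series/= mulr_sumr; apply: ler_sum => k _.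
  rewrite normrM normrX normfV normr_nat /exp_coeff/= exprD.
  rewrite [leRHS]mulrACA [`|x| ^+ n * _]mulrC ler_wpM2l//.
  rewrite -invfM -natrM lef_pV2 ?posrE ?ltr0n ?muln_gt0 ?fact_gt0// ler_nat.
  have := bin_fact (leq_addl k n); rewrite addnK => <-.
  by rewrite leq_pmull// bin_gt0 leq_addl.
Unshelve. all: by end_near. Qed.

Lemma expR_norm_le x : expR `|x| <= expR x + expR (- x).
Proof.
have := expR_ge0 x; have := expR_ge0 (- x).
by case: (ger0P x) => _; lra.
Qed.

(** The odd terms cancel and leave a remainder of order 6. In [normal_moments] this is cubic in the
    square of the argument, just enough to identify the second and fourth moments. *)
Lemma cosh_taylor x :
  `|2^-1 * (expR x + expR (- x)) - (1 + x ^+ 2 / 2 + x ^+ 4 / 24)| <=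
    `|x| ^+ 6 * expR `|x|.
Proof.
have tay y : `|expR y - (1 + y + y ^+ 2 / 2 + y ^+ 3 / 6 + y ^+ 4 / 24 +
    y ^+ 5 / 120)| <= `|y| ^+ 6 * expR `|y|.
  apply: le_trans (_ : _ <= `|y| ^+ 6 / 6`!%:R * expR `|y|) _; last first.
    by rewrite ler_wpM2r ?expR_ge0// ler_piMr ?exprn_ge0// invf_le1 ?ler1n.
  apply: le_trans (expR_taylor 6 y); rewrite le_eqVlt; apply/orP; left; apply/eqP.
  congr (`|_ - _|); rewrite !(big_nat_recl _ _ _ (leq0n _)) big_geq//=.
  by rewrite (_ : 2`! = 2)%N// (_ : 3`! = 6)%N// (_ : 4`! = 24)%N// (_ : 5`! = 120)%N// fact0 (_ : 1`! = 1)%N//; field.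
have -> : 2^-1 * (expR x + expR (- x)) - (1 + x ^+ 2 / 2 + x ^+ 4 / 24) =
  2^-1 * ((expR x - (1 + x + x ^+ 2 / 2 + x ^+ 3 / 6 + x ^+ 4 / 24 + x ^+ 5 / 120)) +
  (expR (- x) - (1 + - x + (- x) ^+ 2 / 2 + (- x) ^+ 3 / 6 + (- x) ^+ 4 / 24 +
     (- x) ^+ 5 / 120))) by field.
rewrite normrM gtr0_norm// ler_pdivrMl//.
apply: le_trans (ler_normD _ _) _.
have := lerD (tay x) (tay (- x)); rewrite normrN; lra.
Qed.

End Exponential.

Section Laws.
Context d (T : measurableType d) (R : realType) (P : probability T R).
Local Notation mu := (@lebesgue_measure R).
Local Notation mom := (mom P).
Local Notation ev := (ev P).

(** Generic in [nu] because a normal law is either a point mass, with [nu] a Dirac measure and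
    density 1, or has a density with respect to Lebesgue measure. *)
Lemma integral_law d' (T' : measurableType d') (nu : {measure set T' -> \bar R})
    (Y : T -> R) (g F : T' -> R) (h : R -> R) :
  measurable_fun [set: T] Y -> measurable_fun [set: T'] g ->
  measurable_fun [set: T'] F -> (forall x, 0 <= F x) ->
  (forall A : set R, measurable A ->
    P (Y @^-1` A) = (\int[nu]_(x in g @^-1` A) (F x)%:E)%E) ->
  measurable_fun [set: R] h -> (forall x, 0 <= h x) ->
  (\int[P]_x (h (Y x))%:E = \int[nu]_x (h (g x) * F x)%:E)%E.
Proof.
move=> mY mg mF F0 H mh h0.
transitivity (\int[P]_x (h (Y x) * cst 1 x)%:E)%E.
  by apply: eq_integral => x _; rewrite mulr1.
apply: eq_integral_density => // B mB.
have mYB : measurable (Y @^-1` B) by rewrite -[X in measurable X]setTI; exact: mY.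
by rewrite -H// -[RHS]mul1e -(integral_cst P mYB).
Qed.

Lemma ge0_integrable (f : T -> R) (c : R) : measurable_fun [set: T] f ->
  (forall x, 0 <= f x) -> (\int[P]_x (f x)%:E <= c%:E)%E ->
  P.-integrable [set: T] (EFin \o f).
Proof.
move=> mf f0 fc; apply/integrableP; split; first exact/measurable_EFinP.
apply: le_lt_trans (ltry c); apply: le_trans fc.
by under eq_integral do rewrite /= ger0_norm//.
Qed.

Lemma mom_of_expR (f : T -> R) (a c : R) : measurable_fun [set: T] f -> 0 < a ->
  (\int[P]_x (expR (a * `|f x|))%:E <= c%:E)%E -> mom f.
Proof.
move=> mf a0 fc.
have mE : measurable_fun [set: T] (fun x => expR (a * `|f x|)).
  apply: measurableT_comp => //; apply: measurable_funM => //.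
  exact: measurableT_comp mf.
have iE := ge0_integrable mE (fun x => expR_ge0 _) fc.
apply: (@mom_bound _ _ _ _ _ (fun k x => (a ^- k * k`!%:R) * expR (a * `|f x|))) => //.
  by move=> k; exact: (integrableZl measurableT (a ^- k * k`!%:R) iE).
move=> k x; rewrite -mulrA ler_pdivlMl ?exprn_gt0// -exprMn.
by apply: exprn_le_expR; rewrite mulr_ge0// ltW.
Qed.

End Laws.

Section Gaussian.
Context d (T : measurableType d) (R : realType) (P : probability T R).
Local Notation mu := (@lebesgue_measure R).
Local Notation mom := (mom P).
Local Notation ev := (ev P).
Variables (Y : T -> R) (m s : R).
Hypothesis mY : measurable_fun [set: T] Y.
Hypothesis lawY : normal_law P Y m s.

(** Completing the square: an exponential tilt of a normal density is a multiple of a shifted one,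
    so the moment generating function needs only the total mass of a normal density. *)
Lemma normal_pdf_shift (t x : R) : s != 0 ->
  expR (t * x) * normal_pdf m s x =
  expR (m * t + t ^+ 2 * s ^+ 2 / 2) * normal_pdf (m + t * s ^+ 2) s x.
Proof.
move=> s0; rewrite !normal_pdfE//= mulrCA [RHS]mulrCA; congr (_ * _).
rewrite /normal_fun -!expRD; congr expR.
by field.
Qed.

Lemma normal_mgf_integral (t : R) :
  (\int[P]_x (expR (t * Y x))%:E = (expR (m * t + t ^+ 2 * s ^+ 2 / 2))%:E)%E.
Proof.
have mh : measurable_fun [set: R] (fun x => expR (t * x)).
  by apply: measurableT_comp => //; exact: measurable_funM.
have [s0|s0] := eqVneq s 0.
  rewrite (@integral_law _ _ _ P _ _ (\d_m) Y id (cst 1) (fun x => expR (t * x)))//; last first.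
    by move=> A mA; rewrite lawY// s0 eqxx -[LHS]mul1e -(integral_cst _ mA).
  rewrite integral_dirac//=; last first.
    by apply/measurable_EFinP; exact: measurable_funM.
  by rewrite diracT mul1e mulr1 s0 expr0n/= mulr0 mul0r addr0 mulrC.
rewrite (@integral_law _ _ _ P _ _ mu Y id (normal_pdf m s) (fun x => expR (t * x)))//; last 3 first.
- exact: measurable_normal_pdf.
- by move=> x; exact: normal_pdf_ge0.
- by move=> A mA; rewrite lawY// (negbTE s0).
under eq_integral do rewrite normal_pdf_shift// EFinM.
rewrite ge0_integralZl//=.
- by rewrite integral_normal_pdf mule1.
- by apply/measurable_EFinP; exact: measurable_normal_pdf.
- by move=> x _; rewrite lee_fin normal_pdf_ge0.
Qed.

Lemma mom_normal : mom Y.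
Proof.
apply: (@mom_of_expR _ _ _ P Y 1 (expR (m + s ^+ 2 / 2) + expR (- m + s ^+ 2 / 2))) => //.
have mE (t : R) : measurable_fun [set: T] (fun x => (expR (t * Y x))%:E).
  apply/measurable_EFinP; apply: measurableT_comp => //.
  exact: measurable_funM.
have := normal_mgf_integral 1; have := normal_mgf_integral (- 1).
rewrite !mulr1 sqrrN !expr1n !mul1r mulrN1 => eN e1.
rewrite EFinD -e1 -eN -ge0_integralD//.
apply: ge0_le_integral => //.
- apply/measurable_EFinP; apply: measurableT_comp => //.
  by apply: measurable_funM => //; exact: measurableT_comp mY.
- exact: emeasurable_funD.
- by move=> x _; rewrite -EFinD lee_fin !mul1r mulN1r expR_norm_le.
Qed.

Lemma mom_expR_normal (t : R) : mom (fun x => expR (t * Y x)).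
Proof.
have mE (r : R) : measurable_fun [set: T] (fun x => expR (r * Y x)).
  apply: measurableT_comp => //; exact: measurable_funM.
split => // k; apply: (@ge0_integrable _ _ _ P _ (expR (m * (k%:R * t) + (k%:R * t) ^+ 2 * s ^+ 2 / 2))).
- by apply: measurable_funX; apply: measurableT_comp => //.
- by move=> x; apply: exprn_ge0.
- rewrite -normal_mgf_integral; under eq_integral do rewrite ger0_norm ?expR_ge0// -expRM_natl mulrA.
  by [].
Qed.

Lemma normal_mgf (t : R) :
  ev (fun x => expR (t * Y x)) = expR (m * t + t ^+ 2 * s ^+ 2 / 2).
Proof.
by apply: EFin_inj; rewrite -ev_EFin ?normal_mgf_integral//; exact: mom_expR_normal.
Qed.

(* The moment generating function dominates [1 + t * ev Y], whose slope at [0]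
   determines the mean. *)
Lemma normal_centered : ev Y = 0 -> m = 0.
Proof.
move=> Y0.
have key t : 0 <= m * t + t ^+ 2 * s ^+ 2 / 2.
  have : ev (fun x => 1 + t * Y x) <= ev (fun x => expR (t * Y x)).
    apply: ev_le => [||x]; last exact: expR_ge1Dx.
      by apply: mom_add; [exact: mom_cst|exact/mom_scale/mom_normal].
    exact: mom_expR_normal.
  rewrite ev_add; [|exact: mom_cst|exact/mom_scale/mom_normal].
  rewrite ev_cst ev_scale; last exact: mom_normal.
  by rewrite Y0 mulr0 addr0 normal_mgf !leNgt expR_lt1.
have [s0|s0] := eqVneq s 0.
  have := key (- m); rewrite s0 expr0n/= mulr0 mul0r addr0 mulrN oppr_ge0.
  by rewrite -expr2 => h; apply/eqP; rewrite -sqrf_eq0 eq_le sqr_ge0 andbT.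
have s20 : 0 < s ^+ 2 by rewrite exprn_even_gt0.
(* The minimizer of the quadratic in [t]; the minimum is negative unless [m = 0]. *)
have := key (- m / s ^+ 2).
have -> : m * (- m / s ^+ 2) + (- m / s ^+ 2) ^+ 2 * s ^+ 2 / 2 =
   - (m ^+ 2 / (2 * s ^+ 2)) by field.
rewrite oppr_ge0 => h; apply/eqP; rewrite -sqrf_eq0 eq_le sqr_ge0 andbT.
by move: h; rewrite pmulr_lle0// invr_gt0 mulr_gt0.
Qed.

End Gaussian.

Section GaussianMoments.
Context d (T : measurableType d) (R : realType) (P : probability T R).
Local Notation mom := (mom P).
Local Notation ev := (ev P).

Lemma le_mul_small (a C : R) : 0 <= C ->
  (forall u, 0 < u -> u <= 1 -> `|a| <= C * u) -> a = 0.
Proof.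
move=> C0 H; apply/eqP; apply: contraT => a0.
have na0 : 0 < `|a| by rewrite normr_gt0.
set u := `|a| / (2 * (C + `|a|)).
have uE : u * (2 * (C + `|a|)) = `|a|.
  by rewrite divfK// gt_eqF// mulr_gt0// ltr_wpDl.
have u0 : 0 < u by rewrite divr_gt0// mulr_gt0// ltr_wpDl.
have u1 : u <= 1 by rewrite ler_pdivrMr ?mulr_gt0// ?ltr_wpDl//; lra.
have := H u u0 u1; nra.
Qed.

Lemma quadratic_vanish (a b E : R) : 0 <= E ->
  (forall u, 0 < u -> u <= 1 -> `|a * u + b * u ^+ 2| <= E * u ^+ 3) ->
  a = 0 /\ b = 0.
Proof.
move=> E0 H.
have a0 : a = 0.
  apply: (@le_mul_small _ (`|b| + E)) => [|u u0 u1]; first by rewrite addr_ge0.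
  have h := H u u0 u1.
  have h1 : `|a| * u <= `|b| * u ^+ 2 + E * u ^+ 3.
    have -> : `|a| * u = `|a * u| by rewrite normrM (gtr0_norm u0).
    have -> : `|b| * u ^+ 2 = `|b * u ^+ 2|.
      by rewrite normrM (ger0_norm (sqr_ge0 u)).
    have := ler_normB (a * u + b * u ^+ 2) (b * u ^+ 2).
    by rewrite addrK => /le_trans; apply; rewrite addrC lerD2l.
  rewrite -(ler_pM2r u0); apply: le_trans h1 _.
  have : E * u ^+ 3 <= E * u ^+ 2.
    by rewrite ler_wpM2l// exprS ler_piMl ?sqr_ge0.
  by rewrite -mulrA -expr2 mulrDl lerD2l.
split=> //; apply: (le_mul_small E0) => u u0 u1.
have := H u u0 u1; rewrite a0 mul0r add0r normrM (ger0_norm (sqr_ge0 u)).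
by rewrite [u ^+ 3]exprS [E * _]mulrA ler_pM2r// exprn_gt0.
Qed.

(** The mean of [cosh (t Y)] is expanded twice, once under the expectation and once from its closed
    form [expR (t ^+ 2 * s ^+ 2 / 2)]. The expansions agree up to [O(t ^+ 6)], and
    [quadratic_vanish] at [u = t ^+ 2] compares their coefficients. *)
Lemma normal_moments (Y : T -> R) (s : R) : measurable_fun [set: T] Y ->
  normal_law P Y 0 s ->
  ev (fun x => Y x ^+ 2) = s ^+ 2 /\ ev (fun x => Y x ^+ 4) = 3 * s ^+ 4.
Proof.
move=> mY lawY.
have momY : mom Y := mom_normal mY lawY.
have momE t : mom (fun x => expR (t * Y x)) := mom_expR_normal mY lawY t.
pose W x := Y x ^+ 6 * (expR (1 * Y x) + expR (- 1 * Y x)).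
have momW : mom W by apply: mom_mul; [exact: mom_exp|exact: mom_add].
have W0 x : 0 <= W x.
  by rewrite mulr_ge0 ?addr_ge0 ?expR_ge0//; rewrite exprn_even_ge0.
have D0 : 0 <= ev W by exact: ev_ge0.
set D := ev W in D0.
set m2 := ev (fun x => Y x ^+ 2); set m4 := ev (fun x => Y x ^+ 4).
have cosh t : 0 < t -> t <= 1 ->
   `|expR (t ^+ 2 * s ^+ 2 / 2) - (1 + t ^+ 2 / 2 * m2 + t ^+ 4 / 24 * m4)| <=
   t ^+ 6 * D.
  move=> t0 t1.
  pose L x := 2^-1 * (expR (t * Y x) + expR (- t * Y x)).
  pose Q x := 1 + t ^+ 2 / 2 * Y x ^+ 2 + t ^+ 4 / 24 * Y x ^+ 4.
  have momL : mom L by apply/mom_scale/mom_add.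
  have momQ : mom Q.
    apply: mom_add; last by apply: mom_scale; exact: mom_exp.
    by apply: mom_add; [exact: mom_cst|apply: mom_scale; exact: mom_exp].
  have -> : expR (t ^+ 2 * s ^+ 2 / 2) = ev L.
    rewrite ev_scale; last exact: mom_add.
    by rewrite ev_add// !(normal_mgf mY lawY) !mul0r !add0r sqrrN; lra.
  have -> : 1 + t ^+ 2 / 2 * m2 + t ^+ 4 / 24 * m4 = ev Q.
    rewrite ev_add; last by apply: mom_scale; exact: mom_exp.
      rewrite ev_add; [|exact: mom_cst|by apply: mom_scale; exact: mom_exp].
      by rewrite ev_cst !ev_scale//; exact: mom_exp.
    by apply: mom_add; [exact: mom_cst|apply: mom_scale; exact: mom_exp].
  have bnd x : `|L x - Q x| <= t ^+ 6 * W x.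
    have -> : L x = 2^-1 * (expR (t * Y x) + expR (- (t * Y x))).
      by rewrite /L mulNr.
    have -> : Q x = 1 + (t * Y x) ^+ 2 / 2 + (t * Y x) ^+ 4 / 24.
      by rewrite /Q; field.
    apply: (le_trans (cosh_taylor _)).
    have -> : `|t * Y x| ^+ 6 = t ^+ 6 * Y x ^+ 6.
      by rewrite -normrX exprMn ger0_norm// mulr_ge0// exprn_even_ge0.
    rewrite -mulrA ler_wpM2l ?exprn_ge0 ?(ltW t0)// /W.
    rewrite ler_wpM2l ?exprn_even_ge0//.
    rewrite mul1r mulN1r; apply: le_trans (expR_norm_le _).
    by rewrite ler_expR normrM (gtr0_norm t0) ler_piMl.
  rewrite -ev_sub// ler_norml; apply/andP; split.
    rewrite lerNl -ev_scale// -[X in - X]mul1r -mulNr -ev_scale//; last exact: mom_sub.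
    apply: ev_le => [||x]; [exact/mom_scale/mom_sub|exact: mom_scale|].
    by rewrite mulN1r; have := bnd x; rewrite ler_norml => /andP[]; rewrite lerNl.
  rewrite -ev_scale//; apply: ev_le => [||x]; [exact: mom_sub|exact: mom_scale|].
  by have := bnd x; rewrite ler_norml => /andP[].
(* The sum of the two remainders: [D] comes from the cosh of [Y], the rest from the exponential at
   [u * s ^+ 2 / 2], which is at most [s ^+ 2]. *)
pose E := D + s ^+ 6 * expR (s ^+ 2).
have E0 : 0 <= E.
  by rewrite addr_ge0// mulr_ge0 ?expR_ge0// exprn_even_ge0.
have [h1 h2] : (s ^+ 2 - m2) / 2 = 0 /\ s ^+ 4 / 8 - m4 / 24 = 0.
  apply: (quadratic_vanish E0) => u u0 u1.
  set t := Num.sqrt u.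
  have t2 : t ^+ 2 = u by rewrite sqr_sqrtr// ltW.
  have t4 : t ^+ 4 = u ^+ 2 by rewrite -t2 -exprM.
  have t6 : t ^+ 6 = u ^+ 3 by rewrite -t2 -exprM.
  have t0 : 0 < t by rewrite sqrtr_gt0.
  have t1 : t <= 1 by rewrite -sqrtr1 ler_sqrt.
  have := cosh t t0 t1; rewrite t2 t4 t6 => c1.
  set v := u * s ^+ 2 / 2.
  have v0 : 0 <= v by rewrite divr_ge0// mulr_ge0 ?sqr_ge0// ltW.
  have vs : v <= s ^+ 2.
    by rewrite /v; have := sqr_ge0 s; nra.
  have := expR_taylor 3 v; rewrite !(big_nat_recl _ _ _ (leq0n _)) big_geq//=.
  rewrite (ger0_norm v0) (_ : 3`! = 6)%N// fact0 (_ : 1`! = 1)%N// => c2.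
  have v3 : v ^+ 3 / 6%:R * expR v <= u ^+ 3 * (s ^+ 6 * expR (s ^+ 2)).
    rewrite mulrA; apply: ler_pM; rewrite ?expR_ge0 ?ler_expR//.
      by rewrite divr_ge0// exprn_ge0.
    rewrite (_ : v ^+ 3 / 6%:R = u ^+ 3 * s ^+ 6 * 48^-1); last by rewrite /v; field.
    have us0 : 0 <= u ^+ 3 * s ^+ 6.
      by apply: mulr_ge0; [exact/exprn_ge0/ltW|exact: exprn_even_ge0].
    by rewrite ler_piMr// invf_le1 ?ler1n.
  rewrite [E * _]mulrC /E mulrDr.
  apply: le_trans (lerD c1 (le_trans c2 v3)).
  have -> : (s ^+ 2 - m2) / 2 * u + (s ^+ 4 / 8 - m4 / 24) * u ^+ 2 =
     (expR (u * s ^+ 2 / 2) - (1 + u / 2 * m2 + u ^+ 2 / 24 * m4)) -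
     (expR v - (v ^+ 0 / 1%:R + (v ^+ 1 / 1%:R + (v ^+ 2 / 2`!%:R + 0)))).
    rewrite -/v; by set e := expR v; rewrite /v (_ : 2`! = 2)%N//; field.
  exact: ler_normB.
by split; lra.
Qed.

End GaussianMoments.

Section Laplace.
Context d (T : measurableType d) (R : realType) (P : probability T R).
Local Notation mu := (@lebesgue_measure R).
Local Notation mom := (mom P).
Local Notation ev := (ev P).
Variables (xi : T -> R) (b : R).
Hypothesis mxi : measurable_fun [set: T] xi.
Hypothesis b0 : 0 < b.
Hypothesis law : laplace_law P b xi.

Lemma measurable_laplace_pdf : measurable_fun [set: R] (laplace_pdf b).
Proof.
apply: measurable_funM => //; apply: measurableT_comp => //.
by apply: measurableT_comp => //; apply: measurable_funM.
Qed.

Lemma laplace_pdf_ge0 x : 0 <= laplace_pdf b x.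
Proof. by rewrite mulr_ge0 ?expR_ge0// invr_ge0 mulr_ge0// ltW. Qed.

Lemma laplace_integral (h : R -> R) : measurable_fun [set: R] h ->
  (forall x, 0 <= h x) ->
  (\int[P]_x (h (xi x))%:E = \int[mu]_x (h x * laplace_pdf b x)%:E)%E.
Proof.
move=> mh h0; apply: (@integral_law _ _ _ P _ _ mu xi id) => //.
- exact: measurable_laplace_pdf.
- exact: laplace_pdf_ge0.
Qed.

Lemma integral_expR_norm (r : R) : 0 < r ->
  (\int[mu]_x (r * expR (- (r * `|x|)))%:E = 2%:E)%E.
Proof.
move=> r0; rewrite ge0_symfun_integralT//; last 3 first.
- by move=> x; rewrite mulr_ge0 ?expR_ge0// ltW.
- move=> x; apply: cvgM; first exact: cvg_cst.
  apply: continuous_comp; last exact: continuous_expR.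
  by apply: cvgN; apply: cvgM; [exact: cvg_cst|exact: norm_continuous].
- by move=> x; rewrite /= normrN.
rewrite -[RHS]mule1; congr (_ * _)%E.
rewrite -[RHS](integral_exponential_pdf r0) /exponential_pdf.
rewrite [RHS](_ : _ = \int[mu]_(x in `[0%R, +oo[) (r * expR (- r * x))%:E)%E; last first.
  rewrite [RHS]integral_mkcond; apply: eq_integral => x _.
  by rewrite /patch; case: ifP.
rewrite set_itvcy; apply: eq_integral => x; rewrite inE/= => x0.
by rewrite ger0_norm// mulNr.
Qed.

(** At half of the critical rate [b^-1] the tilted density is the one of [integral_expR_norm] with
    [r = (2 * b)^-1]. All the moment bounds for the noise rest on this identity. *)
Lemma laplace_expR_norm :
  (\int[P]_x (expR ((2 * b)^-1 * `|xi x|))%:E = 2%:E)%E.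
Proof.
rewrite (laplace_integral (h := fun x => expR ((2 * b)^-1 * `|x|)))//; last first.
  apply: measurableT_comp => //; apply: measurable_funM => //.
rewrite -(@integral_expR_norm (2 * b)^-1) ?invr_gt0 ?mulr_gt0//.
apply: eq_integral => x _; rewrite /laplace_pdf mulrCA -expRD.
congr (_ * expR _)%:E.
by field; rewrite gt_eqF.
Qed.

Lemma mom_laplace : mom xi.
Proof.
apply: (@mom_of_expR _ _ _ P xi (2 * b)^-1 2) => //.
  by rewrite invr_gt0 mulr_gt0.
by rewrite laplace_expR_norm.
Qed.

Lemma laplace_symmetric (h : R -> R) : measurable_fun [set: R] h ->
  (forall x, 0 <= h x) ->
  (\int[P]_x (h (xi x))%:E = \int[P]_x (h (- xi x))%:E)%E.
Proof.
move=> mh h0; rewrite laplace_integral//.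
rewrite (laplace_integral (h := fun x => h (- x)))//; last exact: measurableT_comp.
transitivity (\int[pushforward mu (-%R : _ -> measurableTypeR R)]_x
    (h x * laplace_pdf b x)%:E)%E.
  by apply: eq_measure_integral => /= A mA _; exact/esym/lebesgue_measureN.
rewrite ge0_integral_pushforward//=.
- by apply: eq_integral => x _; rewrite /= /laplace_pdf normrN.
- apply/measurable_EFinP; apply: measurable_funM => //.
  exact: measurable_laplace_pdf.
- by move=> x _; rewrite lee_fin mulr_ge0// laplace_pdf_ge0.
Qed.

Lemma ev_laplace : ev xi = 0.
Proof.
have mxi' := mom_laplace.
pose hp (y : R) := Num.max y 0.
have mhp : measurable_fun [set: R] hp.
  exact: (@measurable_maxr _ _ _ _ id (cst 0)).
have hp0 y : 0 <= hp y by rewrite /hp le_max lexx orbT.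
have mm (f : T -> R) : mom f -> mom (fun x => hp (f x)).
  move=> mf; apply: (mom_le _ mf) => [|x].
    by apply: measurableT_comp => //; exact: (mom_meas mf).
  by rewrite ger0_norm// /hp ge_max normr_ge0 ler_norm.
rewrite (eq_ev (g := fun x => hp (xi x) - hp (- xi x))); last first.
  move=> x; rewrite /hp; case: (leP (xi x) 0) => h.
    by rewrite max_l ?oppr_ge0// sub0r opprK.
  by rewrite max_r ?subr0// oppr_le0 ltW.
rewrite ev_sub; [|exact: mm|apply: mm; exact: mom_opp].
apply/eqP; rewrite subr_eq0; apply/eqP/EFin_inj; rewrite -!ev_EFin.
- exact: laplace_symmetric.
- by apply: mm; exact: mom_opp.
- exact: mm.
Qed.

Let iE : P.-integrable [set: T] (EFin \o (fun x => expR ((2 * b)^-1 * `|xi x|))).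
Proof.
apply: (@ge0_integrable _ _ _ P _ 2) => //.
  apply: measurableT_comp => //; apply: measurable_funM => //.
  exact: measurableT_comp.
by rewrite laplace_expR_norm.
Qed.

Let evE : \int[P]_x expR ((2 * b)^-1 * `|xi x|) = 2.
Proof. by rewrite /Rintegral laplace_expR_norm. Qed.

(** The exact value is [2 * b ^+ 2]; the cruder constant comes from [y ^+ 2 <= 2 * expR y] at
    [y = |xi| / (2 b)] and [laplace_expR_norm]. *)
Lemma laplace_second_moment : ev (fun x => xi x ^+ 2) <= 16 * b ^+ 2.
Proof.
rewrite (_ : 16 * b ^+ 2 = (8 * b ^+ 2) * 2); last by ring.
rewrite -evE -RintegralZl//; apply: le_Rintegral => //.
- by apply: mom_integrable; apply: mom_exp; exact: mom_laplace.
- exact: (integrableZl measurableT (8 * b ^+ 2) iE).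
move=> x _; set y := (2 * b)^-1 * `|xi x|.
have -> : xi x ^+ 2 = 4 * b ^+ 2 * y ^+ 2.
  by rewrite -[xi x ^+ 2](ger0_norm (sqr_ge0 _)) normrX /y; field; rewrite gt_eqF.
have y0 : 0 <= y by rewrite mulr_ge0// invr_ge0 mulr_ge0// ltW.
have := exprn_le_expR 2 y0; rewrite (_ : 2`!%:R = 2)// => h.
have := ler_wpM2l (_ : 0 <= 4 * b ^+ 2) h.
by rewrite mulr_ge0 ?sqr_ge0// => /(_ isT); lra.
Qed.

(** Near 0 the Laplace law is sub-Gaussian. With [y = |xi| / (4 b)], one factor [expR y] pays for
    the square in the Taylor remainder and another for its exponential; the total [expR (2 y)] has
    mean 2, and the linear term is centered. *)
Lemma laplace_mgf (th : R) : `|th| * b <= 4^-1 ->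
  (\int[P]_x (expR (th * xi x))%:E <= (expR (32 * th ^+ 2 * b ^+ 2))%:E)%E.
Proof.
move=> thb.
have bnd x : expR (th * xi x) <= 1 + th * xi x +
    16 * th ^+ 2 * b ^+ 2 * expR ((2 * b)^-1 * `|xi x|).
  set z := th * xi x; set y := (4 * b)^-1 * `|xi x|.
  have zy : `|z| <= y.
    rewrite /z /y normrM ler_wpM2r// -[leRHS]mul1r ler_pdivlMr ?mulr_gt0//; lra.
  have y0 : 0 <= y by rewrite mulr_ge0// invr_ge0 mulr_ge0// ltW.
  have := expR_taylor 2 z; rewrite !(big_nat_recl _ _ _ (leq0n _)) big_geq//=.
  rewrite fact0 (_ : 1`! = 1)%N// (_ : 2`! = 2)%N// => /ler_normlP[_ h].
  have h2 : `|z| ^+ 2 / 2 * expR `|z| <=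
      16 * th ^+ 2 * b ^+ 2 * expR ((2 * b)^-1 * `|xi x|).
    have -> : (2 * b)^-1 * `|xi x| = y + y by rewrite /y; field; rewrite gt_eqF.
    rewrite expRD mulrA; apply: ler_pM; rewrite ?expR_ge0 ?ler_expR//.
    have := exprn_le_expR 2 y0; rewrite (_ : 2`!%:R = 2)// => h2.
    have -> : `|z| ^+ 2 = 16 * th ^+ 2 * b ^+ 2 * y ^+ 2.
      rewrite /z normrM exprMn -normrX (ger0_norm (sqr_ge0 _)) /y.
      by field; rewrite gt_eqF.
    have c0 : 0 <= 16 * th ^+ 2 * b ^+ 2.
      by rewrite -mulrA -exprMn mulr_ge0// sqr_ge0.
    have := ler_wpM2l c0 h2; lra.
  rewrite expr0 expr1 in h; lra.
have i1 : P.-integrable [set: T] (EFin \o (fun x => 1 + th * xi x)).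
  apply: mom_integrable; apply: mom_add; first exact: mom_cst.
  exact/mom_scale/mom_laplace.
have i2 : P.-integrable [set: T] (EFin \o (fun x =>
    16 * th ^+ 2 * b ^+ 2 * expR ((2 * b)^-1 * `|xi x|))).
  exact: (integrableZl measurableT (16 * th ^+ 2 * b ^+ 2) iE).
have i3 : P.-integrable [set: T] (EFin \o (fun x => 1 + th * xi x +
    16 * th ^+ 2 * b ^+ 2 * expR ((2 * b)^-1 * `|xi x|))).
  exact: (integrableD measurableT i1 i2).
apply: (@le_trans _ _ (\int[P]_x (1 + th * xi x +
    16 * th ^+ 2 * b ^+ 2 * expR ((2 * b)^-1 * `|xi x|))%:E)%E).
  apply: ge0_le_integral => //.
  - apply/measurable_EFinP; apply: measurableT_comp => //.
    exact: measurable_funM.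
  - exact: measurable_int i3.
  - by move=> x _; rewrite lee_fin.
rewrite -[leLHS]fineK; last exact: integrable_fin_num i3.
rewrite lee_fin -/(Rintegral P setT _) RintegralD// RintegralZl// evE.
rewrite -/(ev (fun x => 1 + th * xi x)) ev_add; last 2 first.
- exact: mom_cst.
- exact/mom_scale/mom_laplace.
rewrite ev_cst ev_scale; last exact: mom_laplace.
rewrite ev_laplace mulr0 addr0; apply: le_trans (expR_ge1Dx _); lra.
Qed.

End Laplace.

(** * Jackson and de la Vallee Poussin means *)

Section TrigonometricKernels.
Context (R : realType).
Implicit Types (x t phi : R) (c : nat -> R) (g : R -> R).

(** Halving the angle keeps the cosine above [cos (pi / 4)], both in the mean value bound for
    [sin (x / 2)] and in [sin x = 2 sin (x / 2) cos (x / 2)]; the square of that cosine is 1/2. *)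
Lemma sin_ge_half x : 0 <= x <= pi / 2 -> x / 2 <= sin x.
Proof.
move=> /andP[x0 xpi].
have pi0 : 0 < pi :> R := pi_gt0 R.
have c4 : cos (pi / 4) ^+ 2 = 2^-1 :> R.
  have := cos_mulr2n (pi / 4 : R).
  have -> : (pi / 4) *+ 2 = pi / 2 :> R by rewrite -mulr_natr; field.
  rewrite cos_pihalf -mulr_natr => h; lra.
have c40 : 0 <= cos (pi / 4) :> R.
  by apply: cos_ge0_pihalf; lra.
have cge y : 0 <= y <= x / 2 -> cos (pi / 4) <= cos y.
  move=> /andP[y0 yx].
  have [->|yn] := eqVneq y (pi / 4); first by [].
  apply: ltW; rewrite ltr_cos ?in_itv/=; lra.
have s2 : x / 2 * cos (pi / 4) <= sin (x / 2).
  have x20 : 0 <= x / 2 by lra.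
  have csin : {within `[0, x / 2], continuous (@sin R)}.
    by apply: continuous_subspaceT => z; exact: continuous_sin.
  have [y] := MVT_segment x20 (fun z _ => is_derive_sin z) csin.
  rewrite in_itv/= => /cge yc; rewrite sin0 !subr0 => ->.
  by rewrite mulrC ler_wpM2r.
have -> : sin x = 2 * sin (x / 2) * cos (x / 2).
  have -> : sin x = sin ((x / 2) *+ 2) by congr sin; rewrite -mulr_natr; field.
  rewrite sin_mulr2n -mulr_natr; lra.
have c2 : cos (pi / 4) <= cos (x / 2) by apply: cge; lra.
have : x / 2 * cos (pi / 4) * cos (pi / 4) <= sin (x / 2) * cos (x / 2).
  apply: ler_pM => //; rewrite mulr_ge0//; lra.
rewrite -mulrA -expr2 c4; lra.
Qed.

(** Bounds the second moment of a kernel by its Fourier coefficients of order 0 and 1, as used in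
    [residual_modulus]. *)
Lemma sqr_le_one_sub_cos t : `|t| <= pi -> t ^+ 2 <= 8 * (1 - cos t).
Proof.
move=> tpi.
have -> : t ^+ 2 = `|t| ^+ 2 by rewrite -normrX ger0_norm// sqr_ge0.
have -> : cos t = cos `|t| by case: (ger0P t) => _ //; rewrite cosN.
have := normr_ge0 t; set u := `|t| in tpi * => u0.
have := @sin_ge_half (u / 2); rewrite (_ : 0 <= u / 2 <= pi / 2); last by lra.
move=> /(_ isT) h.
have -> : cos u = 1 - 2 * sin (u / 2) ^+ 2.
  have -> : cos u = cos ((u / 2) *+ 2) by congr cos; rewrite -mulr_natr; field.
  by rewrite cos_mulr2n cos2sin2; ring.
nra.
Qed.

Section Grid.
Variable N : nat.

(** The shift by [pi] keeps the nodes in the range of [sqr_le_one_sub_cos]. *)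
Definition grid (j : nat) : R := 2 * pi * j%:R / N%:R - pi.

Lemma grid_le_pi j : (j < N)%N -> `|grid j| <= pi.
Proof.
move=> jN; have N0 : 0 < N%:R :> R by rewrite ltr0n (leq_ltn_trans _ jN).
have pi0 : 0 < pi :> R := pi_gt0 R.
have jN1 : 0 <= (j%:R / N%:R : R) <= 1.
  by rewrite divr_ge0// ler_pdivrMr// mul1r ler_nat ltnW.
rewrite /grid ler_norml -mulrA; nra.
Qed.

(** Multiplied by [2 * sin (h / 2)], with [h] the angular step, the sum telescopes and closes up by
    periodicity. The bounds on [k] make this factor nonzero. *)
Lemma sum_cos_equidistributed k phi : (0 < k < N)%N ->
  \sum_(j < N) cos (phi + k%:R * (2 * pi * j%:R / N%:R)) = 0.
Proof.
move=> /andP[k0 kN]; have N0 : 0 < N%:R :> R by rewrite ltr0n (leq_ltn_trans _ kN).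
have pi0 : 0 < pi :> R := pi_gt0 R.
pose h : R := 2 * pi * k%:R / N%:R.
have sh : 0 < sin (h / 2).
  apply: sin_gt0_pi; have -> : h / 2 = pi * (k%:R / N%:R) by rewrite /h; field; rewrite gt_eqF.
  apply/andP; split; first by rewrite mulr_gt0// divr_gt0// ltr0n.
  by rewrite -[X in _ < X]mulr1 ltr_pM2l// ltr_pdivrMr// mul1r ltr_nat.
pose F (j : nat) : R := sin (phi + j%:R * h - h / 2).
have FE j : 2 * sin (h / 2) * cos (phi + k%:R * (2 * pi * j%:R / N%:R)) =
    F j.+1 - F j.
  have -> : phi + k%:R * (2 * pi * j%:R / N%:R) = phi + j%:R * h.
    by rewrite /h; field; rewrite gt_eqF.
  rewrite /F (_ : phi + j.+1%:R * h - h / 2 = (phi + j%:R * h) + h / 2); last first.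
    by rewrite -natr1; field.
  by rewrite sinD sinB; ring.
have sh0 : 2 * sin (h / 2) != 0 by rewrite mulf_neq0// gt_eqF.
apply: (mulfI sh0); apply/eqP; rewrite mulr0 mulr_sumr; under eq_bigr do rewrite FE.
rewrite -(big_mkord xpredT (fun j => F j.+1 - F j)) telescope_sumr// subr_eq0 /F.
rewrite mul0r addr0 (_ : N%:R * h = (pi *+ 2) *+ k); last first.
  by rewrite -mulr_natr -[pi *+ 2]mulr_natr /h; field; rewrite gt_eqF.
by rewrite addrAC periodicn//; exact: sinD2pi.
Qed.

Lemma sum_cos_grid (a : int) phi : (`|a| < N)%N ->
  \sum_(j < N) cos (phi + a%:~R * grid j) = (a == 0)%:R * N%:R * cos phi.
Proof.
have pos (k : nat) psi : (0 < k < N)%N -> \sum_(j < N) cos (psi + k%:R * grid j) = 0.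
  move=> kN; rewrite -[RHS](sum_cos_equidistributed (psi - k%:R * pi) kN).
  by apply: eq_bigr => j _; congr cos; rewrite /grid; ring.
case: a => [[|k]|k] aN.
- under eq_bigr do rewrite mul0r addr0.
  by rewrite sumr_const card_ord eqxx mul1r mulr_natl.
- by rewrite mul0r mul0r; exact: pos.
- rewrite NegzE oppr_eq0 mul0r mul0r; rewrite NegzE abszN in aN.
  rewrite -[RHS](pos k.+1 (- phi))//; apply: eq_bigr => j _.
  by rewrite -cosN; congr cos; rewrite mulrNz; ring.
Qed.

(** The squared modulus of the trigonometric polynomial with coefficients [c], expanded to display
    its frequencies; for constant [c] it is the Fejer kernel up to normalization. *)
Definition trig_kernel c (m : nat) t : R :=
  \sum_(p < m) \sum_(q < m) c p * c q * cos ((p%:R - q%:R) * t).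

Lemma trig_kernelE c m t : trig_kernel c m t =
  (\sum_(p < m) c p * cos (p%:R * t)) ^+ 2 +
  (\sum_(p < m) c p * sin (p%:R * t)) ^+ 2.
Proof.
rewrite !expr2 !mulr_suml -big_split/=; apply: eq_bigr => p _.
rewrite !mulr_sumr -big_split/=; apply: eq_bigr => q _.
by rewrite mulrBl cosB; ring.
Qed.

Lemma trig_kernel_ge0 c m t : 0 <= trig_kernel c m t.
Proof. by rewrite trig_kernelE addr_ge0// sqr_ge0. Qed.

(** The Fourier coefficient of index [k] of [trig_kernel c m], hence its multiplier on [cos (k y)]
    in [convol_cos]. *)
Definition autocorr c (m k : nat) : R :=
  \sum_(p < m) \sum_(q < m) c p * c q * (p == (q + k)%N :> nat)%:R.

(* The quadrature on N equispaced points of a convolution integral: it is exact on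
   trigonometric polynomials of low degree ([convol_cos]). *)
Definition convol c (m : nat) g x : R :=
  N%:R^-1 * \sum_(j < N) trig_kernel c m (grid j) * g (x - grid j).

(** The condition [k + m <= N] excludes aliasing: the frequencies [p - q - k] and [q - p - k] stay
    below [N] in absolute value, so the grid sum vanishes unless one of them is 0. *)
Lemma convol_cos c m k x : (0 < N)%N -> (k + m <= N)%N ->
  convol c m (fun y => cos (k%:R * y)) x = autocorr c m k * cos (k%:R * x).
Proof.
move=> N0 kmN.
have N0' : N%:R != 0 :> R by rewrite pnatr_eq0 -lt0n.
have one (p q : 'I_m) : \sum_(j < N) cos ((p%:R - q%:R) * grid j) *
    cos (k%:R * (x - grid j)) =
    2^-1 * ((p == (q + k)%N :> nat)%:R + (q == (p + k)%N :> nat)%:R) * N%:R *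
    cos (k%:R * x).
  pose a : int := p%:Z - q%:Z - k%:Z; pose b : int := q%:Z - p%:Z - k%:Z.
  have aE : (a == 0) = (p == (q + k)%N :> nat).
    by rewrite /a; apply/eqP/eqP; lia.
  have bE : (b == 0) = (q == (p + k)%N :> nat).
    by rewrite /b; apply/eqP/eqP; lia.
  have aN : (`|a| < N)%N by have := ltn_ord p; have := ltn_ord q; rewrite /a; lia.
  have bN : (`|b| < N)%N by have := ltn_ord p; have := ltn_ord q; rewrite /b; lia.
  have := sum_cos_grid (k%:R * x) aN; have := sum_cos_grid (k%:R * x) bN.
  rewrite aE bE => hb ha.
  transitivity (2^-1 * (\sum_(j < N) cos (k%:R * x + a%:~R * grid j) +
                      \sum_(j < N) cos (k%:R * x + b%:~R * grid j))).
    rewrite -big_split/= mulr_sumr; apply: eq_bigr => j _.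
    have -> : k%:R * x + a%:~R * grid j =
        (p%:R - q%:R) * grid j + k%:R * (x - grid j).
      by rewrite /a !rmorphB/= !pmulrn; ring.
    have -> : k%:R * x + b%:~R * grid j =
        k%:R * (x - grid j) - (p%:R - q%:R) * grid j.
      by rewrite /b !rmorphB/= !pmulrn; ring.
    by rewrite cosD cosB; field.
  by rewrite ha hb; ring.
rewrite /convol /trig_kernel.
under eq_bigr do rewrite mulr_suml.
rewrite exchange_big/=.
under eq_bigr => p _.
  under eq_bigr do rewrite mulr_suml.
  rewrite exchange_big/=.
  under eq_bigr => q _.
    under eq_bigr do rewrite -mulrA.
    rewrite -mulr_sumr one.
    over.
  over.
rewrite /=.
transitivity ((2^-1 * (autocorr c m k + autocorr c m k)) * cos (k%:R * x)); last by field.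
have sym : autocorr c m k =
    \sum_(p < m) \sum_(q < m) c p * c q * (q == (p + k)%N :> nat)%:R.
  rewrite /autocorr exchange_big; apply: eq_bigr => p _; apply: eq_bigr => q _.
  by rewrite [c p * _]mulrC.
rewrite {2}sym /autocorr -big_split/= 2!mulr_sumr mulr_suml.
apply: eq_bigr => p _; rewrite -big_split/= 2!mulr_sumr mulr_suml.
by apply: eq_bigr => q _; field.
Qed.

(** The kernel is nonnegative, so its norm is its mass, given by [convol_cos] at [k = 0]. The bound
    does not depend on [N]. *)
Lemma convol_bound c m g (M : R) x : (0 < N)%N -> (m <= N)%N ->
  (forall y, `|g y| <= M) -> `|convol c m g x| <= autocorr c m 0 * M.
Proof.
move=> N0 mN gM.
have := @convol_cos c m 0 0 N0 mN; rewrite mul0r cos0 mulr1 => <-.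
rewrite /convol normrM ger0_norm ?invr_ge0// -mulrA ler_wpM2l ?invr_ge0//.
apply: le_trans (ler_norm_sum _ _ _) _; rewrite mulr_suml; apply: ler_sum => j _.
rewrite normrM ger0_norm ?trig_kernel_ge0// mul0r cos0 mulr1.
by rewrite ler_wpM2l// trig_kernel_ge0.
Qed.

End Grid.

End TrigonometricKernels.

Section Jackson.
Context (R : realType).
Implicit Types (x t : R) (c s : nat -> R) (f g : R -> R) (m N K : nat).

Lemma autocorrE c m k :
  autocorr c m k = \sum_(q < m) (q + k < m)%:R * (c (q + k)%N * c q).
Proof.
rewrite /autocorr exchange_big/=; apply: eq_bigr => q _.
case: ltnP => [qkm|mqk].
  rewrite (bigD1 (Ordinal qkm))//= eqxx mulr1 mul1r big1 ?addr0// => p.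
  by rewrite -val_eqE/= => /negbTE ->; rewrite mulr0.
rewrite mul0r big1// => p _; rewrite (_ : _ == _ = false) ?mulr0//.
by apply/negbTE; rewrite neq_ltn (leq_trans (ltn_ord p) mqk).
Qed.

(* With these coefficients [trig_kernel] is the Jackson kernel, the square of a
   Fejer kernel up to normalization. *)
Definition tent m (p : nat) : R := (minn p.+1 (m - p))%:R.

(** Twice the difference is the sum of the squared increments of [tent], each at most 1, plus a
    boundary term 1. *)
Lemma tent_autocorr_diff m : (0 < m)%N ->
  autocorr (tent m) m 0 - autocorr (tent m) m 1 <= m%:R.
Proof.
move=> m0; rewrite !autocorrE.
have -> : \sum_(q < m) (q + 0 < m)%:R * (tent m (q + 0) * tent m q) =
    \sum_(q < m) tent m q ^+ 2.
  by apply: eq_bigr => q _; rewrite addn0 ltn_ord mul1r -expr2.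
have -> : \sum_(q < m) (q + 1 < m)%:R * (tent m (q + 1) * tent m q) =
    \sum_(q < m) tent m q.+1 * tent m q.
  apply: eq_bigr => q _; rewrite addn1; case: ltnP => [_|mq].
    by rewrite mul1r.
  by rewrite mul0r /tent (_ : minn q.+2 (m - q.+1) = 0)%N ?mul0r//; lia.
have tel : \sum_(q < m) (tent m q.+1 ^+ 2 - tent m q ^+ 2) = - 1.
  rewrite -(big_mkord xpredT (fun q => tent m q.+1 ^+ 2 - tent m q ^+ 2)).
  rewrite telescope_sumr// /tent (_ : minn m.+1 (m - m) = 0)%N; last by lia.
  by rewrite (_ : minn 1 (m - 0) = 1)%N ?expr0n ?expr1n ?sub0r//; lia.
have le1 : \sum_(q < m) (tent m q.+1 - tent m q) ^+ 2 <= m%:R.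
  apply: (@le_trans _ _ (\sum_(q < m) 1)); last by rewrite sumr_const card_ord.
  apply: ler_sum => q _; rewrite -[_ ^+ 2]ger0_norm ?sqr_ge0// normrX expr_le1//.
  have h1 : (minn q.+2 (m - q.+1) <= (minn q.+1 (m - q)).+1)%N by lia.
  have h2 : (minn q.+1 (m - q) <= (minn q.+2 (m - q.+1)).+1)%N by lia.
  move: h1 h2; rewrite -!(ler_nat R) -!natr1 -/(tent m q) -/(tent m q.+1) => h1 h2.
  by rewrite ler_norml; apply/andP; split; lra.
have : \sum_(q < m) (tent m q.+1 - tent m q) ^+ 2 =
   \sum_(q < m) (tent m q.+1 ^+ 2 - tent m q ^+ 2) +
   2 * (\sum_(q < m) tent m q ^+ 2 - \sum_(q < m) tent m q.+1 * tent m q).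
  rewrite -sumrB mulr_sumr -big_split/=; apply: eq_bigr => q _; ring.
rewrite tel => E; have m1 : 1 <= m%:R :> R by rewrite ler1n.
lra.
Qed.

(** The minimum in [tent] is at least the product of its arguments divided by [m + 1], whose sum has
    a closed form; then [c ^+ 2 >= 2 * l * c - l ^+ 2] with [l = m / 6] passes from the sum to the
    sum of squares. *)
Lemma tent_autocorr0 m : m%:R ^+ 3 <= 36 * autocorr (tent m) m 0.
Proof.
rewrite autocorrE.
have -> : \sum_(q < m) (q + 0 < m)%:R * (tent m (q + 0) * tent m q) =
    \sum_(q < m) tent m q ^+ 2.
  by apply: eq_bigr => q _; rewrite addn0 ltn_ord mul1r -expr2.
have closed k : \sum_(q < k) (q%:R + 1) * (m%:R - q%:R) =
    k%:R * m%:R + (m%:R - 1) * k%:R * (k%:R - 1) / 2 -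
    (k%:R - 1) * k%:R * (2 * k%:R - 1) / 6 :> R.
  elim: k => [|k ih]; first by rewrite big_ord0; field.
  by rewrite big_ord_recr/= ih -natr1; field.
have sum1 : m%:R ^+ 2 <= 6 * \sum_(q < m) tent m q.
  have : \sum_(q < m) (q%:R + 1) * (m%:R - q%:R) <=
      (m%:R + 1) * \sum_(q < m) tent m q.
    rewrite mulr_sumr; apply: ler_sum => q _.
    have qm := ltn_ord q.
    have : (q.+1 * (m - q) <= m.+1 * minn q.+1 (m - q))%N by nia.
    by rewrite -(ler_nat R) !natrM natrB 1?ltnW// -!natr1.
  rewrite closed => h.
  have m1 : 0 < m%:R + 1 :> R by rewrite ltr_wpDl.
  rewrite -(ler_pM2l m1); have m0 : 0 <= m%:R :> R by [].
  nra.
have : \sum_(q < m) (2 * (m%:R / 6) * tent m q - (m%:R / 6) ^+ 2) <=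
    \sum_(q < m) tent m q ^+ 2.
  by apply: ler_sum => q _; have := sqr_ge0 (tent m q - m%:R / 6); nra.
rewrite big_split/= -mulr_sumr sumrN sumr_const card_ord -mulr_natl => h.
have m0 : 0 <= m%:R :> R by [].
have h3 := ler_wpM2l m0 sum1.
rewrite -exprS in h3; lra.
Qed.

Lemma ones_autocorr m k : autocorr (fun=> 1 : R) m k = (m - k)%:R.
Proof.
rewrite autocorrE; under eq_bigr do rewrite !mulr1.
rewrite -natr_sum; congr _%:R.
have H a b : (\sum_(q < a) (q < b)%N = minn a b)%N.
  elim: a => [|a ih]; first by rewrite big_ord0; lia.
  by rewrite big_ord_recr/= ih; lia.
rewrite (eq_bigr (fun q : 'I_m => nat_of_bool (q < m - k)%N)) ?H; first by lia.
by move=> q _; congr nat_of_bool; lia.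
Qed.

Lemma tent_autocorr_ge m k : (m <= k)%N -> autocorr (tent m) m k = 0.
Proof.
move=> mk; rewrite autocorrE big1// => q _.
by rewrite ltnNge (leq_trans mk) ?leq_addl// mul0r.
Qed.

Lemma tent_autocorr0_gt0 m : (0 < m)%N -> 0 < autocorr (tent m) m 0.
Proof.
move=> m0; have := tent_autocorr0 m.
have : 0 < m%:R ^+ 3 :> R by rewrite exprn_gt0// ltr0n.
lra.
Qed.

Definition linop (O : (R -> R) -> R -> R) := forall a f g x,
  O (fun y => a * f y + g y) x = a * O f x + O g x.

Lemma linop_sub O f g x : linop O -> O (fun y => f y - g y) x = O f x - O g x.
Proof.
move=> lO; rewrite (_ : (fun y => _) = fun y => -1 * g y + f y); last first.
  by apply/funext => y; ring.
by rewrite lO; ring.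
Qed.

Lemma linop0 O x : linop O -> O (fun=> 0) x = 0.
Proof.
move=> lO; transitivity (O (fun y => -1 * (fun=> 0) y + (fun=> 0) y) x).
  by congr (O _ x); apply/funext => y; rewrite mulr0 addr0.
by rewrite lO mulN1r addNr.
Qed.

Lemma linop_scale O a f x : linop O -> O (fun y => a * f y) x = a * O f x.
Proof.
move=> lO; rewrite -[RHS]addr0 -(linop0 x lO) -lO; congr (O _ x).
by apply/funext => y; rewrite addr0.
Qed.

Lemma linop_sum O (n : nat) (s : nat -> R) (G : nat -> R -> R) x : linop O ->
  O (fun y => \sum_(k < n) s k * G k y) x = \sum_(k < n) s k * O (G k) x.
Proof.
move=> lO; elim: n => [|n ih].
  rewrite big_ord0 (_ : (fun y => _) = fun y => 0); last first.
    by apply/funext => y; rewrite big_ord0.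
  exact: linop0.
rewrite big_ord_recr/= -ih addrC -lO; congr (O _ x); apply/funext => y.
by rewrite big_ord_recr addrC.
Qed.

Lemma linop_comp O1 O2 : linop O1 -> linop O2 -> linop (fun f => O1 (O2 f)).
Proof.
move=> l1 l2 a f g x; rewrite -l1; congr (O1 _ x); apply/funext => y.
exact: l2.
Qed.

Lemma linop_iter O l : linop O -> linop (iter l O).
Proof. by move=> lO; elim: l => //= l; exact: linop_comp. Qed.

Lemma linop_convol N c m : linop (convol N c m).
Proof.
move=> a f g x; rewrite /convol mulrCA -mulrDr; congr (_ * _).
by rewrite mulr_sumr -big_split/=; apply: eq_bigr => j _; ring.
Qed.

Definition jackson_mean N m f x : R :=
  (autocorr (tent m) m 0)^-1 * convol N (tent m) m f x.

Definition residual N m f x : R := f x - jackson_mean N m f x.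

Lemma linop_residual N m : linop (residual N m).
Proof. by move=> a f g x; rewrite /residual /jackson_mean linop_convol; ring. Qed.

(* [convol N (fun=> 1) m] is [m] times the Fejer mean of order [m]. *)
Definition vallee_poussin N K f x : R := K%:R^-1 *
  (2 * convol N (fun=> 1) K f x - convol N (fun=> 1) K./2 f x -
   convol N (fun=> 1) (K - K./2) f x).

(** For odd [K] the break point [K / 2] of the taper is not an integer. Using the orders floor and
    ceiling of [K / 2] together still reproduces the taper at every integer [k <= K]
    ([vp_coef_taper]). *)
Definition vp_coef K (k : nat) : R :=
  K%:R^-1 * (2 * (K - k)%:R - (K./2 - k)%:R - (K - K./2 - k)%:R).

Definition vp_residual N K f x : R := f x - vallee_poussin N K f x.

Lemma linop_vp_residual N K : linop (vp_residual N K).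
Proof. by move=> a f g x; rewrite /vp_residual /vallee_poussin !linop_convol; ring. Qed.

Lemma half_bounds K : (K./2 <= K - K./2 <= K./2.+1)%N.
Proof. by have := odd_double_half K; case: (odd K); lia. Qed.

Lemma vp_coef_low K k : (k <= K./2)%N -> (0 < K)%N -> vp_coef K k = 1.
Proof.
move=> kK K0; have := half_bounds K => /andP[h1 h2].
have K0' : K%:R != 0 :> R by rewrite pnatr_eq0 -lt0n.
have e : 2 * (K - k)%:R = K%:R + (K./2 - k)%:R + (K - K./2 - k)%:R :> R.
  by rewrite -natrM -!natrD; congr _%:R; lia.
by rewrite /vp_coef e; field.
Qed.

Lemma vp_coef_high K k : (K./2 < k)%N -> vp_coef K k = K%:R^-1 * (2 * (K - k)%:R).
Proof.
move=> kK; have := half_bounds K => /andP[h1 h2].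
have e1 : (K./2 - k = 0)%N by lia.
have e2 : (K - K./2 - k = 0)%N by lia.
by rewrite /vp_coef e1 e2 mulr0n !subr0.
Qed.

Lemma vp_coef_taper K k : (0 < K)%N -> (k <= K)%N -> vp_coef K k = taper R K k%:Z.
Proof.
move=> K0 kK; rewrite /taper /=.
have K0' : K%:R != 0 :> R by rewrite pnatr_eq0 -lt0n.
have -> : (k%:R <= K%:R / 2 :> R) = (k <= K./2)%N.
  rewrite ler_pdivlMr// -natrM ler_nat.
  by have := odd_double_half K; case: (odd K); lia.
case: leqP => h; first exact: vp_coef_low.
by rewrite vp_coef_high// natrB//; field.
Qed.

Lemma vp_coef_ge K k : (K <= k)%N -> (1 < K)%N -> vp_coef K k = 0.
Proof.
move=> Kk K1; rewrite vp_coef_high; last by have := odd_double_half K; lia.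
have e : (K - k = 0)%N by lia.
by rewrite e mulr0n !mulr0.
Qed.

Lemma residual_cos N m k x : (0 < m)%N -> (k + m <= N)%N ->
  residual N m (fun y => cos (k%:R * y)) x =
  (1 - (autocorr (tent m) m 0)^-1 * autocorr (tent m) m k) * cos (k%:R * x).
Proof.
move=> m0 kmN; rewrite /residual /jackson_mean convol_cos//; last by lia.
by ring.
Qed.

Lemma vp_residual_cos N K k x : (0 < K)%N -> (k + K <= N)%N ->
  vp_residual N K (fun y => cos (k%:R * y)) x =
  (1 - vp_coef K k) * cos (k%:R * x).
Proof.
move=> K0 kKN; rewrite /vp_residual /vallee_poussin.
have := half_bounds K => /andP[h1 h2].
by rewrite !convol_cos ?ones_autocorr; [rewrite /vp_coef; ring|lia..].
Qed.

(* Where [1 - vp_coef K k] does not vanish, the Jackson multiplier is zero. *)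
Lemma vp_residual_iter_cos N K l k x : (1 < K)%N -> (k + K <= N)%N ->
  vp_residual N K (iter l (residual N K./2) (fun y => cos (k%:R * y))) x =
  (1 - vp_coef K k) * cos (k%:R * x).
Proof.
move=> K1 kKN; have := half_bounds K => /andP[h1 h2].
pose lam := 1 - (autocorr (tent K./2) K./2 0)^-1 * autocorr (tent K./2) K./2 k.
have K20 : (0 < K./2)%N by lia.
have -> : iter l (residual N K./2) (fun y => cos (k%:R * y)) =
    fun y => lam ^+ l * cos (k%:R * y).
  elim: l => [|l ih]; first by apply/funext => y; rewrite mul1r.
  apply/funext => y; rewrite iterS ih linop_scale; last exact: linop_residual.
  by rewrite residual_cos//; [rewrite exprS -/lam; ring|lia].
rewrite linop_scale; last exact: linop_vp_residual.
rewrite vp_residual_cos//; last by lia.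
case: (leqP K./2 k) => [kh|kh].
  by rewrite /lam (tent_autocorr_ge kh) mulr0 subr0 expr1n mul1r.
by rewrite vp_coef_low ?subrr ?mul0r ?mulr0//; lia.
Qed.

Lemma residual_sup N m f M x : (0 < m <= N)%N -> (forall y, `|f y| <= M) ->
  `|residual N m f x| <= 2 * M.
Proof.
move=> /andP[m0 mN] fM; rewrite /residual.
apply: le_trans (ler_normB _ _) _; rewrite mulr_natl mulr2n lerD//.
have r0 := tent_autocorr0_gt0 m0.
rewrite /jackson_mean normrM ger0_norm ?invr_ge0 ?(ltW r0)// ler_pdivrMl//.
by apply: convol_bound => //; lia.
Qed.

Lemma iter_residual_sup N m f M l x : (0 < m <= N)%N -> (forall y, `|f y| <= M) ->
  `|iter l (residual N m) f x| <= 2 ^+ l * M.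
Proof.
move=> mN fM; elim: l x => [|l ih] x; first by rewrite mul1r.
by rewrite iterS exprS -mulrA; exact: residual_sup.
Qed.

(** The mean itself has norm at most [(2 K + K) / K = 3], as the two smaller orders add up to
    [K]. *)
Lemma vp_residual_sup N K f M x : (0 < K <= N)%N -> (forall y, `|f y| <= M) ->
  `|vp_residual N K f x| <= 4 * M.
Proof.
move=> /andP[K0 KN] fM; have := half_bounds K => /andP[h1 h2].
have K0' : 0 < K%:R :> R by rewrite ltr0n.
have b m : (m <= N)%N -> `|convol N (fun=> 1) m f x| <= m%:R * M.
  move=> mN; have := @convol_bound _ N (fun=> 1) m f M x.
  by rewrite ones_autocorr subn0; apply => //; lia.
apply: le_trans (ler_normB _ _) _.
suff : `|vallee_poussin N K f x| <= 3 * M by have := fM x; lra.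
rewrite /vallee_poussin normrM ger0_norm ?invr_ge0// ler_pdivrMl//.
apply: le_trans (ler_normB _ _) _.
apply: le_trans (lerD (ler_normB _ _) (lexx _)) _.
have b1 := b K KN; have b2 := b K./2 ltac:(lia); have b3 := b (K - K./2)%N ltac:(lia).
rewrite normrM ger0_norm//.
have : (K./2)%:R + (K - K./2)%:R = K%:R :> R by rewrite -natrD; congr _%:R; lia.
move=> <-; rewrite -{2}(_ : (K./2 + (K - K./2) = K)%N) in b1; last by lia.
rewrite natrD in b1; lra.
Qed.

(* The constant is [1 + 8 * 36], from [sqr_le_one_sub_cos], [tent_autocorr_diff]
   and [tent_autocorr0]. *)
Lemma residual_modulus N m f w x : (0 < m)%N -> (m < N)%N ->
  (forall t, `|t| <= pi -> `|f x - f (x - t)| <= w * (1 + m%:R ^+ 2 * t ^+ 2)) ->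
  `|residual N m f x| <= 289 * w.
Proof.
move=> m0 mN fw; have r0 := tent_autocorr0_gt0 m0.
have N0 : (0 < N)%N by lia.
pose ker j : R := trig_kernel (tent m) m (grid R N j).
have w0 : 0 <= w.
  have := fw 0; rewrite subr0 subrr normr0 expr0n/= mulr0 addr0 mulr1.
  by apply; exact: pi_ge0.
have e0 : N%:R^-1 * \sum_(j < N) ker j = autocorr (tent m) m 0.
  have := @convol_cos _ N (tent m) m 0 0 N0 (ltnW mN).
  rewrite mul0r cos0 mulr1 => <-; congr (_ * _); apply: eq_bigr => j _.
  by rewrite mul0r cos0 mulr1.
have e1 : N%:R^-1 * \sum_(j < N) ker j * cos (grid R N j) = autocorr (tent m) m 1.
  have := @convol_cos _ N (tent m) m 1 0 N0 mN.
  rewrite mulr0 cos0 mulr1 => <-; congr (_ * _); apply: eq_bigr => j _.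
  by rewrite mul1r sub0r cosN.
have -> : residual N m f x = (autocorr (tent m) m 0)^-1 *
    (N%:R^-1 * \sum_(j < N) ker j * (f x - f (x - grid R N j))).
  rewrite /residual /jackson_mean /convol.
  under [in RHS]eq_bigr do rewrite mulrBr.
  rewrite sumrB -mulr_suml mulrBr mulrBr [N%:R^-1 * (_ * f x)]mulrA e0.
  by rewrite mulKf// gt_eqF.
rewrite normrM ger0_norm ?invr_ge0 ?(ltW r0)// ler_pdivrMl//.
rewrite normrM ger0_norm ?invr_ge0//.
(* Once [t ^+ 2] is replaced by [8 * (1 - cos t)], the average against the kernel involves only [e0]
   and [e1]. *)
apply: (@le_trans _ _ (N%:R^-1 * \sum_(j < N) (ker j * (w * (1 + 8 * m%:R ^+ 2)) -
    ker j * cos (grid R N j) * (w * (8 * m%:R ^+ 2))))).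
  rewrite ler_wpM2l ?invr_ge0//.
  apply: le_trans (ler_norm_sum _ _ _) _; apply: ler_sum => j _.
  have k0 : 0 <= ker j by exact: trig_kernel_ge0.
  have tp := grid_le_pi R (ltn_ord j).
  rewrite normrM ger0_norm// -mulrA -mulrBr ler_wpM2l//.
  apply: le_trans (fw _ tp) _.
  have := sqr_le_one_sub_cos tp; set t2 := grid R N j ^+ 2; set ct := cos _ => h.
  have m20 : 0 <= m%:R ^+ 2 :> R by rewrite sqr_ge0.
  have := ler_wpM2l m20 h; have := ler_wpM2l w0 (ler_wpM2l m20 h).
  lra.
rewrite sumrB -!mulr_suml mulrBr !mulrA e0 e1.
have d1 := tent_autocorr_diff m0; have d2 := tent_autocorr0 m.
have m20 : 0 <= m%:R ^+ 2 :> R by rewrite sqr_ge0.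
have d3 := ler_wpM2l m20 d1; rewrite -exprSr in d3.
have := ler_wpM2l w0 (le_trans d3 d2); lra.
Qed.

End Jackson.

(** * Iterated Jackson residuals of smooth periodic functions *)

Section JacksonSmooth.
Context (R : realType).
Implicit Types (x t : R) (f g : R -> R) (m N K l : nat).

(** A quadrature is a finite sum of translates, so it commutes with differentiation without any
    exchange of limits. *)
Lemma is_derive_convol N (c : nat -> R) m f x : (forall y, derivable f y 1) ->
  is_derive x 1 (convol N c m f) (convol N c m (f^`())%classic x).
Proof.
move=> df.
have trans t : is_derive x (1 : R) (fun y => f (y - t)) ((f^`())%classic (x - t)).
  pose g y := f (y - t).
  have E : (fun h : R => h^-1 *: ((g \o shift x) (h *: (1 : R)) - g x)) =
      (fun h : R => h^-1 *: ((f \o shift (x - t)) (h *: (1 : R)) - f (x - t))).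
    by apply/funext => h; rewrite /g /= addrA.
  apply: DeriveDef; first by rewrite /derivable E; exact: df.
  by rewrite derive1E /derive E.
rewrite /convol.
have -> : (fun y => N%:R^-1 * \sum_(j < N) trig_kernel c m (grid R N j) *
      f (y - grid R N j)) =
    N%:R^-1 \*: (\sum_(j < N) (trig_kernel c m (grid R N j) \*:
      (fun y => f (y - grid R N j)))).
  by apply/funext => y; rewrite fct_sumE.
by apply: is_deriveZ; apply: is_derive_sum => j; exact: is_deriveZ.
Qed.

Lemma is_derive_residual N m f x : (forall y, derivable f y 1) ->
  is_derive x 1 (residual N m f) (residual N m (f^`())%classic x).
Proof.
move=> df.
have -> : residual N m f = f - (autocorr (tent R m) m 0)^-1 \*: convol N (tent R m) m f.
  by apply/funext.
apply: is_deriveB; first by rewrite derive1E; apply: derivableP.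
by apply: is_deriveZ; exact: is_derive_convol.
Qed.

Lemma is_derive_iter_residual N m l f x : (forall y, derivable f y 1) ->
  is_derive x 1 (iter l (residual N m) f) (iter l (residual N m) (f^`())%classic x).
Proof.
move=> df; elim: l x => [|l ih] x.
  by rewrite /= derive1E; apply: derivableP.
rewrite !iterS.
have -> : iter l (residual N m) (f^`())%classic = ((iter l (residual N m) f)^`())%classic.
  by apply/funext => y; rewrite derive1E (@derive_val _ _ _ _ _ _ _ (ih y)).
by apply: is_derive_residual => y; have [] := ih y.
Qed.

(** Induction on the number of derivatives. The bound [E] for the derivative of [f] makes the
    iterated residual [h] of [f] Lipschitz, since residuals commute with differentiation; as
    [m |t| <= 1 + m ^+ 2 * t ^+ 2], one more residual of [h] gains the factor [289 / m]. *)
Lemma iter_residual_smooth N m l f w x : (0 < m < N)%N -> 0 <= w ->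
  (forall k, (k < l)%N -> forall y, derivable (f^`(k))%classic y 1) ->
  (forall y t, `|t| <= pi ->
    `|(f^`(l))%classic y - (f^`(l))%classic (y - t)| <= w * (1 + m%:R ^+ 2 * t ^+ 2)) ->
  `|iter l.+1 (residual N m) f x| <= (289 / m%:R) ^+ l * (289 * w).
Proof.
move=> /andP[m0 mN] w0; elim: l f x => [|l ih] f x df wf.
  by rewrite mul1r; apply: residual_modulus => // t; exact: wf.
have df0 y : derivable f y 1 by exact: (df 0%N).
have ihf y : `|iter l.+1 (residual N m) (f^`())%classic y| <=
    (289 / m%:R) ^+ l * (289 * w).
  apply: ih => [k kl z|z t]; rewrite -?derive1Sn; first exact: df.
  exact: wf.
have m0' : 0 < m%:R :> R by rewrite ltr0n.
pose E := (289 / m%:R) ^+ l * (289 * w).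
have E0 : 0 <= E.
  apply: mulr_ge0; first by rewrite exprn_ge0 ?divr_ge0 ?ler0n.
  by apply: mulr_ge0; first exact: ler0n.
have -> : (289 / m%:R) ^+ l.+1 * (289 * w) = 289 * (E / m%:R).
  by rewrite /E exprS; field; rewrite gt_eqF.
rewrite -/E in ihf; clearbody E; rewrite iterS.
apply: residual_modulus => // t _; set h := iter l.+1 (residual N m) f.
have dh y := @is_derive_iter_residual N m l.+1 f y df0.
have lip a b : a <= b -> `|h b - h a| <= E * (b - a).
  move=> ab.
  have ch : {within `[a, b], continuous h}.
    apply: derivable_within_continuous => y _.
    by have [] := dh y.
  have [c _ ->] := MVT_segment ab (fun y _ => dh y) ch.
  by rewrite normrM (ger0_norm (_ : 0 <= b - a)) ?subr_ge0// ler_wpM2r ?subr_ge0.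
have : `|h x - h (x - t)| <= E * `|t|.
  case: (ger0P t) => t0.
    by have := lip (x - t) x; rewrite gerBl => /(_ t0); rewrite subKr.
  rewrite distrC; have := lip x (x - t); rewrite lerDl oppr_ge0 ltW// => /(_ isT).
  by rewrite (_ : x - t - x = - t)//; ring.
move=> /le_trans; apply; rewrite -mulrA ler_wpM2l// ler_pdivlMl//.
have -> : t ^+ 2 = `|t| ^+ 2 by rewrite -normrX ger0_norm// sqr_ge0.
by have := normr_ge0 t; nra.
Qed.

Lemma derive1_periodic f p : periodic f p -> periodic (f^`())%classic p.
Proof.
move=> fp x; rewrite !derive1E /derive.
have -> // : (fun h : R => h^-1 *: ((f \o shift (x + p)) (h *: (1 : R)) - f (x + p))) =
    (fun h : R => h^-1 *: ((f \o shift x) (h *: (1 : R)) - f x)).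
by apply/funext => h; rewrite /= addrA !fp.
Qed.

Lemma derive1n_periodic f p l : periodic f p -> periodic (f^`(l))%classic p.
Proof. by move=> fp; elim: l => [//|l ih]; rewrite derive1nS; exact: derive1_periodic. Qed.

Lemma periodic_reduce f x : periodic f (pi *+ 2) ->
  exists2 x0 : R, - pi <= x0 <= pi & forall t, f (x + t) = f (x0 + t).
Proof.
move=> fp; have pi0 : 0 < pi :> R := pi_gt0 R.
have perz (k : int) y : f (y + (pi *+ 2) *~ k) = f y.
  case: k => k; first by rewrite -pmulrn; exact: periodicn.
  by rewrite NegzE mulrNz -pmulrn -[LHS](periodicn fp k.+1) subrK.
pose k := Num.floor ((x + pi) / (pi *+ 2)).
exists (x - (pi *+ 2) *~ k) => [|t]; last first.
  by rewrite -[RHS](perz k) addrAC subrK.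
have p2 : 0 < pi *+ 2 :> R by rewrite pmulrn_lgt0.
have := floor_itv ((x + pi) / (pi *+ 2)); rewrite -/k => /andP[].
rewrite ler_pdivlMr// ltr_pdivrMr// intrD mulrDl mul1r mulrzl => h1 h2.
by rewrite -[_ *~ k]mulrzl in h1 h2 *; rewrite -mulr_natr in h1 h2 *; apply/andP; split; lra.
Qed.

(** The Holder bound holds on one period only. If [x0 - t] leaves it, the increment is cut at the
    end point crossed, where [F pi = F (- pi)]; both pieces have length at most [|t|], whence the
    factor 2. *)
Lemma holder_periodic (F : R -> R) (L0 b : R) : 0 <= L0 -> 0 < b ->
  periodic F (pi *+ 2) ->
  (forall x y, - pi <= x <= pi -> - pi <= y <= pi ->
    `|F x - F y| <= L0 * `|x - y| `^ b) ->
  forall x t, `|t| <= pi -> `|F x - F (x - t)| <= 2 * L0 * `|t| `^ b.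
Proof.
move=> L00 b0 Fp HF x t tpi; have pi0 : 0 < pi :> R := pi_gt0 R.
have [x0 /andP[x01 x02] xE] := periodic_reduce x Fp.
have := xE 0; rewrite !addr0 => ->; rewrite xE.
have powle (a : R) : 0 <= a -> a <= `|t| -> L0 * a `^ b <= L0 * `|t| `^ b.
  by move=> a0 at_; rewrite ler_wpM2l// ge0_ler_powR// ?nnegrE// ltW.
have Fpi : F pi = F (- pi).
  by rewrite -[in RHS]Fp -mulr_natr; congr F; ring.
have t2 : 0 <= L0 * `|t| `^ b by rewrite mulr_ge0// powR_ge0.
have [tn tx] := ler_normlP _ _ tpi.
have rx : - pi <= x0 <= pi by rewrite x01 x02.
have rl : - (pi : R) <= (- pi : R) <= (pi : R) by lra.
have rr : - (pi : R) <= (pi : R) <= (pi : R) by lra.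
have p2 : pi *+ 2 = 2 * pi :> R by rewrite mulr_natl.
have half2 u v : u <= L0 * `|t| `^ b -> v <= L0 * `|t| `^ b ->
    u + v <= 2 * L0 * `|t| `^ b.
  by move=> hu hv; lra.
have [h1|h1] := leP (- pi) (x0 - t); last first.
  have -> : F (x0 - t) = F (x0 - t + pi *+ 2) by rewrite Fp.
  have ry : - pi <= x0 - t + pi *+ 2 <= pi by rewrite p2; lra.
  apply: le_trans (ler_distD (F (- pi)) _ _) _; rewrite -{2}Fpi.
  apply: half2.
    apply: le_trans (HF _ _ rx rl) _; apply: powle => //.
    by rewrite ger0_norm; [apply: le_trans (ler_norm _)|]; lra.
  apply: le_trans (HF _ _ rr ry) _; apply: powle => //.
  by rewrite p2 ger0_norm; [apply: le_trans (ler_norm _)|]; lra.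
have [h2|h2] := leP (x0 - t) pi.
  have ry : - pi <= x0 - t <= pi by rewrite h1 h2.
  by apply: le_trans (HF _ _ rx ry) _; rewrite subKr; lra.
have -> : F (x0 - t) = F (x0 - t - pi *+ 2) by rewrite -[RHS]Fp subrK.
have ry : - pi <= x0 - t - pi *+ 2 <= pi by rewrite p2; lra.
apply: le_trans (ler_distD (F pi) _ _) _; rewrite {2}Fpi.
apply: half2.
  apply: le_trans (HF _ _ rx rr) _; apply: powle => //; rewrite distrC -[in leRHS]normrN.
  by rewrite ger0_norm; [apply: le_trans (ler_norm _)|]; lra.
apply: le_trans (HF _ _ rl ry) _; apply: powle => //; rewrite distrC -[in leRHS]normrN.
by rewrite p2 ger0_norm; [apply: le_trans (ler_norm _)|]; lra.
Qed.

End JacksonSmooth.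

(** * Fourier partial sums and the passage to the limit in the quadrature *)

Section FourierPartialSums.
Context (R : realType).
Implicit Types (x w : R) (f : R -> R) (s : nat -> R) (m N K l : nat).

(** The operator identity is exact only on trigonometric polynomials, so it is applied to the
    partial sum [S] of order [n] with [N = n + 1 + K] nodes. Replacing [f] by [S] costs a multiple
    of [e n] whose factor is independent of [N], and [n] tends to infinity. *)
Lemma vp_error s f (e : nat -> R) K l (E : R) w : (1 < K)%N ->
  (forall n y, `|f y - \sum_(k < n.+1) s k * cos (k%:R * y)| <= e n) ->
  e @ \oo --> 0 ->
  (forall N y, (K < N)%N -> `|iter l (residual N K./2) f y| <= E) ->
  `|f w - \sum_(k < K.+1) s k * vp_coef R K k * cos (k%:R * w)| <= 4 * E.
Proof.
move=> K1 fe e0 fE.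
have K20 : (0 < K./2)%N by have := odd_double_half K; lia.
have K2K : (K./2 <= K)%N by have := odd_double_half K; lia.
suff bnd n : (K <= n)%N ->
    `|f w - \sum_(k < K.+1) s k * vp_coef R K k * cos (k%:R * w)| <=
    4 * E + (1 + 4 * 2 ^+ l) * e n.
  have c : (fun n => 4 * E + (1 + 4 * 2 ^+ l) * e n) @ \oo --> 4 * E.
    rewrite -[X in _ --> X]addr0 -(mulr0 (1 + 4 * 2 ^+ l)).
    by apply: cvgD; [exact: cvg_cst|apply: cvgM; [exact: cvg_cst|exact: e0]].
  apply: (cvgr_to_ge c); near=> n; apply: bnd; near: n; exact: nbhs_infty_ge.
move=> Kn; pose N := (n.+1 + K)%N.
pose S y := \sum_(k < n.+1) s k * cos (k%:R * y).
pose O (g : R -> R) := vp_residual N K (iter l (residual N K./2) g).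
have lO : linop O.
  apply: linop_comp; first exact: linop_vp_residual.
  exact/linop_iter/linop_residual.
have OS : O S w = S w - \sum_(k < K.+1) s k * vp_coef R K k * cos (k%:R * w).
  have -> : O S w = \sum_(k < n.+1) s k * O (fun y => cos (k%:R * y)) w.
    exact: (linop_sum n.+1 s (fun k y => cos (k%:R * y)) w lO).
  rewrite /O.
  have -> : \sum_(k < K.+1) s k * vp_coef R K k * cos (k%:R * w) =
      \sum_(k < n.+1) s k * vp_coef R K k * cos (k%:R * w).
    rewrite -(big_mkord xpredT (fun k => s k * vp_coef R K k * cos (k%:R * w))).
    rewrite -(big_mkord xpredT (fun k => s k * vp_coef R K k * cos (k%:R * w))).
    rewrite [RHS](@big_cat_nat _ _ _ K.+1)//= [X in _ = _ + X]big_nat_cond.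
    rewrite [X in _ = _ + X]big1 ?addr0// => k; rewrite andbT => /andP[Kk _].
    by rewrite vp_coef_ge ?mulr0 ?mul0r// ltnW.
  rewrite -sumrB; apply: eq_bigr => k _.
  rewrite vp_residual_iter_cos//; first by ring.
  by have := ltn_ord k; rewrite /N; lia.
have Of : `|O f w| <= 4 * E.
  apply: vp_residual_sup => [|y]; first by rewrite /N; lia.
  by apply: fE; rewrite /N; lia.
have OfS : `|O (fun y => f y - S y) w| <= 4 * (2 ^+ l * e n).
  apply: vp_residual_sup => [|y]; first by rewrite /N; lia.
  apply: iter_residual_sup => [|z]; last exact: fe.
  by rewrite /N K20; lia.
rewrite (linop_sub _ _ _ lO) OS in OfS.
have -> : f w - \sum_(k < K.+1) s k * vp_coef R K k * cos (k%:R * w) =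
    O f w + ((f w - S w) -
      (O f w - (S w - \sum_(k < K.+1) s k * vp_coef R K k * cos (k%:R * w)))).
  by ring.
apply: le_trans (ler_normD _ _) _; apply: lerD => //.
apply: le_trans (ler_normB _ _) _.
by rewrite mulrDl mul1r -mulrA; apply: lerD => //; exact: fe.
Unshelve. all: by end_near. Qed.

Lemma esum_seq_le (I : choiceType) (a : I -> R) (M : R) (r : seq I) : uniq r ->
  (\esum_(j in [set: I]) (a j)%:E <= M%:E)%E -> \sum_(j <- r) a j <= M.
Proof.
move=> ur aM; rewrite -lee_fin; apply: le_trans aM.
apply: esum_ge; exists [set` r] => //.
by rewrite -fsbig_seq// sumEFin.
Qed.

Variables (sigma : int -> R) (M : R).
Hypothesis sigmaN : forall j, sigma (- j) = sigma j.
Hypothesis sigmaM : forall r : seq int, uniq r -> \sum_(j <- r) `|sigma j| <= M.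

Definition fourier_coef (k : nat) : R :=
  (2 * pi)^-1 * (if k == 0%N then sigma 0 else 2 * sigma k%:Z).

Lemma Re_fourier_partial w n : complex.Re (fourier_partial sigma w n) =
  2 * pi * \sum_(k < n.+1) fourier_coef k * cos (k%:R * w).
Proof.
have pi0 : 2 * pi != 0 :> R by rewrite mulf_neq0// gt_eqF ?pi_gt0.
rewrite /fourier_partial /sum_punctured raddfD/= raddf_sum/= mulr_sumr.
rewrite mul0r subr0 cos0 mulr1.
rewrite big_ord_recl/= mulr0n mul0r cos0 mulr1 /fourier_coef eqxx mulrA mulfV// mul1r.
congr (_ + _); rewrite big_add1/= big_mkord; apply: eq_bigr => k _.
rewrite /bump/= add1n !mul0r !subr0 sigmaN mulrNz mulNr cosN.
rewrite -pmulrn; have := pi_gt0 R; generalize (pi : R) => p p0.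
by field; rewrite gt_eqF.
Qed.

Lemma two_pi_inv_le : 0 <= (2 * pi)^-1 * 2 :> R /\ (2 * pi)^-1 * 2 <= 1 :> R.
Proof.
have pi0 : 0 < pi :> R := pi_gt0 R; have pi2 := pi_ge2 R.
split; first by rewrite mulr_ge0// invr_ge0 mulr_ge0// ltW.
by rewrite ler_pdivrMl ?mulr_gt0//; lra.
Qed.

Lemma fourier_coef_le k : `|fourier_coef k| <= `|sigma k%:Z|.
Proof.
have [p0 p1] := two_pi_inv_le.
have -> : fourier_coef k = ((2 * pi)^-1 * 2) * (if k == 0%N then sigma 0 / 2 else sigma k%:Z).
  rewrite /fourier_coef; have := pi_gt0 R; generalize (pi : R) => p pgt0.
  by case: eqP => _; [field; rewrite gt_eqF|ring].
rewrite normrM ger0_norm//; apply: (@le_trans _ _ `|if k == 0%N then sigma 0 / 2 else sigma k%:Z|).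
  by rewrite ler_piMl.
case: eqP => [->|//]; rewrite normrM (@ger0_norm _ 2^-1)//.
by have := normr_ge0 (sigma 0); lra.
Qed.

Lemma sum_fourier_coef_le n : \sum_(k < n) `|fourier_coef k| <= M.
Proof.
apply: le_trans (sigmaM (r := [seq k%:Z | k <- iota 0 n]) _); last first.
  by rewrite map_inj_uniq ?iota_uniq// => i j [].
have -> : iota 0 n = index_iota 0 n by rewrite /index_iota subn0.
rewrite big_map big_mkord.
by apply: ler_sum => k _; exact: fourier_coef_le.
Qed.

Lemma spectral_density_uniform : exists2 e : nat -> R, e @ \oo --> 0 &
  forall n w, `|spectral_density sigma w -
    \sum_(k < n.+1) fourier_coef k * cos (k%:R * w)| <= e n.
Proof.
pose A n := \sum_(k < n) `|fourier_coef k|.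
have ndA : nondecreasing_seq A.
  by apply/nondecreasing_seqP => n; rewrite /A big_ord_recr/= lerDl.
have cA : cvgn A.
  apply: nondecreasing_is_cvgn => //; exists M => _ [n _ <-].
  exact: sum_fourier_coef_le.
exists (fun n => limn A - A n.+1).
  rewrite -(subrr (limn A)); apply: cvgB; first exact: cvg_cst.
  by rewrite cvg_shiftS.
move=> n w; pose u k := fourier_coef k * cos (k%:R * w).
have AE : A = series (fun k => `|fourier_coef k|).
  by apply/funext => i; rewrite /A /series/= big_mkord.
have cu : cvgn (series u).
  apply: normed_cvg; rewrite /=.
  apply: (@series_le_cvg _ (fun k => `|u k|) (fun k => `|fourier_coef k|)) => //.
  - by move=> k; rewrite normrM ler_piMr// cos_max.
  - by rewrite -AE.
have uE i : series u i = \sum_(k < i) u k by rewrite /series/= big_mkord.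
have -> : spectral_density sigma w = limn (series u).
  rewrite /spectral_density.
  have pi0 : 2 * pi != 0 :> R by rewrite mulf_neq0// gt_eqF ?pi_gt0.
  have -> : (fun i => complex.Re (fourier_partial sigma w i)) =
      (fun i => 2 * pi * series u i.+1).
    by apply/funext => i; rewrite Re_fourier_partial uE.
  have c2 : (fun i => 2 * pi * series u i.+1) @ \oo --> 2 * pi * limn (series u).
    apply: cvgM; first exact: cvg_cst.
    by rewrite (cvg_shiftS (series u)).
  by rewrite (cvg_lim _ c2)// mulrA mulVf// mul1r.
have c3 : (fun i => `|series u i - \sum_(k < n.+1) u k|) @ \oo -->
    `|limn (series u) - \sum_(k < n.+1) u k|.
  by apply: cvg_norm; apply: cvgB; [exact: cu|exact: cvg_cst].
apply: (cvgr_to_le c3); near=> i.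
have ni : (n.+1 <= i)%N by near: i; exact: nbhs_infty_ge.
apply: (@le_trans _ _ (A i - A n.+1)); last first.
  by rewrite lerD2r; exact: nondecreasing_cvgn_le.
rewrite AE -uE /series/= !(big_cat_nat (leq0n n.+1) ni)/=.
rewrite !(addrC (\sum_(0 <= k < n.+1) _)) !addrK.
apply: le_trans (ler_norm_sum _ _ _) _; apply: ler_sum => k _.
by rewrite normrM ler_piMr// cos_max.
Unshelve. all: by end_near. Qed.

End FourierPartialSums.

(** * Bias *)

Section Bias.
Context (R : realType).
Variables (sigma : int -> R) (M : R).
Hypothesis sigmaN : forall j, sigma (- j) = sigma j.
Hypothesis sigmaM : forall r : seq int, uniq r -> \sum_(j <- r) `|sigma j| <= M.

Definition taper_weight (K : nat) (w : R) (m : nat) : R :=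
  2 * taper R K m%:Z * cos (w * m%:R).

(** The left-hand side is the mean of the estimator without clipping; the taper turns it into a de
    la Vallee Poussin mean. *)
Lemma tapered_mean K w : (0 < K)%N ->
  (2 * pi)^-1 * (sigma 0 + \sum_(1 <= m < K.+1) taper_weight K w m * sigma m%:Z) =
  \sum_(k < K.+1) fourier_coef sigma k * vp_coef R K k * cos (k%:R * w).
Proof.
move=> K0; rewrite big_ord_recl/= (vp_coef_low R (leq0n _) K0) mul0r cos0 !mulr1.
rewrite mulrDr; congr (_ + _).
rewrite big_add1/= big_mkord mulr_sumr; apply: eq_bigr => k _.
rewrite /bump/= add1n vp_coef_taper//.
by rewrite /taper_weight /fourier_coef/= [w * _]mulrC; ring.
Qed.

Lemma spectral_density_periodic : periodic (spectral_density sigma) (pi *+ 2).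
Proof.
move=> w; rewrite /spectral_density.
have -> // : (fun n => complex.Re (fourier_partial sigma (w + pi *+ 2) n)) =
    (fun n => complex.Re (fourier_partial sigma w n)).
apply/funext => n; rewrite !Re_fourier_partial//; congr (_ * _).
apply: eq_bigr => k _; congr (_ * _).
rewrite mulrDr (_ : k%:R * (pi *+ 2) = (pi *+ 2) *+ k) ?mulr_natl//.
exact/periodicn/cosD2pi.
Qed.

Lemma powRN_half (K : nat) (b : R) : 0 <= b -> (1 < K)%N ->
  (K./2)%:R `^ (- b) <= 3 `^ b * K%:R `^ (- b).
Proof.
move=> b0 K1.
have h0 : 0 < (K./2)%:R :> R by rewrite ltr0n; have := odd_double_half K; lia.
have K0 : 0 < K%:R :> R by rewrite ltr0n; lia.
(* The worst case is [K = 3]. *)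
have Kh : K%:R <= 3 * (K./2)%:R :> R.
  by rewrite -natrM ler_nat; have := odd_double_half K; case: (odd K); lia.
rewrite !powRN ler_pdivlMr ?powR_gt0// mulrC ler_pdivrMr ?powR_gt0//.
rewrite -(powRM b (_ : 0 <= 3) (ltW h0))//.
by apply: ge0_ler_powR => //; rewrite nnegrE ?mulr_ge0// ltW.
Qed.

Lemma powR_le_one_sqr (u b : R) : 0 <= u -> 0 < b <= 1 -> u `^ b <= 1 + u ^+ 2.
Proof.
move=> u0 /andP[b0 b1]; have [u1|u1] := leP u 1.
  apply: (@le_trans _ _ 1); last by rewrite lerDl sqr_ge0.
  have := @ge0_ler_powR R b (ltW b0) u 1; rewrite powR1 !nnegrE => -> //.
have : u `^ b <= u `^ 1 by apply: ler_powR => //; exact: ltW.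
by rewrite powRr1//; nra.
Qed.

Lemma bias_W_infty (s L0 L : R) K w : 0 < s -> 0 < L0 -> (1 < K)%N ->
  W_infty s L0 L sigma ->
  `|spectral_density sigma w - (2 * pi)^-1 *
      (sigma 0 + \sum_(1 <= m < K.+1) taper_weight K w m * sigma m%:Z)| <=
  4 * (289 `^ s * 289 * (2 * L0) * 3 `^ s) * K%:R `^ (- s).
Proof.
move=> s0 L00 K1 [_ _ [l [/andP[ls sl] df hf]]].
rewrite tapered_mean; last by lia.
set f := spectral_density sigma in df hf *.
have [e e0 fe] := spectral_density_uniform sigmaN sigmaM.
have b01 : 0 < s - l%:R <= 1 by rewrite -natr1 in sl; lra.
have /andP[b0 _] := b01.
have h0 : (0 < K./2)%N by have := odd_double_half K; lia.
have h0' : 0 < (K./2)%:R :> R by rewrite ltr0n.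
have hold := @holder_periodic _ (f^`(l))%classic L0 _ (ltW L00) b0
  (derive1n_periodic l spectral_density_periodic) hf.
(* With this [w'] the Holder bound becomes [w'] times the power [s - l] of [K./2 * |t|], which
   [powR_le_one_sqr] brings to the form required by [iter_residual_smooth]. *)
pose w' := 2 * L0 * (K./2)%:R `^ (- (s - l%:R)).
have w'0 : 0 <= w' by rewrite mulr_ge0 ?powR_ge0// mulr_ge0// ltW.
have wf y t : `|t| <= pi -> `|(f^`(l))%classic y - (f^`(l))%classic (y - t)| <=
    w' * (1 + (K./2)%:R ^+ 2 * t ^+ 2).
  move=> tpi; apply: le_trans (hold y t tpi) _.
  rewrite /w' -[X in _ <= X]mulrA ler_wpM2l ?mulr_ge0 ?(ltW L00)//.
  have := powR_le_one_sqr (u := (K./2)%:R * `|t|) (b := s - l%:R).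
  rewrite b01 mulr_ge0// => /(_ isT isT).
  rewrite powRM ?(ltW h0')// powRN exprMn -[`|t| ^+ 2]normrX (ger0_norm (sqr_ge0 t)) => h.
  by rewrite ler_pdivlMl ?powR_gt0.
rewrite -[leRHS]mulrA; apply: (@vp_error R (fourier_coef sigma) f e K l.+1 _ w K1 fe e0) => N y KN.
apply: le_trans (iter_residual_smooth (N := N) (m := K./2) (w := w') _ _ _ _ _) _ => //.
- by move: K1 KN; clear; have := odd_double_half K; lia.
- by move=> k kl z; have [_] := df k kl; exact.
have -> : (289 / (K./2)%:R) ^+ l * (289 * w') =
    289 ^+ l * 289 * (2 * L0) * (K./2)%:R `^ (- s) :> R.
  rewrite /w' (_ : - s = - l%:R + - (s - l%:R)); last by ring.
  rewrite powRD; last by apply/implyP => _; rewrite gt_eqF.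
  by rewrite (powRN _ l%:R) powR_mulrn// exprMn exprVn; ring.
rewrite -[X in _ <= X]mulrA; apply: ler_pM.
- by rewrite !mulr_ge0 ?exprn_ge0 ?ler0n// ltW.
- exact: powR_ge0.
- rewrite ler_wpM2r ?mulr_ge0 ?(ltW L00) ?ler0n// ler_wpM2r ?ler0n//.
  by rewrite -powR_mulrn ?ler0n// ler_powR ?ler1n// ltW.
- by apply: powRN_half => //; exact: ltW.
Qed.

(** Compares the terms of the tail with a telescoping difference, by [ln (1 + x) <= x] and
    [1 + x <= expR x] instead of an integral. *)
Lemma powR_tail_step (q : R) (k : nat) : 0 < q -> (0 < k)%N ->
  q * k.+1%:R `^ (- (q + 1)) <= k%:R `^ (- q) - k.+1%:R `^ (- q).
Proof.
move=> q0 k0.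
have k0' : 0 < k%:R :> R by rewrite ltr0n.
have k1 : 0 < k.+1%:R :> R by rewrite ltr0n.
have lnk : ln k%:R <= ln k.+1%:R - k.+1%:R^-1 :> R.
  suff : ln (k%:R / k.+1%:R) <= - k.+1%:R^-1 :> R by rewrite ln_div ?posrE// lerBlDr addrC.
  have -> : k%:R / k.+1%:R = 1 + - k.+1%:R^-1 :> R.
    by rewrite -natr1; field; rewrite natr1 gt_eqF.
  by apply: le_ln1Dx; rewrite ltrN2 invf_lt1// ltr1n ltnS.
rewrite !powRN /powR !gt_eqF// -!expRN.
have : expR (- (q * ln k.+1%:R)) * (1 + q / k.+1%:R) <= expR (- (q * ln k%:R)).
  apply: (@le_trans _ _ (expR (- (q * ln k.+1%:R)) * expR (q / k.+1%:R))).
    by rewrite ler_wpM2l ?expR_ge0// expR_ge1Dx.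
  rewrite -expRD ler_expR.
  by rewrite addrC -opprB lerN2 -mulrBr ler_wpM2l// ltW.
rewrite mulrDl mul1r opprD expRD [X in _ * (_ * X)]expRN lnK ?posrE//.
by rewrite mulrDr mulr1 => h; rewrite lerBrDl; apply: le_trans h; rewrite mulrCA.
Qed.

Lemma powR_tail (q : R) (h n : nat) : 0 < q -> (0 < h)%N -> (h <= n)%N ->
  \sum_(h.+1 <= k < n.+1) k%:R `^ (- (q + 1)) <= h%:R `^ (- q) / q.
Proof.
move=> q0 h0 hn; rewrite ler_pdivlMr// mulr_suml.
apply: (@le_trans _ _ (\sum_(h <= k < n) (k%:R `^ (- q) - k.+1%:R `^ (- q)))).
  rewrite big_add1/= big_nat_cond [leRHS]big_nat_cond; apply: ler_sum => k.
  rewrite andbT => /andP[hk _]; rewrite mulrC; apply: powR_tail_step => //.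
  exact: leq_trans hk.
have -> : \sum_(h <= k < n) (k%:R `^ (- q) - k.+1%:R `^ (- q)) =
    h%:R `^ (- q) - n%:R `^ (- q) :> R.
  under eq_bigr => k _ do rewrite -[k%:R `^ _]opprK addrC.
  rewrite (telescope_sumr (fun k => - (k%:R `^ (- q))))//.
  by rewrite opprK addrC.
by rewrite gerBl powR_ge0.
Qed.

Lemma bias_W_2 (s L : R) K w : 2^-1 < s -> 0 < L -> (1 < K)%N ->
  W_2 s L sigma ->
  `|spectral_density sigma w - (2 * pi)^-1 *
      (sigma 0 + \sum_(1 <= m < K.+1) taper_weight K w m * sigma m%:Z)| <=
  (L + (2 * s - 1)^-1) * 3 `^ (s - 2^-1) * K%:R `^ (- (s - 2^-1)).
Proof.
move=> s2 L0 K1 [_ HL _].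
rewrite tapered_mean; last by lia.
have [e e0 fe] := spectral_density_uniform sigmaN sigmaM.
set f := spectral_density sigma in fe *.
set q := 2 * s - 1; have q0 : 0 < q by rewrite /q; lra.
set h := K./2; have h0 : (0 < h)%N by rewrite /h; have := odd_double_half K; lia.
have hK : (h <= K)%N by rewrite /h; have := odd_double_half K; lia.
have h0' : 0 < h%:R :> R by rewrite ltr0n.
have coef k : `|1 - vp_coef R K k| <= 1.
  have [kh|hk] := leqP k h; first by rewrite vp_coef_low ?subrr ?normr0//; lia.
  rewrite vp_coef_high//.
  have K0 : 0 < K%:R :> R by rewrite ltr0n; lia.
  have : 2 * (K - k)%:R <= K%:R :> R.
    by rewrite -natrM ler_nat; move: hk; rewrite /h; have := odd_double_half K; case: (odd K); lia.
  rewrite -(ler_pM2l (_ : 0 < K%:R^-1)) ?invr_gt0// mulVf ?gt_eqF// => le1.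
  have ge0 : 0 <= K%:R^-1 * (2 * (K - k)%:R) :> R by rewrite mulr_ge0.
  by rewrite ler_norml; lra.
(* The weight in the inequality between means that stands in for Cauchy-Schwarz. It balances the
   weighted energy, at most [lam * L], against the tail of the powers, at most [lam / q]. *)
pose lam := h%:R `^ (- (q / 2)) : R.
have lam0 : 0 < lam by rewrite powR_gt0.
have lamE : h%:R `^ (- q) = lam ^+ 2.
  rewrite /lam expr2 -powRD; last by apply/implyP => _; rewrite gt_eqF.
  by congr (_ `^ _); field.
have amgm k : (0 < k)%N -> `|sigma k%:Z| <=
    2^-1 * (lam * (`|sigma k%:Z| ^+ 2 * k%:R `^ (2 * s)) +
            lam^-1 * k%:R `^ (- (q + 1))).
  move=> k0; set a := `|sigma k%:Z|.
  have k0' : 0 < k%:R :> R by rewrite ltr0n.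
  have -> : q + 1 = 2 * s by rewrite /q; ring.
  rewrite powRN; set p := k%:R `^ (2 * s).
  have p0 : 0 < p by rewrite powR_gt0.
  have -> : 2^-1 * (lam * (a ^+ 2 * p) + lam^-1 * p^-1) =
     a + 2^-1 * (lam * p * a - 1) ^+ 2 / (lam * p).
    by field; rewrite !gt_eqF.
  rewrite lerDl; apply: mulr_ge0; first by apply: mulr_ge0 => //; exact: sqr_ge0.
  by rewrite invr_ge0; apply: mulr_ge0; exact: ltW.
have tail n : (K <= n)%N -> \sum_(h.+1 <= k < n.+1) `|sigma k%:Z| <= lam * (L + q^-1).
  move=> Kn.
  apply: (@le_trans _ _ (2^-1 * (lam * L + lam^-1 * (lam ^+ 2 / q)))).
    apply: (@le_trans _ _ (2^-1 * (lam *
       \sum_(h.+1 <= k < n.+1) (`|sigma k%:Z| ^+ 2 * k%:R `^ (2 * s)) +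
        lam^-1 * \sum_(h.+1 <= k < n.+1) k%:R `^ (- (q + 1))))).
      rewrite !mulr_sumr -big_split/= mulr_sumr.
      rewrite big_nat_cond [leRHS]big_nat_cond; apply: ler_sum => k.
      by rewrite andbT => /andP[hk _]; apply: amgm; lia.
    rewrite ler_pM2l//; apply: lerD; rewrite ler_pM2l ?invr_gt0//.
      have := esum_seq_le (r := [seq k%:Z | k <- index_iota h.+1 n.+1]) _ HL.
      rewrite big_map => -> //.
      by rewrite map_inj_uniq ?iota_uniq// => i j [].
    by rewrite -lamE; apply: powR_tail => //; exact: leq_trans hK Kn.
  rewrite (_ : lam^-1 * (lam ^+ 2 / q) = lam / q); last by field; rewrite !gt_eqF.
  have : 0 <= lam * L by rewrite mulr_ge0 ?ltW.
  have : 0 <= lam / q by rewrite divr_ge0 ?ltW.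
  by rewrite mulrDr; lra.
have bnd n : (K <= n)%N ->
    `|f w - \sum_(k < K.+1) fourier_coef sigma k * vp_coef R K k * cos (k%:R * w)|
    <= e n + lam * (L + q^-1).
  move=> Kn; pose S := \sum_(k < n.+1) fourier_coef sigma k * cos (k%:R * w).
  rewrite -(subrKA S); apply: le_trans (ler_normD _ _) _; apply: lerD; first exact: fe.
  apply: le_trans (tail n Kn).
  have -> : \sum_(k < K.+1) fourier_coef sigma k * vp_coef R K k * cos (k%:R * w) =
      \sum_(k < n.+1) fourier_coef sigma k * vp_coef R K k * cos (k%:R * w).
    rewrite -(big_mkord xpredT (fun k => fourier_coef sigma k * vp_coef R K k * cos (k%:R * w))).
    rewrite -(big_mkord xpredT (fun k => fourier_coef sigma k * vp_coef R K k * cos (k%:R * w))).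
    rewrite [RHS](@big_cat_nat _ _ _ K.+1)//= [X in _ = _ + X]big_nat_cond.
    rewrite [X in _ = _ + X]big1 ?addr0// => k; rewrite andbT => /andP[Kk _].
    by rewrite vp_coef_ge ?mulr0 ?mul0r// ltnW.
  rewrite /S -sumrB.
  rewrite -(big_mkord xpredT (fun k => fourier_coef sigma k * cos (k%:R * w) -
    fourier_coef sigma k * vp_coef R K k * cos (k%:R * w))).
  rewrite (@big_cat_nat _ _ _ h.+1)//=; last by lia.
  rewrite big_nat_cond big1 ?add0r => [|k]; last first.
    by rewrite andbT ltnS => kh; rewrite vp_coef_low ?mulr1 ?subrr//; lia.
  apply: le_trans (ler_norm_sum _ _ _) _; apply: ler_sum => k _.
  rewrite (_ : _ - _ = fourier_coef sigma k * ((1 - vp_coef R K k) * cos (k%:R * w))); last by ring.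
  rewrite normrM -[leRHS]mulr1; apply: ler_pM => //; first exact: fourier_coef_le.
  by rewrite normrM -[leRHS]mulr1; apply: ler_pM => //; exact: cos_max.
have c : (fun n => e n + lam * (L + q^-1)) @ \oo --> 0 + lam * (L + q^-1).
  by apply: cvgD; [exact: e0|exact: cvg_cst].
rewrite add0r in c.
apply: (@le_trans _ _ (lam * (L + q^-1))).
  by apply: (cvgr_to_ge c); near=> n; apply: bnd; near: n; exact: nbhs_infty_ge.
have A0 : 0 <= L + q^-1 by rewrite addr_ge0 ?invr_ge0 ?ltW.
rewrite -[leRHS]mulrA [leLHS]mulrC ler_wpM2l//.
rewrite /lam (_ : q / 2 = s - 2^-1); last by rewrite /q; field.
by apply: powRN_half => //; lra.
Unshelve. all: by end_near. Qed.

End Bias.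

(** * Moments of the sample and of the noise *)

Section GaussianFamily.
Context d (T : measurableType d) (R : realType) (P : probability T R).
Local Notation mom := (mom P).
Local Notation ev := (ev P).
Variables (X : int -> {RV P >-> R}) (sigma : int -> R).
Hypothesis gX : centered_stationary_gaussian X sigma.
Hypothesis sigmaN : forall j, sigma (- j) = sigma j.

Lemma mom_gaussian t : mom (X t).
Proof.
have [gp _ _] := gX; have [m [s [_ law]]] := gp [:: t] (fun=> 1).
have mXt : measurable_fun [set: T] (X t) by [].
apply: (@mom_normal _ _ _ P _ m s mXt).
rewrite [X in normal_law _ X](_ : _ = fun w => \sum_(u <- [:: t]) 1 * X u w)//.
by apply/funext => x; rewrite big_seq1 mul1r.
Qed.

Lemma ev_gaussian t : ev (X t) = 0.
Proof.
have [_ e0 _] := gX; apply: EFin_inj; rewrite -ev_EFin; last exact: mom_gaussian.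
by have := e0 t; rewrite unlock.
Qed.

Lemma ev_gaussian2 t u : ev (fun x => X t x * X u x) = sigma (t - u).
Proof.
have [_ e0 cv] := gX; apply: EFin_inj; rewrite -ev_EFin; last first.
  by apply: mom_mul; exact: mom_gaussian.
have := cv t (u - t); rewrite addrC subrK -sigmaN opprB => <-.
rewrite unlock !e0/= unlock; apply: eq_integral => x _.
by rewrite [in RHS]/GRing.mul /= !subr0.
Qed.

Section Combination.
Variables (J : eqType) (r : seq J) (e : J -> R) (idx : J -> int).
Let Y x := \sum_(j <- r) e j * X (idx j) x.

Lemma mom_combination : mom Y.
Proof. by apply: mom_sum => j _ _; apply: mom_scale; exact: mom_gaussian. Qed.

Lemma gaussian_combination : exists s : R, normal_law P Y 0 s.
Proof.
have [gp _ _] := gX.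
(* [idx] may repeat a time, while [gaussian_process] attaches one coefficient to each time;
   coefficients are therefore collected by time. *)
pose r' := undup (map idx r); pose c t := \sum_(j <- r | idx j == t) e j.
have [m [s [_ law]]] := gp r' c.
have YE : Y = fun x => \sum_(t <- r') c t * X t x.
  apply/esym/funext => x; rewrite /c; under eq_bigr do rewrite mulr_suml big_mkcond.
  rewrite exchange_big/=; apply: eq_big_seq => j jr.
  rewrite (bigD1_seq (idx j)) ?undup_uniq//=; last first.
    by rewrite mem_undup map_f.
  by rewrite eqxx big1 ?addr0// => t /negbTE; rewrite eq_sym => ->.
have lawY : normal_law P Y m s by rewrite YE.
exists s; rewrite -(normal_centered _ lawY)//; first exact: mom_meas mom_combination.
rewrite /Y ev_sum => [|j _ _]; last by apply: mom_scale; exact: mom_gaussian.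
apply: big1 => j _; rewrite ev_scale; last exact: mom_gaussian.
by rewrite ev_gaussian mulr0.
Qed.

Lemma ev_combination2 : ev (fun x => Y x ^+ 2) =
  \sum_(j <- r) \sum_(k <- r) e j * e k * sigma (idx j - idx k).
Proof.
have momt j k : mom (fun x => (e j * e k) * (X (idx j) x * X (idx k) x)).
  by apply: mom_scale; apply: mom_mul; exact: mom_gaussian.
rewrite (eq_ev (g := fun x => \sum_(j <- r) \sum_(k <- r)
    (e j * e k) * (X (idx j) x * X (idx k) x))); last first.
  move=> x; rewrite expr2 /Y mulr_suml; apply: eq_bigr => j _.
  by rewrite mulr_sumr; apply: eq_bigr => k _; rewrite mulrACA.
rewrite ev_sum => [|j _ _]; last by apply: mom_sum.
apply: eq_bigr => j _; rewrite ev_sum//; apply: eq_bigr => k _.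
by rewrite ev_scale ?ev_gaussian2//; apply: mom_mul; exact: mom_gaussian.
Qed.

Lemma ev_combination4 : ev (fun x => Y x ^+ 4) = 3 * ev (fun x => Y x ^+ 2) ^+ 2.
Proof.
have [s law] := gaussian_combination.
have [-> ->] := normal_moments (mom_meas mom_combination) law.
by rewrite -exprM.
Qed.

Lemma combination_mgf (V t : R) : ev (fun x => Y x ^+ 2) <= V ->
  (\int[P]_x (expR (t * Y x))%:E <= (expR (t ^+ 2 * V / 2))%:E)%E.
Proof.
have [s law] := gaussian_combination; have mY := mom_meas mom_combination.
have [-> _] := normal_moments mY law => sV.
rewrite (normal_mgf_integral mY law) mul0r add0r lee_fin ler_expR.
by rewrite ler_pM2r// ler_wpM2l// sqr_ge0.
Qed.

End Combination.

(* Isserlis' formula, obtained from the fourth moment of linear combinations by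
   polarization. *)
Lemma ev_gaussian4 (t1 t2 t3 t4 : int) :
  ev (fun x => X t1 x * X t2 x * (X t3 x * X t4 x)) =
  sigma (t1 - t2) * sigma (t3 - t4) + sigma (t1 - t3) * sigma (t2 - t4) +
  sigma (t1 - t4) * sigma (t2 - t3).
Proof.
pose idx (j : 'I_4) : int := nth t1 [:: t1; t2; t3; t4] j.
pose e (b1 b2 b3 : bool) (j : 'I_4) : R :=
  nth 1 [:: 1; (-1) ^+ b1; (-1) ^+ b2; (-1) ^+ b3] j.
pose Y b1 b2 b3 x := \sum_(j <- enum 'I_4) e b1 b2 b3 j * X (idx j) x.
have YE b1 b2 b3 x : Y b1 b2 b3 x = X t1 x + (-1) ^+ b1 * X t2 x +
    (-1) ^+ b2 * X t3 x + (-1) ^+ b3 * X t4 x.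
  by rewrite /Y big_enum/= !big_ord_recl big_ord0 /e /idx /= mul1r addr0 !addrA.
have sN a b : sigma (a - b) = sigma (b - a) by rewrite -sigmaN opprB.
have E4 b1 b2 b3 : ev (fun x => Y b1 b2 b3 x ^+ 4) = 3 * (4 * sigma 0 +
    2 * ((-1) ^+ b1 * sigma (t1 - t2) + (-1) ^+ b2 * sigma (t1 - t3) +
    (-1) ^+ b3 * sigma (t1 - t4) + (-1) ^+ b1 * (-1) ^+ b2 * sigma (t2 - t3) +
    (-1) ^+ b1 * (-1) ^+ b3 * sigma (t2 - t4) +
    (-1) ^+ b2 * (-1) ^+ b3 * sigma (t3 - t4))) ^+ 2.
  rewrite ev_combination4 ev_combination2; congr (3 * _ ^+ 2).
  rewrite big_enum/= !big_ord_recl big_ord0 !big_enum/= !big_ord_recl !big_ord0.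
  rewrite /e /idx /= !subrr.
  rewrite (sN t2 t1) (sN t3 t1) (sN t4 t1) (sN t3 t2) (sN t4 t2) (sN t4 t3).
  by case: b1; case: b2; case: b3; rewrite /= ?expr0 ?expr1; ring.
pose f b1 b2 b3 x := Y b1 b2 b3 x ^+ 4.
have mf b1 b2 b3 : mom (f b1 b2 b3) by apply: mom_exp; exact: mom_combination.
(* In the sum over the 8 sign patterns, weighted by the product of signs, only the mixed monomial
   survives, with coefficient [8 * 4! = 192]. *)
rewrite (eq_ev (g := fun x => 192^-1 * (f false false false x -
  f false false true x - f false true false x +
  f false true true x - f true false false x + f true false true x +
  f true true false x - f true true true x))); last first.
  by move=> x; rewrite /f !YE /= ?expr0 ?expr1; field.
rewrite ev_scale; last by repeat (first [exact: mf|apply: mom_sub|apply: mom_add]).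
rewrite !(ev_sub, ev_add);
  try by repeat (first [exact: mf|apply: mom_sub|apply: mom_add]).
by rewrite /f !E4 /= ?expr0 ?expr1; field.
Qed.

End GaussianFamily.

Section NoiseMoments.
Context d (T : measurableType d) (R : realType) (P : probability T R).
Local Notation mom := (mom P).
Local Notation ev := (ev P).
Variables (X : int -> {RV P >-> R}) (sigma : int -> R).
Hypothesis gX : centered_stationary_gaussian X sigma.
Hypothesis sigmaN : forall j, sigma (- j) = sigma j.
Variables (n K : nat) (b b' : R) (xi xi' : nat -> {RV P >-> R}).
Hypothesis b0 : 0 < b.
Hypothesis b'0 : 0 < b'.
Hypothesis noise : privacy_noise n K b b' X xi xi'.

Lemma mom_noise i : (1 <= i <= n)%N -> mom (xi i).
Proof. by move=> /(let: And3 H _ _ := noise in H); apply: mom_laplace. Qed.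

Lemma mom_noise' i : (K.+1 <= i <= n)%N -> mom (xi' i).
Proof. by move=> /(let: And3 _ H _ := noise in H); apply: mom_laplace. Qed.

Lemma ev_noise i : (1 <= i <= n)%N -> ev (xi i) = 0.
Proof. by move=> /(let: And3 H _ _ := noise in H); apply: ev_laplace. Qed.

Lemma ev_noise' i : (K.+1 <= i <= n)%N -> ev (xi' i) = 0.
Proof. by move=> /(let: And3 _ H _ := noise in H); apply: ev_laplace. Qed.

Lemma ev_noise_sqr i : (1 <= i <= n)%N -> ev (fun x => xi i x ^+ 2) <= 16 * b ^+ 2.
Proof. by move=> /(let: And3 H _ _ := noise in H); apply: laplace_second_moment. Qed.

Lemma ev_noise'_sqr i : (K.+1 <= i <= n)%N ->
  ev (fun x => xi' i x ^+ 2) <= 16 * b' ^+ 2.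
Proof. by move=> /(let: And3 _ H _ := noise in H); apply: laplace_second_moment. Qed.

Lemma sigma_of_preimage (Y : T -> R) (h : R -> R) (A : set R) :
  measurable_fun [set: R] h -> measurable A ->
  sigma_of Y ((fun x => h (Y x)) @^-1` A).
Proof.
move=> mh mA; exists (h @^-1` A); last by rewrite setTI.
by rewrite -[X in measurable X]setTI; exact: mh.
Qed.

(** The whole sample is a single source of randomness, so a product of two observations must enter
    independence as one variable. *)
Lemma sigma_sample_preimage i j (A : set R) : (1 <= i <= n)%N -> (1 <= j <= n)%N ->
  measurable A -> sigma_sample X n ((fun x => X i%:Z x * X j%:Z x) @^-1` A).
Proof.
move=> hi hj mA.
set G := \bigcup_(k in [set k : nat | (1 <= k <= n)%N]) sigma_of (X k%:Z).
have mX k : (1 <= k <= n)%N ->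
    measurable_fun [set: g_sigma_algebraType G] (X k%:Z : g_sigma_algebraType G -> R).
  move=> hk _ B mB; rewrite setTI; apply: sub_sigma_algebra; exists k => //.
  by apply: (@sigma_of_preimage (X k%:Z) id).
have := measurable_funM (mX _ hi) (mX _ hj).
by move=> /(_ measurableT _ mA); rewrite setTI.
Qed.

Lemma ev_sample_noise i j k l : (1 <= i <= n)%N -> (1 <= j <= n)%N ->
  (1 <= k <= n)%N -> (1 <= l <= n)%N ->
  ev (fun x => X i%:Z x * X j%:Z x * (xi k x * xi l x)) =
  if k == l then sigma (i%:Z - j%:Z) * ev (fun x => xi k x ^+ 2) else 0.
Proof.
move=> hi hj hk hl; have [_ _ indep] := noise.
have mXX : mom (fun x => X i%:Z x * X j%:Z x).
  by apply: mom_mul; exact: (mom_gaussian gX).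
have mXA A : measurable A ->
  sigma_sample X n ((fun x => X i%:Z x * X j%:Z x) @^-1` A).
  exact: sigma_sample_preimage.
have [kl|kl] := eqVneq k l.
  (* The sources of a product must be distinct, so for [k = l] the square of [xi k] is taken as one
     factor. *)
  rewrite -kl -(ev_gaussian2 gX sigmaN).
  pose u (s : source) x := match s with
    | inl _ => X i%:Z x * X j%:Z x | inr (inl a) => xi a x ^+ 2
    | inr (inr a) => 0 end.
  pose r : seq source := [:: inl tt; inr (inl k)].
  rewrite (eq_ev (g := fun x => \prod_(s <- r) u s x)); last first.
    by move=> x; rewrite !big_cons big_nil mulr1 -expr2.
  rewrite (ev_prod indep)//; first by rewrite !big_cons big_nil mulr1.
  move=> s; rewrite !inE => /orP[/eqP->|/eqP->]; split => //.
  - by apply: mom_exp; exact: mom_noise.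
  - move=> A mA; apply: (@sigma_of_preimage (xi k) (fun y => y ^+ 2)) => //.
pose u (s : source) x := match s with
  | inl _ => X i%:Z x * X j%:Z x | inr (inl a) => xi a x
  | inr (inr a) => 0 end.
pose r : seq source := [:: inl tt; inr (inl k); inr (inl l)].
rewrite (eq_ev (g := fun x => \prod_(s <- r) u s x)); last first.
  by move=> x; rewrite !big_cons big_nil mulr1.
rewrite (ev_prod indep).
- by rewrite !big_cons big_nil /= ev_noise// mul0r mulr0.
- by rewrite /= !inE /= andbT; apply: contra kl => /eqP[->].
- move=> s; rewrite !inE => /or3P[/eqP->|/eqP->|/eqP->]; split => //.
  + exact: mom_noise.
  + by move=> A mA; apply: (@sigma_of_preimage (xi k) id).
  + exact: mom_noise.
  + by move=> A mA; apply: (@sigma_of_preimage (xi l) id).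
Qed.

Lemma ev_noise'_mul k l : (K.+1 <= k <= n)%N -> (K.+1 <= l <= n)%N -> k != l ->
  ev (fun x => xi' k x * xi' l x) = 0.
Proof.
move=> hk hl kl; have [_ _ indep] := noise.
pose u (s : source) x := match s with
  | inl _ => 0 | inr (inl a) => 0 | inr (inr a) => xi' a x end.
pose r : seq source := [:: inr (inr k); inr (inr l)].
rewrite (eq_ev (g := fun x => \prod_(s <- r) u s x)); last first.
  by move=> x; rewrite !big_cons big_nil mulr1.
rewrite (ev_prod indep).
- by rewrite !big_cons big_nil /= ev_noise'// mul0r.
- by rewrite /= !inE /= andbT; apply: contra kl => /eqP[->].
- move=> s; rewrite !inE => /orP[/eqP->|/eqP->]; split => //.
  + exact: mom_noise'.
  + by move=> A mA; apply: (@sigma_of_preimage (xi' k) id).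
  + exact: mom_noise'.
  + by move=> A mA; apply: (@sigma_of_preimage (xi' l) id).
Qed.

(** For a nonzero coefficient the exponential of a Laplace variable lacks high moments, hence is not
    [mom]; this is why [integral_prod_le] is used and not [ev_prod]. *)
Lemma noise_combination_mgf (r : seq nat) (c : nat -> R) : uniq r ->
  (forall k, k \in r -> (1 <= k <= n)%N /\ `|c k| * b <= 4^-1) ->
  (\int[P]_x (expR (\sum_(k <- r) c k * xi k x))%:E <=
    (expR (\sum_(k <- r) 32 * c k ^+ 2 * b ^+ 2))%:E)%E.
Proof.
move=> ur H; have [lx _ indep] := noise.
pose u (s : source) x := match s with
  | inl _ => 1 | inr (inl a) => expR (c a * xi a x) | inr (inr a) => 1 end.
pose B (s : source) : R := match s with
  | inl _ => 1 | inr (inl a) => expR (32 * c a ^+ 2 * b ^+ 2) | inr (inr a) => 1 end.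
pose f (k : nat) : source := inr (inl k).
rewrite (_ : expR _ = \prod_(s <- map f r) B s); last by rewrite big_map expR_sum.
under eq_integral.
  move=> x _; rewrite (_ : expR _ = \prod_(s <- map f r) u s x); last first.
    by rewrite big_map expR_sum.
  over.
apply: (integral_prod_le indep).
- by rewrite map_inj_uniq// => k l [].
- move=> s /mapP[k kr ->]; have [hk ck] := H _ kr; split => //.
  + apply: measurableT_comp => //; exact: measurable_funM.
  + by move=> x; exact: expR_ge0.
  + move=> A mA; apply: (@sigma_of_preimage (xi k) (fun y => expR (c k * y))) => //.
    apply: measurableT_comp => //; exact: measurable_funM.
  + by apply: laplace_mgf => //; exact: lx.
Qed.

End NoiseMoments.
(** * Truncation *)

Section Truncation.
Context (R : realType).
Implicit Types (t u x : R).

Lemma normr_clip t x : 0 <= t -> `|clip t x| <= `|x|.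
Proof.
move=> t0; have x0 := normr_ge0 x; have [xn xp] := ler_normlP _ _ (lexx `|x|).
rewrite /clip ler_norml ge_max le_max le_min ge_min xp/=.
have -> : - `|x| <= x by rewrite lerNl.
have xt : - `|x| <= t by rewrite (le_trans _ t0)// oppr_le0.
have tx : - t <= `|x| by rewrite (le_trans _ x0)// oppr_le0.
by rewrite xt tx.
Qed.

Lemma clip_id t x : `|x| <= t -> clip t x = x.
Proof.
move=> /ler_normlP[h1 h2]; rewrite /clip min_l// max_l//; lra.
Qed.

Lemma interactionE K (w t : R) (x xi : nat -> R) i :
  interaction K w t x xi i = x i ^+ 2 +
    x i * \sum_(1 <= m < K.+1) taper_weight K w m * (clip t (x (i - m)%N) + xi (i - m)%N).
Proof.
rewrite /interaction /interaction_complex /sum_punctured raddfD/= raddf_sum/= mulr_sumr.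
congr (_ + _); apply: eq_bigr => m _.
rewrite /= !mul0r !subr0 /taper_weight /taper abszN mulrNz mulrN cosN /release1.
by rewrite -pmulrn; ring.
Qed.

Lemma taper_ge0_le1 K m : (1 <= m <= K)%N -> 0 <= taper R K m%:Z <= 1.
Proof.
move=> /andP[m1 mK]; rewrite /taper/=.
have K0 : 0 < K%:R :> R by rewrite ltr0n; lia.
have mK' : m%:R / K%:R <= 1 :> R by rewrite ler_pdivrMr// mul1r ler_nat.
case: (leP m%:R (K%:R / 2)) => h; first by rewrite ler01 lexx.
have : 2^-1 < m%:R / K%:R :> R by rewrite ltr_pdivlMr//; lra.
by move=> h2; lra.
Qed.

Lemma taper_weight_le2 K w m : (1 <= m <= K)%N -> `|taper_weight K w m : R| <= 2.
Proof.
move=> /taper_ge0_le1 /andP[h0 h1]; rewrite /taper_weight !normrM.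
rewrite (@ger0_norm _ 2)// (ger0_norm h0) -mulrA -[leRHS]mulr1 ler_pM2l//.
by rewrite -[leRHS]mulr1; apply: ler_pM => //; exact: cos_max.
Qed.

Variables (K : nat) (W x z : nat -> R) (t : R).
Hypothesis W2 : forall m, (1 <= m <= K)%N -> `|W m| <= 2.
Hypothesis t1 : 1 <= t.

Let sq : R := Num.sqrt K.+1%:R.
Let G : R := \sum_(1 <= m < K.+1) W m * x m.
Let H : R := \sum_(1 <= m < K.+1) W m * z m.
Let V : R := x 0%N ^+ 2 + x 0%N * \sum_(1 <= m < K.+1) W m * (clip t (x m) + z m).
Let V0 : R := x 0%N ^+ 2 + x 0%N * \sum_(1 <= m < K.+1) W m * (x m + z m).

(* The variables that must stay below the truncation level [t] for the clipping
   to be inactive. *)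
Definition score (m : nat) : R :=
  if (m <= K)%N then x m else
  if m == K.+1 then G / (8 * sq) else H / (8 * sq * t).

Let sq1 : 1 <= sq.
Proof. by rewrite /sq -[leLHS]sqrtr1 ler_sqrt ?ltr0n// ler1n. Qed.

Let sqK : sq <= K.+1%:R.
Proof.
have : sq ^+ 2 = K.+1%:R by rewrite sqr_sqrtr.
by have := sq1; nra.
Qed.

(** Here [x m] and [z m] are the observation and the noise at lag [m]. If all scores are below [t],
    then [|V0| <= 17 * t ^+ 3 * sq], within the clipping level. Otherwise a crude bound suffices,
    quadratic in [y] with constant [26 = 2 + 16 + 8], since it is only used on a rare event. *)
Lemma truncation_error (y : R) : (forall m, (m < K.+3)%N -> `|score m| <= y) ->
  (y <= t -> clip (32 * t ^+ 3 * sq) V = V0) /\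
  (t <= y -> `|clip (32 * t ^+ 3 * sq) V - V0| <= 26 * K.+1%:R * t * y ^+ 2).
Proof.
move=> Hy.
have t0 : 0 <= t by exact: le_trans t1.
have sq_ge1 := sq1; have sq0 : 0 < sq by exact: lt_le_trans sq1.
have xy m : (m <= K)%N -> `|x m| <= y.
  by move=> mK; have := Hy m; rewrite /score mK; apply; lia.
have y0 : 0 <= y by apply: le_trans (xy 0%N _).
have Gy : `|G| <= 8 * sq * y.
  have := Hy K.+1 (leqnSn _); rewrite /score ltnn eqxx.
  have s8 : 0 < 8 * sq by rewrite mulr_gt0.
  by rewrite normrM normfV (ger0_norm (ltW s8)) ler_pdivrMr// mulrC.
have Hy' : `|H| <= 8 * sq * t * y.
  have := Hy K.+2 (ltnSn _); rewrite /score ltnNge leqnSn /= gtn_eqF//.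
  have tt0 : 0 < 8 * sq * t by rewrite !mulr_gt0// (lt_le_trans _ t1).
  by rewrite normrM normfV (ger0_norm (ltW tt0)) ler_pdivrMr// mulrC.
have VE : V = x 0%N ^+ 2 + x 0%N * (\sum_(1 <= m < K.+1) W m * clip t (x m) + H).
  by rewrite /V /H -big_split/=; congr (_ + _ * _); apply: eq_bigr => m _; ring.
have V0E : V0 = x 0%N ^+ 2 + x 0%N * (G + H).
  by rewrite /V0 /G /H -big_split/=; congr (_ + _ * _); apply: eq_bigr => m _; ring.
have x0y := xy 0%N (leq0n _).
have V0y : `|V0| <= y ^+ 2 + y * (8 * sq * y + 8 * sq * t * y).
  rewrite V0E; apply: le_trans (ler_normD _ _) _; apply: lerD.
    by rewrite normrX lerXn2r ?nnegrE.
  rewrite normrM; apply: ler_pM => //; apply: le_trans (ler_normD _ _) _.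
  exact: lerD.
split=> ty.
  have -> : V = V0.
    rewrite VE V0E; congr (_ + _ * (_ + _)); rewrite /G.
    rewrite big_nat_cond [RHS]big_nat_cond; apply: eq_bigr => m.
    rewrite andbT => /andP[_ mK]; rewrite clip_id// (le_trans (xy m _))//.
  apply: clip_id; apply: le_trans V0y _.
  have h1 : y ^+ 2 <= t ^+ 2 by rewrite lerXn2r ?nnegrE.
  have h2 : t ^+ 2 <= t ^+ 3 by rewrite [t ^+ 3]exprS ler_peMl ?sqr_ge0.
  have t30 : 0 <= t ^+ 3 by rewrite exprn_ge0.
  have -> : y ^+ 2 + y * (8 * sq * y + 8 * sq * t * y) =
    y ^+ 2 * (1 + 8 * sq + 8 * sq * t) by ring.
  apply: (@le_trans _ _ (t ^+ 2 * (17 * sq * t))).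
    apply: ler_pM => //; rewrite ?sqr_ge0//.
      by rewrite !addr_ge0// !mulr_ge0// (ltW sq0).
    have h3 : sq <= sq * t by rewrite ler_peMr// ltW.
    lra.
  have -> : t ^+ 2 * (17 * sq * t) = 17 * t ^+ 3 * sq by ring.
  by rewrite ler_wpM2r ?(ltW sq0)// ler_wpM2r//; lra.
have t'0 : 0 <= 32 * t ^+ 3 * sq by rewrite !mulr_ge0 ?exprn_ge0 ?(ltW sq0).
apply: le_trans (ler_normB _ _) _.
have Vy : `|V| <= y ^+ 2 + y * (2 * K%:R * y + 8 * sq * t * y).
  rewrite VE; apply: le_trans (ler_normD _ _) _; apply: lerD.
    by rewrite normrX lerXn2r ?nnegrE.
  rewrite normrM; apply: ler_pM => //; apply: le_trans (ler_normD _ _) _.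
  apply: lerD => //; apply: le_trans (ler_norm_sum _ _ _) _.
  apply: (@le_trans _ _ (\sum_(1 <= m < K.+1) 2 * y)).
    rewrite big_nat_cond [leRHS]big_nat_cond; apply: ler_sum => m.
    rewrite andbT ltnS => mK; rewrite normrM; apply: ler_pM => //; first exact: W2.
    by apply: le_trans (normr_clip _ t0) _; apply: xy; case/andP: mK.
  by rewrite sumr_const_nat subSS subn0 -[leLHS]mulr_natr mulrAC.
apply: le_trans (lerD (normr_clip V t'0) (lexx _)) _.
apply: le_trans (lerD Vy V0y) _.
have -> : y ^+ 2 + y * (2 * K%:R * y + 8 * sq * t * y) +
    (y ^+ 2 + y * (8 * sq * y + 8 * sq * t * y)) =
    (2 * (1 + K%:R) + 16 * sq * t + 8 * sq) * y ^+ 2 by ring.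
rewrite ler_wpM2r ?sqr_ge0//.
have := sqK; rewrite -natr1 => hs.
have K0 : 0 <= K%:R :> R by [].
have a1 : sq * t <= (K%:R + 1) * t by rewrite ler_wpM2r.
have a2 : K%:R + 1 <= (K%:R + 1) * t by rewrite ler_peMr// addr_ge0.
by rewrite addrC in a2 *; lra.
Qed.

(** A pointwise Chernoff bound: when [|u| > t], of the exponent [2 * k * t * |u|] one half absorbs
    [|u|] and the other exceeds [k * t ^+ 2]. *)
Lemma pow4_le_expR_tail (k u : R) : 1 <= k * t -> 0 < k -> t < `|u| ->
  u ^+ 4 <= 24 * expR (- (k * t ^+ 2)) *
    (expR (2 * k * t * u) + expR (- (2 * k * t) * u)).
Proof.
move=> kt k0 tu.
have -> : u ^+ 4 = `|u| ^+ 4 by rewrite -normrX ger0_norm// exprn_even_ge0.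
apply: le_trans (exprn_le_expR 4 (normr_ge0 u)) _.
rewrite (_ : 4`!%:R = 24)// -mulrA ler_pM2l//.
apply: (@le_trans _ _ (expR (- (k * t ^+ 2)) * expR (2 * k * t * `|u|))).
  rewrite -expRD ler_expR.
  have : 0 <= (k * t - 1) * `|u| + k * t * (`|u| - t).
    by rewrite addr_ge0// mulr_ge0//; lra.
  by rewrite expr2; lra.
rewrite ler_wpM2l ?expR_ge0//.
have kt0 : 0 <= 2 * k * t by rewrite -mulrA mulr_ge0//; lra.
have -> : 2 * k * t * `|u| = `|2 * k * t * u| by rewrite normrM (ger0_norm kt0).
by rewrite mulNr; exact: expR_norm_le.
Qed.

(** The largest score decides: below [t] there is no error, and above [t] its own term already
    dominates. The sum replaces the maximum because its expectation can be bounded. *)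
Lemma truncation_error_sqr (k : R) : 1 <= k * t -> 0 < k ->
  (clip (32 * t ^+ 3 * sq) V - V0) ^+ 2 <=
  (26 * K.+1%:R * t) ^+ 2 * (24 * expR (- (k * t ^+ 2))) *
  \sum_(m < K.+3) (expR (2 * k * t * score m) + expR (- (2 * k * t) * score m)).
Proof.
move=> kt k0.
have [j _ jmax] := Order.TotalTheory.arg_maxP (fun m : 'I_K.+3 => `|score m|) (isT : xpredT ord0).
set y := `|score j|.
have Hy m : (m < K.+3)%N -> `|score m| <= y.
  by move=> mK; exact: (jmax (Ordinal mK)).
have [E1 E2] := truncation_error Hy.
have t0 : 0 <= t by exact: le_trans t1.
have [yt|ty] := leP y t.
  rewrite E1// subrr expr0n/=; apply: mulr_ge0.
    by rewrite mulr_ge0 ?sqr_ge0// mulr_ge0// expR_ge0.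
  by apply: sumr_ge0 => m _; rewrite addr_ge0// expR_ge0.
rewrite -[leLHS]ger0_norm ?sqr_ge0// normrX.
apply: (@le_trans _ _ ((26 * K.+1%:R * t * y ^+ 2) ^+ 2)).
  have r0 : 0 <= 26 * K.+1%:R * t * y ^+ 2.
    by apply: mulr_ge0; [apply: mulr_ge0|exact: sqr_ge0].
  by rewrite lerXn2r ?nnegrE//; exact/E2/ltW.
rewrite exprMn -[leRHS]mulrA; apply: ler_wpM2l; first exact: sqr_ge0.
have -> : (y ^+ 2) ^+ 2 = score j ^+ 4.
  by rewrite -exprM /y -normrX ger0_norm// exprn_even_ge0.
apply: le_trans (pow4_le_expR_tail kt k0 ty) _.
rewrite ler_wpM2l ?mulr_ge0 ?expR_ge0//.
rewrite (bigD1 j)//= lerDl; apply: sumr_ge0 => m _.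
by rewrite addr_ge0// expR_ge0.
Qed.

End Truncation.

(** * Mean squared error *)

Section SumBounds.
Context (R : realType).

Lemma sum_count_le1 (I J : eqType) (q : seq I) (g : I -> J) (a : J) : uniq q ->
  {in q &, injective g} -> \sum_(m <- q) (a == g m)%:R <= 1 :> R.
Proof.
move=> uq ginj.
have -> : \sum_(m <- q) (a == g m)%:R = (count_mem a (map g q))%:R :> R.
  elim: q {uq ginj} => [|m q ih]; first by rewrite big_nil.
  by rewrite big_cons ih /= natrD eq_sym.
by rewrite count_uniq_mem ?map_inj_in_uniq// lern1 leq_b1.
Qed.

Variables (sigma : int -> R) (M : R).
Hypothesis sigmaM : forall r : seq int, uniq r -> \sum_(j <- r) `|sigma j| <= M.

Lemma sum_autocov_le (q : seq nat) (g : nat -> int) : uniq q ->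
  {in q &, injective g} -> \sum_(j <- q) `|sigma (g j)| <= M.
Proof.
move=> uq ginj; have := sigmaM (r := map g q).
by rewrite big_map map_inj_in_uniq//; apply.
Qed.

End SumBounds.

Section RiskTerms.
Context d (T : measurableType d) (R : realType) (P : probability T R).
Local Notation mom := (mom P).
Local Notation ev := (ev P).

Lemma ev_sum_sqr (I : eqType) (r : seq I) (f : I -> T -> R) :
  (forall i, i \in r -> mom (f i)) ->
  ev (fun x => (\sum_(i <- r) f i x) ^+ 2) =
    \sum_(i <- r) \sum_(j <- r) ev (fun x => f i x * f j x).
Proof.
move=> mf.
rewrite (eq_ev (g := fun x => \sum_(i <- r) \sum_(j <- r) f i x * f j x)); last first.
  by move=> x; rewrite expr2 mulr_suml; apply: eq_bigr => i _; rewrite mulr_sumr.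
have mff i j : i \in r -> j \in r -> mom (fun x => f i x * f j x).
  by move=> ir jr; apply: mom_mul; exact: mf.
rewrite ev_sum => [|i ir _]; last by apply: mom_sum => j jr _; exact: mff.
apply: eq_big_seq => i ir; rewrite ev_sum// => j jr _; exact: mff.
Qed.

(** A row-sum bound for the matrix of second moments, in the manner of Schur's test. *)
Lemma ev_sum_sqr_le (I : eqType) (r : seq I) (f : I -> T -> R) (C : R) :
  (forall i, i \in r -> mom (f i)) ->
  (forall i, i \in r -> \sum_(j <- r) ev (fun x => f i x * f j x) <= C) ->
  ev (fun x => (\sum_(i <- r) f i x) ^+ 2) <= (size r)%:R * C.
Proof.
move=> mf H; rewrite ev_sum_sqr//.
apply: (@le_trans _ _ (\sum_(i <- r) C)).
  by rewrite big_seq [leRHS]big_seq; apply: ler_sum.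
by rewrite big_const_seq count_predT iter_addr_0 mulr_natl.
Qed.

Variables (X : int -> {RV P >-> R}) (sigma : int -> R) (M : R).
Hypothesis gX : centered_stationary_gaussian X sigma.
Hypothesis sigmaN : forall j, sigma (- j) = sigma j.
Hypothesis sigmaM : forall r : seq int, uniq r -> \sum_(j <- r) `|sigma j| <= M.
Variables (n K : nat) (b b' : R) (xi xi' : nat -> {RV P >-> R}).
Hypothesis b0 : 0 < b.
Hypothesis b'0 : 0 < b'.
Hypothesis noise : privacy_noise n K b b' X xi xi'.
Hypothesis Kn : (K < n)%N.

Let times := index_iota K.+1 n.+1.

Let mem_times i : (i \in times) = (K < i <= n)%N.
Proof. by rewrite mem_index_iota. Qed.

Let size_times : size times = (n - K)%N.
Proof. by rewrite size_iota subSS. Qed.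

Let M0 : 0 <= M.
Proof. by have := sigmaM (r := [::]) isT; rewrite big_nil. Qed.

Lemma ev_sum_noise' :
  ev (fun x => (\sum_(i <- times) xi' i x) ^+ 2) <= (n - K)%:R * (16 * b' ^+ 2).
Proof.
rewrite -size_times; apply: ev_sum_sqr_le => i; rewrite mem_times => hi.
  exact: (mom_noise' b'0 noise).
rewrite (bigD1_seq i)/= ?iota_uniq ?mem_times//.
rewrite big_seq_cond big1 ?addr0 => [|j]; last first.
  rewrite mem_times => /andP[hj ij]; apply: (ev_noise'_mul b'0 noise) => //.
  by rewrite eq_sym.
rewrite (eq_ev (g := fun x => xi' i x ^+ 2)); last by move=> x; rewrite expr2.
exact: (ev_noise'_sqr b'0 noise).
Qed.

Variable W : nat -> R.
Hypothesis W2 : forall m, (1 <= m <= K)%N -> `|W m| <= 2.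

(** For fixed [i], [m] and [j], independence leaves at most one lag [m'] with [i - m = j - m']. A
    row sum is thus at most [2 * 2 * 16 * b ^+ 2] times a sum of autocovariances over [j]. *)
Lemma ev_sum_sample_noise :
  ev (fun x => (\sum_(i <- times) \sum_(1 <= m < K.+1)
      W m * (X i%:Z x * xi (i - m)%N x)) ^+ 2) <=
  ((n - K) * K)%:R * (64 * b ^+ 2 * M).
Proof.
clear b'0 Kn.
pose pairs := [seq (i, m) | i <- times, m <- index_iota 1 K.+1].
pose f (p : nat * nat) x := W p.2 * (X p.1%:Z x * xi (p.1 - p.2)%N x).
have mem_pairs p : p \in pairs -> [/\ (K < p.1 <= n)%N & (1 <= p.2 <= K)%N].
  by case: p => i m /allpairsP[[i' m'] /= [+ + [-> ->]]]; rewrite mem_times mem_index_iota ltnS.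
have range i m : (K < i <= n)%N -> (1 <= m <= K)%N ->
    (1 <= i <= n)%N /\ (1 <= i - m <= n)%N by lia.
have -> : ((n - K) * K = size pairs)%N.
  by rewrite size_allpairs size_times size_iota subn1.
rewrite (eq_ev (g := fun x => (\sum_(p <- pairs) f p x) ^+ 2)); last first.
  by move=> x; rewrite big_allpairs.
apply: ev_sum_sqr_le => -[i m] /mem_pairs/= [hi hm]; have [hi1 him] := range _ _ hi hm.
  apply: mom_scale; apply: mom_mul; first exact: (mom_gaussian gX).
  exact: (mom_noise b0 noise).
have c0 : 0 <= 64 * b ^+ 2 by rewrite mulr_ge0// sqr_ge0.
rewrite big_allpairs /=.
apply: (@le_trans _ _ (\sum_(j <- times) 64 * b ^+ 2 * `|sigma (i%:Z - j%:Z)|)); last first.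
  rewrite -mulr_sumr ler_wpM2l//.
  apply: (sum_autocov_le sigmaM (g := fun j => i%:Z - j%:Z)); first exact: iota_uniq.
  by move=> j1 j2 _ _; lia.
rewrite big_seq [leRHS]big_seq; apply: ler_sum => j; rewrite mem_times => hj.
apply: (@le_trans _ _ (64 * b ^+ 2 * `|sigma (i%:Z - j%:Z)| *
    \sum_(m' <- index_iota 1 K.+1) ((i - m)%N == (j - m')%N)%:R)); last first.
  rewrite ler_piMr//; first by rewrite mulr_ge0.
  apply: sum_count_le1; rewrite ?iota_uniq// => m1 m2.
  by rewrite !mem_index_iota => h1 h2; lia.
rewrite mulr_sumr big_seq [leRHS]big_seq; apply: ler_sum => m'.
rewrite mem_index_iota ltnS => hm'; have [hj1 hjm] := range _ _ hj hm'.
rewrite (eq_ev (g := fun x => (W m * W m') *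
    (X i%:Z x * X j%:Z x * (xi (i - m)%N x * xi (j - m')%N x)))); last first.
  by move=> x; rewrite /f/=; ring.
rewrite ev_scale; last first.
  apply: mom_mul; apply: mom_mul; try exact: (mom_gaussian gX).
    exact: (mom_noise b0 noise).
  exact: (mom_noise b0 noise).
rewrite (ev_sample_noise gX sigmaN b0 noise)//.
case: eqP => _; last by rewrite !mulr0.
rewrite mulr1; apply: le_trans (ler_norm _) _; rewrite !normrM.
have e0 : 0 <= ev (fun x => xi (i - m)%N x ^+ 2) by apply: ev_ge0 => x; exact: sqr_ge0.
rewrite (ger0_norm e0).
have e1 := ev_noise_sqr b0 noise him.
have -> : 64 * b ^+ 2 * `|sigma (i%:Z - j%:Z)| =
  (2 * 2) * (`|sigma (i%:Z - j%:Z)| * (16 * b ^+ 2)) by ring.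
apply: ler_pM; [by rewrite mulr_ge0|by rewrite mulr_ge0| |by rewrite ler_wpM2l].
by apply: ler_pM => //; exact: W2.
Qed.

(** After centering, Isserlis leaves two products of autocovariances. In each, one factor is summed
    over the lag [m'] and the other over the time [j], so a row costs [M ^+ 2] per product and not a
    power of [K]. *)
Lemma ev_sum_quadratic (W' : nat -> R) : (forall m, (m <= K)%N -> `|W' m| <= 2) ->
  ev (fun x => (\sum_(i <- times) \sum_(0 <= m < K.+1)
      W' m * (X i%:Z x * X (i - m)%N%:Z x - sigma m%:Z)) ^+ 2) <=
  ((n - K) * K.+1)%:R * (8 * M ^+ 2).
Proof.
move=> W'2; clear b0 b'0 Kn noise.
pose pairs := [seq (i, m) | i <- times, m <- index_iota 0 K.+1].
pose f (p : nat * nat) x :=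
  W' p.2 * (X p.1%:Z x * X (p.1 - p.2)%N%:Z x - sigma p.2%:Z).
have mem_pairs p : p \in pairs -> [/\ (K < p.1 <= n)%N & (p.2 <= K)%N].
  by case: p => i m /allpairsP[[i' m'] /= [+ + [-> ->]]]; rewrite mem_times mem_index_iota ltnS.
have -> : ((n - K) * K.+1 = size pairs)%N.
  by rewrite size_allpairs size_times size_iota subn0.
rewrite (eq_ev (g := fun x => (\sum_(p <- pairs) f p x) ^+ 2)); last first.
  by move=> x; rewrite big_allpairs.
have mXX (i j : int) : mom (fun x => X i x * X j x).
  by apply: mom_mul; exact: (mom_gaussian gX).
apply: ev_sum_sqr_le => -[i m] /mem_pairs/= [hi hm].
  by apply: mom_scale; apply: mom_sub => //; exact: mom_cst.
rewrite big_allpairs /=.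
pose g1 j m' := `|sigma (i%:Z - j%:Z)| * `|sigma ((i - m)%N%:Z - (j - m')%N%:Z)|.
pose g2 j m' := `|sigma (i%:Z - (j - m')%N%:Z)| * `|sigma ((i - m)%N%:Z - j%:Z)|.
apply: (@le_trans _ _ (\sum_(j <- times) \sum_(m' <- index_iota 0 K.+1)
    4 * (g1 j m' + g2 j m'))).
  rewrite big_seq [leRHS]big_seq; apply: ler_sum => j; rewrite mem_times => hj.
  rewrite big_seq [leRHS]big_seq; apply: ler_sum => m'.
  rewrite mem_index_iota ltnS/= => hm'.
  rewrite (eq_ev (g := fun x => (W' m * W' m') *
    ((X i%:Z x * X (i - m)%N%:Z x * (X j%:Z x * X (j - m')%N%:Z x) -
      sigma m%:Z * (X j%:Z x * X (j - m')%N%:Z x)) -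
     (sigma m'%:Z * (X i%:Z x * X (i - m)%N%:Z x) - sigma m%:Z * sigma m'%:Z)))); last first.
    by move=> x; rewrite /f/=; ring.
  have sE (k l : nat) : (K < k)%N -> (l <= K)%N -> sigma (k%:Z - (k - l)%N%:Z) = sigma l%:Z.
    by move=> Kk lK; congr sigma; lia.
  rewrite ev_scale; last by repeat (first [exact: mom_cst|exact: mXX|apply: mom_sub|apply: mom_scale|apply: mom_mul]).
  rewrite ev_sub; last 2 first.
  - by apply: mom_sub; [exact: mom_mul|exact: mom_scale].
  - by apply: mom_sub; [exact: mom_scale|exact: mom_cst].
  rewrite ev_sub; [|exact: mom_mul|exact: mom_scale].
  rewrite ev_sub; [|exact: mom_scale|exact: mom_cst].
  rewrite ev_cst !ev_scale// !(ev_gaussian2 gX sigmaN) (ev_gaussian4 gX sigmaN).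
  rewrite !sE//; try lia.
  apply: le_trans (ler_norm _) _; rewrite normrM; apply: ler_pM => //.
    rewrite normrM (_ : 4 = 2 * 2); last by ring.
    by apply: ler_pM => //; exact: W'2.
  rewrite (_ : _ - _ = sigma (i%:Z - j%:Z) * sigma ((i - m)%N%:Z - (j - m')%N%:Z) +
    sigma (i%:Z - (j - m')%N%:Z) * sigma ((i - m)%N%:Z - j%:Z)); last by ring.
  by apply: le_trans (ler_normD _ _) _; rewrite !normrM.
under eq_bigr do rewrite -mulr_sumr big_split/=.
rewrite -mulr_sumr big_split/= (_ : 8 * M ^+ 2 = 4 * (M * M + M * M)); last by ring.
rewrite ler_pM2l//; apply: lerD.
  apply: (@le_trans _ _ (\sum_(j <- times) `|sigma (i%:Z - j%:Z)| * M)).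
    rewrite big_seq [leRHS]big_seq; apply: ler_sum => j; rewrite mem_times => hj.
    rewrite /g1 -mulr_sumr ler_wpM2l//.
    apply: (sum_autocov_le sigmaM (g := fun m' => (i - m)%N%:Z - (j - m')%N%:Z)).
      exact: iota_uniq.
    by move=> m1 m2; rewrite !mem_index_iota; lia.
  rewrite -mulr_suml ler_wpM2r//.
  apply: (sum_autocov_le sigmaM (g := fun j => i%:Z - j%:Z)); first exact: iota_uniq.
  by move=> j1 j2 _ _; lia.
apply: (@le_trans _ _ (\sum_(j <- times) M * `|sigma ((i - m)%N%:Z - j%:Z)|)).
  rewrite big_seq [leRHS]big_seq; apply: ler_sum => j; rewrite mem_times => hj.
  rewrite /g2 -mulr_suml ler_wpM2r//.
  apply: (sum_autocov_le sigmaM (g := fun m' => i%:Z - (j - m')%N%:Z)).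
    exact: iota_uniq.
  by move=> m1 m2; rewrite !mem_index_iota; lia.
rewrite -mulr_sumr ler_wpM2l//.
apply: (sum_autocov_le sigmaM (g := fun j => (i - m)%N%:Z - j%:Z)); first exact: iota_uniq.
by move=> j1 j2 _ _; lia.
Qed.

End RiskTerms.

Lemma sqr_sum5_le (R : realDomainType) (a b c d e : R) :
  (a + b + c + d + e) ^+ 2 <= 5 * (a ^+ 2 + b ^+ 2 + c ^+ 2 + d ^+ 2 + e ^+ 2).
Proof.
rewrite -subr_ge0.
have -> : 5 * (a ^+ 2 + b ^+ 2 + c ^+ 2 + d ^+ 2 + e ^+ 2) - (a + b + c + d + e) ^+ 2 =
    (a - b) ^+ 2 + (a - c) ^+ 2 + (a - d) ^+ 2 + (a - e) ^+ 2 + (b - c) ^+ 2 +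
    (b - d) ^+ 2 + (b - e) ^+ 2 + (c - d) ^+ 2 + (c - e) ^+ 2 + (d - e) ^+ 2 by ring.
by rewrite !addr_ge0// sqr_ge0.
Qed.

(** * Truncation error in mean square and assembly of the risk *)

Section MeanSquaredError.
Context d (T : measurableType d) (R : realType) (P : probability T R).
Local Notation mom := (mom P).
Local Notation ev := (ev P).
Variables (X : int -> {RV P >-> R}) (sigma : int -> R) (M : R).
Hypothesis gX : centered_stationary_gaussian X sigma.
Hypothesis sigmaN : forall j, sigma (- j) = sigma j.
Hypothesis sigmaM : forall r : seq int, uniq r -> \sum_(j <- r) `|sigma j| <= M.
Variables (n K : nat) (alpha t b' : R) (xi xi' : nat -> {RV P >-> R}).
Hypothesis alpha0 : 0 < alpha.
Hypothesis t1 : 1 <= t.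
Hypothesis b'0 : 0 < b'.
Hypothesis noise : privacy_noise n K (4 * t / alpha) b' X xi xi'.
Hypothesis Kn : (K < n)%N.
Hypothesis K0 : (0 < K)%N.

Let t0 : 0 < t. Proof. exact: lt_le_trans t1. Qed.
Let b0 : 0 < 4 * t / alpha. Proof. by rewrite divr_gt0// mulr_gt0. Qed.
Let sq : R := Num.sqrt K.+1%:R.
Let sq0 : 0 < sq. Proof. by rewrite sqrtr_gt0 ltr0n. Qed.
Let sq2 : sq ^+ 2 = K.+1%:R. Proof. by rewrite sqr_sqrtr. Qed.
Let M0 : 0 <= M.
Proof. by have := sigmaM (r := [::]) isT; rewrite big_nil. Qed.

Lemma measurable_clip (r : R) : measurable_fun [set: R] (clip r).
Proof.
apply: (@measurable_maxr _ _ _ _ (fun x : R => Num.min x r) (cst (- r))) => //.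
exact: (@measurable_minr _ _ _ _ id (cst r)).
Qed.

Lemma mom_clip (r : R) f : 0 <= r -> mom f -> mom (fun x => clip r (f x)).
Proof.
move=> r0 mf; apply: (mom_le _ mf) => [|x]; last exact: normr_clip.
exact: (measurableT_comp (measurable_clip r) (mom_meas mf)).
Qed.

Section Truncation.
Variables (W : nat -> R) (i : nat).
Hypothesis W2 : forall m, (1 <= m <= K)%N -> `|W m| <= 2.
Hypothesis hi : (K < i <= n)%N.

Let x (e : T) m := X (i - m)%N%:Z e.
Let z (e : T) m := xi (i - m)%N e.

Let range m : (1 <= m <= K)%N -> (1 <= i - m <= n)%N.
Proof. by move: hi; lia. Qed.

Let mx m : mom (fun e => x e m).
Proof. exact: (mom_gaussian gX). Qed.

Let mz m : (1 <= m <= K)%N -> mom (fun e => z e m).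
Proof. by move=> hm; apply: (mom_noise b0 noise); exact: range. Qed.

Let mG : mom (fun e => \sum_(1 <= m < K.+1) W m * x e m).
Proof. by apply: mom_sum => m _ _; exact: mom_scale. Qed.

Let mH : mom (fun e => \sum_(1 <= m < K.+1) W m * z e m).
Proof.
by apply: mom_sum => m; rewrite mem_index_iota ltnS => hm _; apply: mom_scale; exact: mz.
Qed.

Lemma mom_score m : mom (fun e => score K W (x e) (z e) t m).
Proof.
rewrite /score; case: leqP => _; first exact: mx.
case: eqP => _.
  by under eq_fun do rewrite mulrC; exact: mom_scale.
by under eq_fun do rewrite mulrC; exact: mom_scale.
Qed.

(** A common sub-Gaussian parameter for all scores: the first term covers the sample, the second the
    noise. *)
Let B : R := M / 2 + 32 / alpha ^+ 2.

(** The hypothesis keeps every noise coefficient in the range of [laplace_mgf]: the score of the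
    noise divides by [sqrt (K + 1)], so the condition reads [4 |c| <= alpha * sqrt (K + 1)]. *)
Lemma score_mgf (c : R) m : 16 * c ^+ 2 <= alpha ^+ 2 * K.+1%:R ->
  (\int[P]_e (expR (c * score K W (x e) (z e) t m))%:E <= (expR (c ^+ 2 * B))%:E)%E.
Proof.
move=> hc.
have K1 : 0 < K.+1%:R :> R by rewrite ltr0n.
have a20 : 0 < alpha ^+ 2 by rewrite exprn_gt0.
have B1 : M / 2 <= B by rewrite lerDl divr_ge0// ltW.
have B2 : 32 / alpha ^+ 2 <= B by rewrite lerDr divr_ge0.
rewrite /score; case: leqP => mK.
  have := @combination_mgf _ _ _ _ _ _ gX nat [:: m] (fun=> 1)
    (fun m => (i - m)%N%:Z) M c.
  rewrite (ev_combination2 gX sigmaN) !big_seq1 !mul1r subrr.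
  have s0 : sigma 0 <= M.
    by apply: le_trans (ler_norm _) _; have := sigmaM (r := [:: 0]) isT; rewrite big_seq1.
  move=> /(_ s0) h; apply: le_trans (_ : _ <= (expR (c ^+ 2 * M / 2))%:E)%E _.
    apply: le_trans h; rewrite le_eqVlt; apply/orP; left; apply/eqP.
    by apply: eq_integral => e _; rewrite big_seq1 mul1r.
  by rewrite lee_fin ler_expR -mulrA ler_wpM2l// sqr_ge0.
case: eqP => _.
  have := @combination_mgf _ _ _ _ _ _ gX nat (index_iota 1 K.+1) W
    (fun m => (i - m)%N%:Z) (4 * K%:R * M) (c / (8 * sq)).
  rewrite (ev_combination2 gX sigmaN) => h.
  apply: le_trans (_ : _ <= (expR ((c / (8 * sq)) ^+ 2 * (4 * K%:R * M) / 2))%:E)%E _.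
    apply: le_trans (h _); last first.
      apply: (@le_trans _ _ (\sum_(j <- index_iota 1 K.+1) 4 * M)); last first.
        by rewrite sumr_const_nat subSS subn0 -[leLHS]mulr_natr mulrAC.
      rewrite big_seq [leRHS]big_seq; apply: ler_sum => j.
      rewrite mem_index_iota ltnS => hj.
      apply: (@le_trans _ _ (\sum_(k <- index_iota 1 K.+1) 4 *
          `|sigma ((i - j)%N%:Z - (i - k)%N%:Z)|)).
        rewrite big_seq [leRHS]big_seq; apply: ler_sum => k.
        rewrite mem_index_iota ltnS => hk.
        apply: le_trans (ler_norm _) _; rewrite !normrM ler_wpM2r//.
        rewrite (_ : 4 = 2 * 2); last by ring.
        by apply: ler_pM => //; exact: W2.
      rewrite -mulr_sumr ler_pM2l//.
      apply: (sum_autocov_le sigmaM (g := fun k => (i - j)%N%:Z - (i - k)%N%:Z)).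
        exact: iota_uniq.
      move=> k1 k2; rewrite !mem_index_iota => h1 h2 /addrI/oppr_inj[] h12.
      by move: hi h1 h2 h12; clear; lia.
    rewrite le_eqVlt; apply/orP; left; apply/eqP; apply: eq_integral => e _.
    by rewrite mulrAC mulrA.
  rewrite lee_fin ler_expR; apply: le_trans (ler_wpM2l (sqr_ge0 c) B1).
  have -> : (c / (8 * sq)) ^+ 2 * (4 * K%:R * M) / 2 =
      (c ^+ 2 * (M / 2)) * (K%:R / K.+1%:R / 16).
    by rewrite -sq2; field; rewrite gt_eqF.
  have c20 : 0 <= c ^+ 2 * (M / 2) by rewrite mulr_ge0 ?sqr_ge0// divr_ge0.
  apply: ler_piMr => //.
  have : K%:R / K.+1%:R <= 1 :> R by rewrite ler_pdivrMr// mul1r ler_nat.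
  by generalize (K%:R / K.+1%:R : R) => u hu; lra.
pose r := [seq (i - m)%N | m <- index_iota 1 K.+1].
pose cf k := c / (8 * sq * t) * W (i - k)%N.
have ik k : (1 <= k <= K)%N -> (i - (i - k) = k)%N by move: hi; clear; lia.
have ur : uniq r.
  rewrite map_inj_in_uniq ?iota_uniq// => k1 k2; rewrite !mem_index_iota => h1 h2 h12.
  by move: hi h1 h2 h12; clear; lia.
have s8 : 0 < 8 * sq * t by rewrite !mulr_gt0.
have cfle k : (1 <= k <= K)%N -> `|cf (i - k)%N| <= `|c| / (4 * sq * t).
  move=> hk; rewrite /cf ik// normrM normrM normfV (ger0_norm (ltW s8)).
  have -> : `|c| / (4 * sq * t) = `|c| / (8 * sq * t) * 2.
    by field; rewrite !gt_eqF.
  rewrite ler_wpM2l ?W2//; apply: mulr_ge0 => //.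
  by rewrite invr_ge0 ltW.
have hcf k : k \in r -> (1 <= k <= n)%N /\ `|cf k| * (4 * t / alpha) <= 4^-1.
  move=> /mapP[m']; rewrite mem_index_iota ltnS => hm' ->; split; first exact: range.
  apply: (@le_trans _ _ (`|c| / (4 * sq * t) * (4 * t / alpha))).
    by rewrite ler_wpM2r ?cfle// ltW.
  have -> : `|c| / (4 * sq * t) * (4 * t / alpha) = `|c| / (sq * alpha).
    by field; rewrite !gt_eqF.
  rewrite ler_pdivrMr ?mulr_gt0// ler_pdivlMl//.
  rewrite -(@ler_pXn2r _ 2)// ?nnegrE ?mulr_ge0 ?(ltW sq0) ?(ltW alpha0)//.
  have -> : (4 * `|c|) ^+ 2 = 16 * c ^+ 2.
    by rewrite exprMn -normrX ger0_norm ?sqr_ge0//; congr (_ * _); ring.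
  by rewrite exprMn sq2 [leRHS]mulrC.
have h := noise_combination_mgf b0 noise ur hcf.
rewrite [X in (_ <= (expR X)%:E)%E]big_map in h.
apply: le_trans (_ : _ <= (expR (\sum_(j <- index_iota 1 K.+1)
    32 * cf (i - j)%N ^+ 2 * (4 * t / alpha) ^+ 2))%:E)%E _.
  apply: le_trans h; rewrite le_eqVlt; apply/orP; left; apply/eqP.
  apply: eq_integral => e _; rewrite big_map; congr (expR _)%:E.
  rewrite mulrA mulrAC mulr_sumr big_seq [RHS]big_seq; apply: eq_bigr => k.
  by rewrite mem_index_iota ltnS => hk; rewrite /cf ik// mulrA.
rewrite lee_fin ler_expR.
apply: (@le_trans _ _ (\sum_(1 <= j < K.+1) 32 * c ^+ 2 / (alpha ^+ 2 * K.+1%:R))).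
  rewrite big_seq [leRHS]big_seq; apply: ler_sum => k.
  rewrite mem_index_iota ltnS => hk.
  have -> : 32 * c ^+ 2 / (alpha ^+ 2 * K.+1%:R) =
      32 * (`|c| / (4 * sq * t)) ^+ 2 * (4 * t / alpha) ^+ 2.
    have -> : c ^+ 2 = `|c| ^+ 2 by rewrite -normrX ger0_norm ?sqr_ge0.
    by rewrite -sq2; field; rewrite !gt_eqF.
  rewrite ler_wpM2r ?sqr_ge0// ler_wpM2l//.
  have -> : cf (i - k)%N ^+ 2 = `|cf (i - k)%N| ^+ 2 by rewrite -normrX ger0_norm ?sqr_ge0.
  rewrite lerXn2r ?nnegrE ?cfle//; apply: mulr_ge0 => //.
  by rewrite invr_ge0 !mulr_ge0// ltW.
rewrite sumr_const_nat subSS subn0 -[leLHS]mulr_natr.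
apply: le_trans (ler_wpM2l (sqr_ge0 c) B2).
have -> : 32 * c ^+ 2 / (alpha ^+ 2 * K.+1%:R) * K%:R =
    c ^+ 2 * (32 / alpha ^+ 2) * (K%:R / K.+1%:R).
  by field; rewrite !gt_eqF.
have c20 : 0 <= c ^+ 2 * (32 / alpha ^+ 2) by rewrite mulr_ge0 ?sqr_ge0// divr_ge0// ltW.
by apply: ler_piMr => //; rewrite ler_pdivrMr// mul1r ler_nat.
Qed.

Let V e : R := x e 0 ^+ 2 + x e 0 * \sum_(1 <= m < K.+1) W m * (clip t (x e m) + z e m).
Let V0 e : R := x e 0 ^+ 2 + x e 0 * \sum_(1 <= m < K.+1) W m * (x e m + z e m).

Lemma mom_untruncated : mom V0.
Proof.
apply: mom_add; first exact: mom_exp.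
apply: mom_mul => //; apply: mom_sum => m; rewrite mem_index_iota ltnS => hm _.
by apply: mom_scale; apply: mom_add => //; exact: mz.
Qed.

Lemma mom_half_truncated : mom V.
Proof.
apply: mom_add; first exact: mom_exp.
apply: mom_mul => //; apply: mom_sum => m; rewrite mem_index_iota ltnS => hm _.
apply: mom_scale; apply: mom_add; last exact: mz.
by apply: mom_clip => //; exact: ltW.
Qed.

Lemma ev_truncation_error (k : R) : 1 <= k * t -> 0 < k ->
  16 * (2 * k * t) ^+ 2 <= alpha ^+ 2 * K.+1%:R ->
  ev (fun e => (clip (32 * t ^+ 3 * sq) (V e) - V0 e) ^+ 2) <=
  (26 * K.+1%:R * t) ^+ 2 * (24 * expR (- (k * t ^+ 2))) *
    (K.+3%:R * (2 * expR ((2 * k * t) ^+ 2 * B))).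
Proof.
move=> kt k0 hc.
pose C : R := (26 * K.+1%:R * t) ^+ 2 * (24 * expR (- (k * t ^+ 2))).
have C0 : 0 <= C by rewrite mulr_ge0 ?sqr_ge0// mulr_ge0// expR_ge0.
have t'0 : 0 <= 32 * t ^+ 3 * sq by rewrite !mulr_ge0 ?exprn_ge0// ltW.
rewrite -lee_fin -ev_EFin; last first.
  by apply: mom_exp; apply: mom_sub; [apply: mom_clip => //; exact: mom_half_truncated|exact: mom_untruncated].
have mE (c : R) m : measurable_fun [set: T] (fun e => expR (c * score K W (x e) (z e) t m)).
  by apply: measurableT_comp => //; exact: (mom_meas (mom_scale c (mom_score m))).
have mE2 m : measurable_fun [set: T] (fun e =>
    (expR (2 * k * t * score K W (x e) (z e) t m) +
     expR (- (2 * k * t) * score K W (x e) (z e) t m))%:E).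
  by apply/measurable_EFinP; exact: measurable_funD.
have E20 m e : (0 <= (expR (2 * k * t * score K W (x e) (z e) t m) +
     expR (- (2 * k * t) * score K W (x e) (z e) t m))%:E)%E.
  by rewrite lee_fin addr_ge0// expR_ge0.
apply: (@le_trans _ _ (\int[P]_e (C%:E * \sum_(m < K.+3)
    (expR (2 * k * t * score K W (x e) (z e) t m) +
     expR (- (2 * k * t) * score K W (x e) (z e) t m))%:E))%E).
  apply: ge0_le_integral => //.
  - by move=> e _; rewrite lee_fin sqr_ge0.
  - apply/measurable_EFinP; apply: (mom_meas (P := P)).
    by apply: mom_exp; apply: mom_sub; [apply: mom_clip => //; exact: mom_half_truncated|exact: mom_untruncated].
  - by apply: measurable_funeM; apply: emeasurable_sum => m _; exact: mE2.
  - move=> e _; rewrite sumEFin -EFinM lee_fin.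
    exact: (truncation_error_sqr (x e) (z e) W2 t1).
rewrite ge0_integralZl//; last 2 first.
- by apply: emeasurable_sum => m _; exact: mE2.
- by move=> e _; apply: sume_ge0.
rewrite [leRHS]EFinM lee_wpmul2l ?lee_fin//.
rewrite ge0_integral_sum//.
apply: (@le_trans _ _ (\sum_(m < K.+3) (2 * expR ((2 * k * t) ^+ 2 * B))%:E)%E); last first.
  by rewrite sumEFin sumr_const card_ord lee_fin -[leLHS]mulr_natl.
apply: lee_sum => m _.
under eq_integral do rewrite EFinD.
rewrite ge0_integralD//; last 2 first.
- exact/measurable_EFinP.
- exact/measurable_EFinP.
rewrite [in leRHS]mulrC mulr_natr mulr2n EFinD; apply: leeD; first exact: score_mgf.
by rewrite -[(2 * k * t) ^+ 2]sqrrN; apply: score_mgf; rewrite sqrrN.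
Qed.


End Truncation.

Variables (w k : R).
Hypothesis kt : 1 <= k * t.
Hypothesis k0 : 0 < k.
Hypothesis hc : 16 * (2 * k * t) ^+ 2 <= alpha ^+ 2 * K.+1%:R.

Let N := (n - K)%N.
Let times := index_iota K.+1 n.+1.
Let W := taper_weight K w : nat -> R.
(** Lag 0 carries the square of the observation, which has weight 1 and is not doubled as the pairs
    of lags are. *)
Let W' m : R := if m is 0%N then 1 else W m.
Let t' : R := 32 * t ^+ 3 * sq.
Let trunc_err : R := (26 * K.+1%:R * t) ^+ 2 * (24 * expR (- (k * t ^+ 2))) *
  (K.+3%:R * (2 * expR ((2 * k * t) ^+ 2 * (M / 2 + 32 / alpha ^+ 2)))).
Let V e i : R := X i%:Z e ^+ 2 +
  X i%:Z e * \sum_(1 <= m < K.+1) W m * (clip t (X (i - m)%N%:Z e) + xi (i - m)%N e).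
Let V0 e i : R := X i%:Z e ^+ 2 +
  X i%:Z e * \sum_(1 <= m < K.+1) W m * (X (i - m)%N%:Z e + xi (i - m)%N e).

Let N0 : 0 < N%:R :> R. Proof. by rewrite ltr0n subn_gt0. Qed.

Let W2 m : (1 <= m <= K)%N -> `|W m| <= 2.
Proof. exact: taper_weight_le2. Qed.

Let W'2 m : (m <= K)%N -> `|W' m| <= 2.
Proof.
case: m => [_|m mK]; last exact: W2.
by rewrite /W' normr1 ler1n.
Qed.

Let mem_times i : (i \in times) = (K < i <= n)%N.
Proof. by rewrite mem_index_iota. Qed.

Let momV i : i \in times -> mom (fun e => V e i).
Proof.
rewrite mem_times => hi.
have := mom_half_truncated W (i := i).
rewrite /V; under eq_fun do rewrite subn0; by apply.
Qed.

Let momV0 i : i \in times -> mom (fun e => V0 e i).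
Proof.
rewrite mem_times => hi.
have := mom_untruncated W (i := i).
rewrite /V0; under eq_fun do rewrite subn0; by apply.
Qed.

Let t'0 : 0 <= t'.
Proof. by rewrite /t' !mulr_ge0 ?exprn_ge0// ltW. Qed.

Let mom_err i : i \in times -> mom (fun e => clip t' (V e i) - V0 e i).
Proof.
move=> hi; apply: mom_sub; last exact: momV0.
by apply: mom_clip => //; exact: momV.
Qed.

Let ev_err i : i \in times ->
  ev (fun e => (clip t' (V e i) - V0 e i) ^+ 2) <= trunc_err.
Proof.
rewrite mem_times => hi.
have h := ev_truncation_error W2 hi kt k0 hc.
apply: le_trans h; rewrite le_eqVlt; apply/orP; left; apply/eqP.
by apply: eq_ev => e; rewrite /V /V0 subn0.
Qed.

(** Truncation errors are neither centered nor uncorrelated, so all [N ^ 2] pairs are bounded; the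
    term [trunc_err] therefore survives undivided by [N] and must itself be made [O(1 / n)]. *)
Let ev_sum_err :
  ev (fun e => (\sum_(i <- times) (clip t' (V e i) - V0 e i)) ^+ 2) <=
  N%:R * (N%:R * trunc_err).
Proof.
have sz : size times = N by rewrite size_iota subSS.
rewrite -sz; apply: ev_sum_sqr_le => [|i hi]; first exact: mom_err.
apply: (@le_trans _ _ (\sum_(j <- times) trunc_err)); last first.
  by rewrite big_const_seq count_predT iter_addr_0 mulr_natl.
rewrite big_seq [leRHS]big_seq; apply: ler_sum => j hj.
have mi := mom_exp 2 (mom_err hi); have mj := mom_exp 2 (mom_err hj).
apply: (@le_trans _ _ (ev (fun e => 2^-1 * ((clip t' (V e i) - V0 e i) ^+ 2 +
    (clip t' (V e j) - V0 e j) ^+ 2)))).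
  apply: ev_le => [||e].
  - by apply: mom_mul; exact: mom_err.
  - by apply: mom_scale; exact: mom_add.
  - have := sqr_ge0 ((clip t' (V e i) - V0 e i) - (clip t' (V e j) - V0 e j)).
    by rewrite !expr2; lra.
rewrite ev_scale; last exact: mom_add.
by rewrite ev_add//; have := ev_err hi; have := ev_err hj; lra.
Qed.

Let mu : R := sigma 0 + \sum_(1 <= m < K.+1) W m * sigma m%:Z.

Let S1 e : R := \sum_(i <- times) xi' i e.
Let S2 e : R := \sum_(i <- times) (clip t' (V e i) - V0 e i).
Let S3 e : R := \sum_(i <- times) \sum_(1 <= m < K.+1) W m * (X i%:Z e * xi (i - m)%N e).
Let S4 e : R := \sum_(i <- times) \sum_(0 <= m < K.+1)
  W' m * (X i%:Z e * X (i - m)%N%:Z e - sigma m%:Z).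

Let sum_release2 e :
  \sum_(i <- times) release2 K w t t' (fun i => X i%:Z e) (fun i => xi i e)
    (fun i => xi' i e) i = S1 e + S2 e + S3 e + S4 e + N%:R * mu.
Proof.
have -> : N%:R * mu = \sum_(i <- times) mu.
  by rewrite big_const_seq count_predT iter_addr_0 mulr_natl size_iota subSS.
rewrite /S1 /S2 /S3 /S4 -!big_split/=; apply: eq_bigr => i _.
rewrite /release2 interactionE -/(V e i).
suff -> : V0 e i = \sum_(1 <= m < K.+1) W m * (X i%:Z e * xi (i - m)%N e) +
    \sum_(0 <= m < K.+1) W' m * (X i%:Z e * X (i - m)%N%:Z e - sigma m%:Z) + mu by ring.
rewrite /V0 /mu (@big_ltn _ _ _ 0)// (_ : W' 0 = 1)//.
have -> : \sum_(1 <= m < K.+1) W' m * (X i%:Z e * X (i - m)%N%:Z e - sigma m%:Z) =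
    \sum_(1 <= m < K.+1) W m * (X i%:Z e * X (i - m)%N%:Z e - sigma m%:Z).
  by apply: eq_big_nat => -[].
rewrite subn0 mulr_sumr.
have -> : \sum_(1 <= m < K.+1) X i%:Z e * (W m * (X (i - m)%N%:Z e + xi (i - m)%N e)) =
    \sum_(1 <= m < K.+1) W m * (X i%:Z e * xi (i - m)%N e) +
    \sum_(1 <= m < K.+1) W m * (X i%:Z e * X (i - m)%N%:Z e - sigma m%:Z) +
    \sum_(1 <= m < K.+1) W m * sigma m%:Z.
  by rewrite -!big_split/=; apply: eq_bigr => m _; ring.
by ring.
Qed.

Let mom_S1 : mom S1.
Proof. by apply: mom_sum => i hi _; apply: (mom_noise' b'0 noise); rewrite -mem_times. Qed.

Let mom_S2 : mom S2.
Proof. by apply: mom_sum => i hi _; exact: mom_err. Qed.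

Let mom_S3 : mom S3.
Proof.
apply: mom_sum => i; rewrite mem_times => hi _; apply: mom_sum => m.
rewrite mem_index_iota ltnS => hm _; apply: mom_scale; apply: mom_mul.
  exact: (mom_gaussian gX).
by apply: (mom_noise b0 noise); move: hi hm; clear; lia.
Qed.

Let mom_S4 : mom S4.
Proof.
apply: mom_sum => i _ _; apply: mom_sum => m _ _; apply: mom_scale; apply: mom_sub.
  by apply: mom_mul; exact: (mom_gaussian gX).
exact: mom_cst.
Qed.

Lemma estimator_risk (f beta : R) : `|f - (2 * pi)^-1 * mu| <= beta ->
  ('E_P[fun e => (`|spectral_estimator n K w t t' (fun i => X i%:Z e)
      (fun i => xi i e) (fun i => xi' i e) - f| ^+ 2)%R] <=
  (5 * (16 * b' ^+ 2 / N%:R + trunc_err + K%:R * (64 * (4 * t / alpha) ^+ 2 * M) / N%:R +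
    K.+1%:R * (8 * M ^+ 2) / N%:R + beta ^+ 2))%:E)%E.
Proof.
move=> hbeta; have beta0 : 0 <= beta by apply: le_trans hbeta.
pose p : R := (2 * pi)^-1.
have p0 : 0 < p by rewrite invr_gt0 mulr_gt0// pi_gt0.
have p1 : p <= 1.
  rewrite invf_le1; last by rewrite mulr_gt0// pi_gt0.
  by have := pi_ge2 R; lra.
have estE e : spectral_estimator n K w t t' (fun i => X i%:Z e)
      (fun i => xi i e) (fun i => xi' i e) - f =
    p / N%:R * (S1 e + S2 e + S3 e + S4 e) + (p * mu - f).
  rewrite /spectral_estimator -/times sum_release2 invfM -/p mulrDr -!/N.
  by rewrite (mulrA _ N%:R mu) mulfVK ?gt_eqF// addrA.
have mS : mom (fun e => S1 e + S2 e + S3 e + S4 e).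
  by apply: mom_add mom_S4; apply: mom_add mom_S3; exact: mom_add.
pose U e : R := N%:R ^- 2 * (S1 e ^+ 2 + S2 e ^+ 2 + S3 e ^+ 2 + S4 e ^+ 2).
have mU : mom U.
  apply: mom_scale; apply: mom_add (mom_exp 2 mom_S4).
  by apply: mom_add (mom_exp 2 mom_S3); apply: mom_add; exact: mom_exp.
pose g e : R := (p / N%:R * (S1 e + S2 e + S3 e + S4 e) + (p * mu - f)) ^+ 2.
have mg : mom g by apply: mom_exp; apply: mom_add; [exact: mom_scale|exact: mom_cst].
apply: (@le_trans _ _ (ev g)%:E).
  rewrite unlock -ev_EFin// le_eqVlt; apply/orP; left; apply/eqP.
  by apply: eq_integral => e _; rewrite estE -normrX ger0_norm ?sqr_ge0.
rewrite lee_fin.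
apply: (@le_trans _ _ (ev (fun e => 5 * (U e + beta ^+ 2)))).
  apply: ev_le => [//||e].
  - by apply: mom_scale; apply: mom_add => //; exact: mom_cst.
  - have hp (s : R) : (p / N%:R * s) ^+ 2 <= N%:R ^- 2 * s ^+ 2.
      rewrite exprMn; apply: ler_wpM2r; first exact: sqr_ge0.
      rewrite exprMn (exprVn N%:R); apply: ler_piMl.
        by rewrite invr_ge0 sqr_ge0.
      by rewrite expr_le1// ltW.
    have hb : (p * mu - f) ^+ 2 <= beta ^+ 2.
      rewrite -[leLHS]ger0_norm ?sqr_ge0// normrX lerXn2r ?nnegrE// distrC.
      exact: hbeta.
    rewrite /g.
    rewrite !(mulrDr (p / N%:R)); apply: le_trans (sqr_sum5_le _ _ _ _ _) _.
    rewrite ler_pM2l//; apply: lerD hb; rewrite /U !(mulrDr (N%:R ^- 2)).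
    by do 3! apply: lerD => //.
rewrite ev_scale; last by apply: mom_add => //; exact: mom_cst.
rewrite ler_pM2l// ev_add//; last exact: mom_cst.
rewrite ev_cst lerD2r ev_scale; last first.
  apply: mom_add (mom_exp 2 mom_S4).
  by apply: mom_add (mom_exp 2 mom_S3); apply: mom_add; exact: mom_exp.
rewrite ev_add; [|apply: mom_add (mom_exp 2 mom_S3); apply: mom_add; exact: mom_exp|exact: mom_exp].
rewrite ev_add; [|apply: mom_add; exact: mom_exp|exact: mom_exp].
rewrite ev_add; [|exact: mom_exp|exact: mom_exp].
rewrite ler_pdivrMl ?exprn_gt0//.
have h1 := ev_sum_noise' b'0 noise.
have h3 := ev_sum_sample_noise gX sigmaN sigmaM b0 noise W2.
have h4 := ev_sum_quadratic gX sigmaN sigmaM n W'2.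
rewrite natrM -/N in h3; rewrite natrM -/N in h4.
apply: le_trans (lerD (lerD (lerD h1 ev_sum_err) h3) h4) _.
rewrite -/N le_eqVlt; apply/orP; left; apply/eqP.
by field; rewrite !gt_eqF.
Qed.

End MeanSquaredError.
(** * Choice of the bandwidth *)

Section Asymptotics.
Context (R : realType).
Implicit Types (A p eps alpha delta M : R).

Lemma ln_nat_ge A : \forall n \near \oo, A <= ln (n%:R : R).
Proof.
near=> n.
have h : expR A <= n%:R by near: n; exact: nbhs_infty_ger.
by rewrite -[leLHS]expRK ler_ln ?posrE ?expR_gt0// (lt_le_trans _ h)// expR_gt0.
Unshelve. all: by end_near. Qed.

Lemma ln_nat_powR_ge A delta : 0 < delta ->
  \forall n \near \oo, A <= ln (n%:R : R) `^ delta.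
Proof.
move=> d0; near=> n.
have h : `|A| `^ delta^-1 <= ln n%:R by near: n; exact: ln_nat_ge.
apply: le_trans (ler_norm _) _.
have x0 : 0 <= ln n%:R :> R by rewrite (le_trans _ h)// powR_ge0.
have -> : `|A| = (`|A| `^ delta^-1) `^ delta.
  by rewrite -powRrM mulVf ?lt0r_neq0// powRr1.
by apply: (ge0_ler_powR (ltW d0)); rewrite ?nnegrE ?powR_ge0.
Unshelve. all: by end_near. Qed.

Lemma ln_nat_powR_le A p eps : 0 < eps ->
  \forall n \near \oo, A * ln (n%:R : R) `^ p <= expR (eps * ln n%:R).
Proof.
move=> e0; pose m := (Num.truncn `|p|).+1.
have pm : p <= m%:R by apply: le_trans (ler_norm _) _; apply/ltW/truncnS_gt.
near=> n.
have x1 : 1 <= ln n%:R :> R by near: n; exact: ln_nat_ge.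
have xA : `|A| * (m.+1`!%:R / eps ^+ m.+1) <= ln n%:R by near: n; exact: ln_nat_ge.
set x := ln n%:R in x1 xA *.
have x0 : 0 < x by exact: lt_le_trans x1.
apply: (@le_trans _ _ (`|A| * x ^+ m)).
  apply: le_trans (ler_wpM2r (powR_ge0 _ _) (ler_norm A)) _.
  by rewrite ler_wpM2l// -powR_mulrn ?ler_powR// ltW.
have := exprn_le_expR m.+1 (ltW (mulr_gt0 e0 x0)).
set E := expR _; rewrite exprMn mulrC -ler_pdivlMr ?exprn_gt0// => h.
rewrite -(ler_pM2l x0) mulrCA -exprS.
apply: le_trans (ler_wpM2l (normr_ge0 A) h) _.
have -> : `|A| * (m.+1`!%:R * E / eps ^+ m.+1) =
  `|A| * (m.+1`!%:R / eps ^+ m.+1) * E by ring.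
by rewrite ler_wpM2r// expR_ge0.
Unshelve. all: by end_near. Qed.

Lemma tau_ge0 delta n : 0 <= tau delta n :> R.
Proof. exact: sqrtr_ge0. Qed.

Lemma tau_sqr delta n : tau delta n ^+ 2 = 8 * ln (n%:R : R) `^ (1 + delta).
Proof. by rewrite sqr_sqrtr// mulr_ge0// powR_ge0. Qed.

Lemma tau_pow6 delta n : tau delta n ^+ 6 = 512 * ln (n%:R : R) `^ (3 + 3 * delta).
Proof.
rewrite (_ : 6 = 2 * 3)%N// exprM tau_sqr exprMn.
rewrite -[(_ `^ _) ^+ 3]powR_mulrn ?powR_ge0// -powRrM.
by congr (_ * _ `^ _); ring.
Qed.

Lemma tau'E delta n K :
  tau' delta n K = 32 * tau delta n ^+ 3 * Num.sqrt K.+1%:R :> R.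
Proof.
rewrite /tau'; have := tau_ge0 delta n; move: (tau delta n) => u u0.
have -> : 1024 * u ^+ 6 = (32 * u ^+ 3) ^+ 2 :> R by ring.
by rewrite sqrtrM ?sqr_ge0// sqrtr_sqr ger0_norm// mulr_ge0// exprn_ge0.
Qed.

(** The rates differ only by the factor [8 ^ 3 = 512] contained in [tau ^+ 6]. *)
Lemma bandwidth_rate_le alpha delta n :
  bandwidth_rate alpha delta n <= 512 * risk_rate alpha delta n.
Proof.
rewrite /bandwidth_rate /risk_rate tau_pow6 -mulrA maxr_pMr ?ler0n// ge_max !le_max.
by rewrite lexx orbT andbT -[leLHS]mul1r ler_wpM2r ?invr_ge0// ler1n.
Qed.

Lemma bandwidth_rate_ge alpha delta n : n%:R^-1 <= bandwidth_rate alpha delta n.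
Proof. by rewrite le_max lexx. Qed.

End Asymptotics.

(** * Large-sample conditions on the bandwidth *)

Section Tuning.
Context (R : realType).
Variables (M k1 k2 theta alpha delta : R).
Hypothesis M0 : 0 < M.
Hypothesis k10 : 0 < k1.
Hypothesis k20 : 0 < k2.
Hypothesis theta1 : 1 < theta.
Hypothesis alpha0 : 0 < alpha.
Hypothesis delta0 : 0 < delta.

Let B : R := M / 2 + 32 / alpha ^+ 2.
Let B0 : 0 < B.
Proof. by rewrite addr_gt0// divr_gt0// exprn_gt0. Qed.

(* This choice balances the exponents of [truncation_negligible]:
   [(2 k t)^2 B = k t^2 / 2]. *)
Let k : R := (8 * B)^-1.
Let k0 : 0 < k.
Proof. by rewrite invr_gt0 mulr_gt0. Qed.

(** With [y = k * t ^+ 2 / 4] the exponents add up to [-4 y + 2 y]. One factor [expR (- y)] absorbs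
    [t ^+ 2], the other is at most [n ^- 5]; the polynomial in [K] costs [n ^+ 3] and the constant
    one more [n]. *)
Lemma truncation_negligible (t : R) (n K : nat) : (0 < n)%N -> (K < n)%N ->
  5 * ln n%:R <= k * t ^+ 2 / 4 -> 26 ^+ 2 * 576 / k <= n%:R ->
  (26 * K.+1%:R * t) ^+ 2 * (24 * expR (- (k * t ^+ 2))) *
    (K.+3%:R * (2 * expR ((2 * k * t) ^+ 2 * B))) <= n%:R^-1.
Proof.
move=> n0 Kn hln hC.
have nR : 0 < n%:R :> R by rewrite ltr0n.
set y := k * t ^+ 2 / 4 in hln.
have tE : t ^+ 2 = 4 / k * y by rewrite /y; field; rewrite gt_eqF.
have -> : (2 * k * t) ^+ 2 * B = y + y.
  have -> : (2 * k * t) ^+ 2 = 4 * k * k * t ^+ 2 by ring.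
  by rewrite tE /k; field; rewrite !gt_eqF.
have -> : k * t ^+ 2 = y + y + (y + y) by rewrite /y; field.
have y0 : 0 <= y by rewrite divr_ge0// mulr_ge0 ?sqr_ge0// ltW.
have yE : y <= expR y by apply: le_trans (expR_ge1Dx y); rewrite lerDr.
have -> : (26 * K.+1%:R * t) ^+ 2 * (24 * expR (- (y + y + (y + y)))) *
    (K.+3%:R * (2 * expR (y + y))) =
    26 ^+ 2 * 192 / k * (K.+1%:R ^+ 2 * K.+3%:R * (y * expR (- (y + y)))).
  rewrite exprMn tE opprD expRD (expRN (y + y)).
  by field; rewrite !gt_eqF// expR_gt0.
have E0 : expR (- (y + y)) = expR (- y) * expR (- y) by rewrite -expRD opprD.
have K3 : K.+1%:R ^+ 2 * K.+3%:R <= 3 * n%:R ^+ 3 :> R.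
  have a1 : K.+1%:R ^+ 2 <= n%:R ^+ 2 :> R by rewrite lerXn2r ?nnegrE// ler_nat.
  have a2 : K.+3%:R <= 3 * n%:R :> R by rewrite -natrM ler_nat; move: Kn; clear; lia.
  have -> : 3 * n%:R ^+ 3 = n%:R ^+ 2 * (3 * n%:R) :> R by ring.
  by apply: ler_pM => //; exact: sqr_ge0.
have yy : y * expR (- (y + y)) <= n%:R ^- 5.
  rewrite E0 mulrA; apply: (@le_trans _ _ (1 * expR (- y))).
    rewrite ler_wpM2r ?expR_ge0// expRN ler_pdivrMr ?expR_gt0// mul1r//.
  rewrite mul1r expRN lef_pV2 ?posrE ?expR_gt0 ?exprn_gt0//.
  have -> : n%:R ^+ 5 = expR (5 * ln n%:R) :> R.
    by rewrite expRM_natl lnK// posrE.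
  by rewrite ler_expR.
apply: (@le_trans _ _ (26 ^+ 2 * 192 / k * (3 * n%:R ^+ 3 * n%:R ^- 5))).
  apply: ler_wpM2l; first by rewrite divr_ge0 ?mulr_ge0 ?exprn_ge0 ?ler0n// ltW.
  by apply: ler_pM => //; rewrite mulr_ge0 ?expR_ge0 ?sqr_ge0.
have -> : 26 ^+ 2 * 192 / k * (3 * n%:R ^+ 3 * n%:R ^- 5) = 26 ^+ 2 * 576 / k * n%:R ^- 2.
  by field; rewrite !gt_eqF.
have -> : n%:R^-1 = n%:R * n%:R ^- 2 :> R by field; rewrite gt_eqF.
by rewrite ler_wpM2r// invr_ge0 sqr_ge0.
Qed.

Lemma bandwidth_rate_small :
  \forall n \near \oo, bandwidth_rate alpha delta n <= expR (- (ln n%:R / 2)) :> R.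
Proof.
near=> n.
have x0 : 0 <= ln n%:R :> R by near: n; exact: ln_nat_ge.
have nR : 0 < n%:R :> R by rewrite ltr0n; near: n; exact: nbhs_infty_gt.
have h : 512 / alpha ^+ 2 * ln n%:R `^ (3 + 3 * delta) <= expR (2^-1 * ln n%:R).
  by near: n; exact: ln_nat_powR_le.
have nE : n%:R^-1 = expR (- (ln n%:R)) :> R by rewrite expRN lnK.
rewrite /bandwidth_rate ge_max nE ler_expR lerN2 ler_pdivrMr// ler_peMr ?ler1n//=.
rewrite tau_pow6 invfM mulrA mulrAC -/(_ / _) nE.
have -> : - (ln n%:R / 2) = 2^-1 * ln n%:R - ln n%:R :> R by field.
rewrite expRD ler_wpM2r ?expR_ge0//.
by apply: le_trans h; rewrite mulrAC.
Unshelve. all: by end_near. Qed.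

(** The rate lies between [n^-1] and [n^(-1/2)], so [K] lies between multiples of [n^(1/(2 theta))]
    and [n^(1/theta)]. The lower power beats the logarithms in [tau], and the upper one is below
    [n / 2] because [theta > 1]. *)
Lemma bandwidth_conditions : exists n0 : nat, forall n K : nat,
  (n0 <= n)%N -> (K < n)%N ->
  k1 * bandwidth_rate alpha delta n `^ (- theta^-1) <= K%:R
    <= k2 * bandwidth_rate alpha delta n `^ (- theta^-1) ->
  [/\ 1 <= tau delta n, 1 <= k * tau delta n, (1 < K)%N /\ (K.*2 <= n)%N,
      16 * (2 * k * tau delta n) ^+ 2 <= alpha ^+ 2 * K.+1%:R
    & (26 * K.+1%:R * tau delta n) ^+ 2 * (24 * expR (- (k * tau delta n ^+ 2))) *
    (K.+3%:R * (2 * expR ((2 * k * tau delta n) ^+ 2 * B))) <= n%:R^-1].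
Proof.
have theta0 : 0 < theta by exact: lt_trans theta1.
have it1 : theta^-1 < 1 by rewrite invf_lt1.
have it0 : 0 < theta^-1 by rewrite invr_gt0.
suff [n0 _ H] : \forall n \near \oo, forall K : nat, (K < n)%N ->
  k1 * bandwidth_rate alpha delta n `^ (- theta^-1) <= K%:R
    <= k2 * bandwidth_rate alpha delta n `^ (- theta^-1) ->
  [/\ 1 <= tau delta n, 1 <= k * tau delta n, (1 < K)%N /\ (K.*2 <= n)%N,
      16 * (2 * k * tau delta n) ^+ 2 <= alpha ^+ 2 * K.+1%:R
    & (26 * K.+1%:R * tau delta n) ^+ 2 * (24 * expR (- (k * tau delta n ^+ 2))) *
    (K.+3%:R * (2 * expR ((2 * k * tau delta n) ^+ 2 * B))) <= n%:R^-1].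
  by exists n0 => n K n0n; exact: H.
near=> n => K Kn /andP[hK1 hK2].
have x1 : 1 <= ln n%:R :> R by near: n; exact: ln_nat_ge.
have xk : (k^-1) ^+ 2 <= ln n%:R by near: n; exact: ln_nat_ge.
have xd : 5 / (2 * k) <= ln n%:R `^ delta by near: n; exact: ln_nat_powR_ge.
have nk : 26 ^+ 2 * 576 / k <= n%:R by near: n; exact: nbhs_infty_ger.
have rs : bandwidth_rate alpha delta n <= expR (- (ln n%:R / 2)).
  by near: n; exact: bandwidth_rate_small.
(* The exponent 0 specializes [ln_nat_powR_le] to a constant on the left. *)
have hk1 : 2 / k1 * ln n%:R `^ 0 <= expR (theta^-1 / 2 * ln n%:R).
  by near: n; apply: ln_nat_powR_le; rewrite divr_gt0.
have hk2 : 2 * k2 * ln n%:R `^ 0 <= expR ((1 - theta^-1) * ln n%:R).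
  by near: n; apply: ln_nat_powR_le; rewrite subr_gt0.
have hk3 : 512 * k ^+ 2 / (alpha ^+ 2 * k1) * ln n%:R `^ (1 + delta) <=
    expR (theta^-1 / 2 * ln n%:R).
  by near: n; apply: ln_nat_powR_le; rewrite divr_gt0.
move: hk1 hk2; rewrite powRr0 !mulr1 => hk1 hk2.
have x0 : 0 < ln n%:R :> R by exact: lt_le_trans x1.
have n0 : (0 < n)%N by exact: leq_ltn_trans Kn.
have nR : 0 < n%:R :> R by rewrite ltr0n.
have a20 : 0 < alpha ^+ 2 by rewrite exprn_gt0.
set r := bandwidth_rate alpha delta n in hK1 hK2 rs.
have r0 : 0 < r by apply: lt_le_trans (bandwidth_rate_ge _ _ _); rewrite invr_gt0.
have rE : r `^ (- theta^-1) = expR (- theta^-1 * ln r) by rewrite /powR gt_eqF.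
have lnr1 : - ln n%:R <= ln r.
  by rewrite -lnV ?posrE// ler_ln ?posrE ?invr_gt0//; exact: bandwidth_rate_ge.
have lnr2 : ln r <= - (ln n%:R / 2).
  by rewrite -[leRHS]expRK ler_ln ?posrE ?expR_gt0.
have rl : expR (theta^-1 / 2 * ln n%:R) <= r `^ (- theta^-1).
  rewrite rE ler_expR mulNr -mulrN -mulrA ler_pM2l// lerNr.
  by rewrite [2^-1 * _]mulrC.
have ru : r `^ (- theta^-1) <= expR (theta^-1 * ln n%:R).
  by rewrite rE ler_expR mulNr -mulrN ler_pM2l// lerNl.
have KE : k1 * expR (theta^-1 / 2 * ln n%:R) <= K%:R.
  by apply: le_trans hK1; rewrite ler_pM2l.
set t := tau delta n.
have t2E : t ^+ 2 = 8 * ln n%:R `^ (1 + delta) by exact: tau_sqr.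
have t0 : 0 <= t by exact: tau_ge0.
have xx : ln n%:R `^ (1 + delta) = ln n%:R * ln n%:R `^ delta :> R.
  by rewrite powRD ?(gt_eqF x0) ?implybT// powRr1// ltW.
have x1d : 1 <= ln n%:R `^ delta :> R.
  by rewrite -[leLHS](powRr0 (ln n%:R : R)) ler_powR// ltW.
have t2x : ln n%:R <= t ^+ 2.
  by rewrite t2E xx mulrCA ler_peMr ?(ltW x0)//; lra.
split.
- by rewrite -(@ler_pXn2r _ 2)// ?nnegrE// expr1n; exact: le_trans t2x.
- have ki0 : 0 <= k^-1 by apply: ltW; rewrite invr_gt0.
  rewrite -ler_pdivrMl// mulr1 -(@ler_pXn2r _ 2)// ?nnegrE//.
  exact: le_trans t2x.
- split.
    rewrite -(ltr_nat R); apply: lt_le_trans KE.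
    by move: hk1; rewrite ler_pdivrMr// mulrC; apply: lt_le_trans; rewrite ltr1n.
  rewrite -muln2 -(ler_nat R) natrM mulrC.
  apply: (@le_trans _ _ (2 * (k2 * expR (theta^-1 * ln n%:R)))).
    rewrite ler_pM2l//; apply: le_trans hK2 _.
    by rewrite ler_pM2l.
  rewrite mulrA; apply: le_trans (ler_wpM2r (expR_ge0 _) hk2) _.
  by rewrite -expRD mulrBl mul1r subrK lnK.
- have -> : 16 * (2 * k * t) ^+ 2 = alpha ^+ 2 * k1 *
      (512 * k ^+ 2 / (alpha ^+ 2 * k1) * ln n%:R `^ (1 + delta)).
    have -> : (2 * k * t) ^+ 2 = 4 * k ^+ 2 * t ^+ 2 by ring.
    by rewrite t2E; field; rewrite !gt_eqF.
  rewrite -mulrA ler_pM2l//.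
  apply: le_trans (ler_wpM2l (ltW k10) hk3) _; apply: le_trans KE _.
  by rewrite ler_nat.
- apply: truncation_negligible => //.
  have -> : k * t ^+ 2 / 4 = ln n%:R * (2 * k * ln n%:R `^ delta).
    by rewrite t2E xx; field.
  rewrite mulrC ler_pM2l// -ler_pdivrMl ?mulr_gt0//.
  by rewrite mulrC.
Unshelve. all: by end_near. Qed.

End Tuning.
(** Stated for an abstract class: the variance [K r] and the squared bias [K^(-(theta - 1))] are
    both of order [r^((theta - 1) / theta)] when [K] is of order [r^(-1 / theta)]. The constant is
    chosen before alpha and delta. *)
Lemma worst_risk_le (R : realType) (class : (int -> R) -> Prop) (M k1 k2 theta Cb : R) :
  0 < M -> 0 < k1 -> k1 <= k2 -> 1 < theta ->
  (forall sigma, class sigma -> is_autocov sigma) ->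
  (forall sigma, class sigma -> (abs_sum sigma < M%:E)%E) ->
  (forall sigma (K : nat) (w : R),
    (forall j, sigma (- j) = sigma j) ->
    (forall r : seq int, uniq r -> \sum_(j <- r) `|sigma j| <= M) ->
    (1 < K)%N -> class sigma ->
    `|spectral_density sigma w - (2 * pi)^-1 *
      (sigma 0 + \sum_(1 <= m < K.+1) taper_weight K w m * sigma m%:Z)| <=
    Cb * K%:R `^ (- ((theta - 1) / 2))) ->
  exists c : R, 0 < c /\
    forall alpha delta : R, 0 < alpha -> 0 < delta ->
    exists n0 : nat, forall (n K : nat) (w : R),
      (n0 <= n)%N -> (K < n)%N ->
      k1 * bandwidth_rate alpha delta n `^ (- theta^-1) <= K%:R
        <= k2 * bandwidth_rate alpha delta n `^ (- theta^-1) ->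
      (worst_risk class alpha delta n K w
         <= (c * risk_rate alpha delta n `^ ((theta - 1) / theta))%:E)%E.
Proof.
move=> M0 k10 k12 theta1 classA classM bias.
have k20 : 0 < k2 by exact: lt_le_trans k12.
have theta0 : 0 < theta by exact: lt_trans theta1.
have [Q QE Q0] : exists2 Q : R, Q = 1024 & 0 < Q by exists 1024; [exact: erefl|rewrite ltr0n].
(* The coefficients of [K * r] in [T1], [T3], [T4] and [T2], in this order. *)
pose A : R := Q ^+ 2 + 2 * Q * M + 32 * M ^+ 2 + 1.
have A0 : 0 < A.
  by have := sqr_ge0 M; have := sqr_ge0 Q; have := mulr_ge0 (ltW Q0) (ltW M0); rewrite /A; lra.
pose g := (theta - 1) / theta.
have g0 : 0 < g by rewrite divr_gt0// subr_gt0.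
(* The factor 5 comes from squaring a sum of five terms; the upper bound on [K] enters through the
   variance, the lower one through the bias, and the last factor passes from [bandwidth_rate] to
   [risk_rate]. *)
pose c := 5 * (A * k2 + Cb ^+ 2 * k1 `^ (- (theta - 1))) * 512 `^ g.
exists c; split.
  apply: mulr_gt0; last by apply: powR_gt0; rewrite ltr0n.
  rewrite mulr_gt0// ltr_pwDl ?mulr_gt0// mulr_ge0 ?sqr_ge0//.
  exact: powR_ge0.
move=> alpha delta alpha0 delta0.
have [n0 H] := bandwidth_conditions M0 k10 k20 theta1 alpha0 delta0.
exists n0 => n K w n0n Kn hK; have [t1 kt [K1 Kn2] hc hD] := H n K n0n Kn hK.
move: hK => /andP[hK1 hK2].
have n_gt0 : (0 < n)%N by exact: leq_ltn_trans Kn.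
have nR : 0 < n%:R :> R by rewrite ltr0n.
have K0 : (0 < K)%N by exact: ltnW.
have KR : 1 <= K%:R :> R by rewrite ler1n.
have KR0 : 0 < K%:R :> R by rewrite ltr0n.
set t := tau delta n in t1 kt hc hD.
have t0 : 0 < t by exact: lt_le_trans t1.
have B0 : 0 < M / 2 + 32 / alpha ^+ 2 by rewrite addr_gt0// divr_gt0// exprn_gt0.
set k := (8 * _)^-1 in kt hc hD.
have k0 : 0 < k by rewrite invr_gt0 mulr_gt0.
set r := bandwidth_rate alpha delta n in hK1 hK2.
have rn : n%:R^-1 <= r by exact: bandwidth_rate_ge.
have r0 : 0 < r by apply: lt_le_trans rn; rewrite invr_gt0.
have rt : t ^+ 6 / (n%:R * alpha ^+ 2) <= r by rewrite /r /bandwidth_rate le_max lexx orbT.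
have b'0 : 0 < 4 * tau' delta n K / alpha.
  rewrite divr_gt0// mulr_gt0// tau'E -/t mulr_gt0 ?sqrtr_gt0 ?ltr0n//.
  by rewrite mulr_gt0// exprn_gt0.
apply: ge_ereal_sup => _ [sigma [cs [d [T [P [X [xi [xi' [gX noise ->]]]]]]]]].
have [sigmaN _ _] := classA _ cs.
have sigmaM (q : seq int) : uniq q -> \sum_(j <- q) `|sigma j| <= M.
  by move=> uq; apply: esum_seq_le => //; apply: ltW; exact: classM.
have hb := bias sigma K w sigmaN sigmaM K1 cs.
rewrite /mean_squared_error.
have := estimator_risk gX sigmaN sigmaM alpha0 t1 b'0 noise Kn K0 kt k0 hc hb.
rewrite /t -tau'E => /le_trans; apply; rewrite lee_fin -/t.
have NR : n%:R <= 2 * (n - K)%:R :> R.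
  by rewrite -natrM ler_nat; move: Kn2; clear; lia.
have N0 : 0 < (n - K)%:R :> R by rewrite ltr0n subn_gt0.
have Ninv : (n - K)%:R^-1 <= 2 / n%:R :> R.
  by rewrite ler_pdivlMr// mulrC ler_pdivrMr.
have K12 : K.+1%:R <= 2 * K%:R :> R.
  by rewrite -natrM ler_nat; move: K0; clear; lia.
have a20 : 0 < alpha ^+ 2 by rewrite exprn_gt0.
have T1 : 16 * (4 * tau' delta n K / alpha) ^+ 2 / (n - K)%:R <= Q ^+ 2 * (K%:R * r).
  have -> : 16 * (4 * tau' delta n K / alpha) ^+ 2 =
      Q * 256 * (t ^+ 6 / alpha ^+ 2) * K.+1%:R.
    rewrite tau'E -/t; set q := Num.sqrt _.
    have -> : K.+1%:R = q ^+ 2 by rewrite sqr_sqrtr.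
    by rewrite QE; field; rewrite gt_eqF.
  apply: (@le_trans _ _ (Q * 256 * (t ^+ 6 / alpha ^+ 2) * (2 * K%:R) * (2 / n%:R))).
    have c0 : 0 <= Q * 256 * (t ^+ 6 / alpha ^+ 2).
      apply: mulr_ge0; last by apply: divr_ge0; apply: exprn_ge0; exact: ltW.
      by apply: mulr_ge0; [exact: ltW|exact: ler0n].
    apply: ler_pM; last exact: Ninv.
    - by apply: mulr_ge0 c0 _.
    - by rewrite invr_ge0.
    - exact: ler_wpM2l.
  have -> : Q * 256 * (t ^+ 6 / alpha ^+ 2) * (2 * K%:R) * (2 / n%:R) =
      Q ^+ 2 * (K%:R * (t ^+ 6 / (n%:R * alpha ^+ 2))).
    by rewrite QE; field; rewrite !gt_eqF.
  by rewrite ler_pM2l ?exprn_gt0// ler_pM2l.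
have T3 : K%:R * (64 * (4 * t / alpha) ^+ 2 * M) / (n - K)%:R <= 2 * Q * M * (K%:R * r).
  apply: (@le_trans _ _ (K%:R * (64 * (4 * t / alpha) ^+ 2 * M) * (2 / n%:R))).
    rewrite ler_wpM2l// mulr_ge0// mulr_ge0 ?(ltW M0)// mulr_ge0 ?sqr_ge0//.
  have -> : K%:R * (64 * (4 * t / alpha) ^+ 2 * M) * (2 / n%:R) =
      2 * Q * M * (K%:R * (t ^+ 2 / (n%:R * alpha ^+ 2))).
    by rewrite QE; field; rewrite !gt_eqF.
  have cM : 0 < 2 * Q * M by rewrite mulr_gt0// mulr_gt0.
  rewrite (ler_pM2l cM) ler_pM2l//; apply: le_trans rt.
  by rewrite ler_pM2r ?invr_gt0 ?mulr_gt0// ler_weXn2l.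
have T4 : K.+1%:R * (8 * M ^+ 2) / (n - K)%:R <= 32 * M ^+ 2 * (K%:R * r).
  apply: (@le_trans _ _ (2 * K%:R * (8 * M ^+ 2) * (2 / n%:R))).
    have m0 : 0 <= 8 * M ^+ 2 by rewrite mulr_ge0 ?sqr_ge0.
    by apply: ler_pM => //; [rewrite mulr_ge0|rewrite ler_wpM2r].
  have -> : 2 * K%:R * (8 * M ^+ 2) * (2 / n%:R) = 32 * M ^+ 2 * (K%:R * n%:R^-1).
    by field; rewrite gt_eqF.
  by apply: ler_wpM2l; [rewrite mulr_ge0 ?sqr_ge0|rewrite ler_pM2l].
have T2 : n%:R^-1 <= K%:R * r.
  by apply: le_trans rn _; rewrite ler_peMl// ltW.
have Kr : K%:R * r <= k2 * r `^ g.
  apply: le_trans (ler_wpM2r (ltW r0) hK2) _.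
  rewrite -mulrA ler_pM2l// -[X in _ * X](powRr1 (ltW r0)) -powRD; last first.
    by rewrite (gt_eqF r0) implybT.
  by rewrite (_ : _ + _ = g)// /g; field; rewrite gt_eqF.
have Kb : (Cb * K%:R `^ (- ((theta - 1) / 2))) ^+ 2 <=
    Cb ^+ 2 * k1 `^ (- (theta - 1)) * r `^ g.
  rewrite exprMn -mulrA; apply: ler_wpM2l; first exact: sqr_ge0.
  rewrite -powR_mulrn ?powR_ge0// -powRrM.
  have -> : - ((theta - 1) / 2) * 2%:R = - (theta - 1) by field.
  have -> : k1 `^ (- (theta - 1)) * r `^ g = (k1 * r `^ (- theta^-1)) `^ (- (theta - 1)).
    rewrite powRM ?powR_ge0 ?(ltW k10)// -powRrM; congr (_ * _ `^ _).
    by rewrite /g mulrNN mulrC.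
  have u0 : 0 < k1 * r `^ (- theta^-1) by rewrite mulr_gt0// powR_gt0.
  move: hK1 u0; move: (k1 * _) => u uK u0.
  rewrite !powRN lef_pV2 ?posrE ?powR_gt0//.
  by apply: ge0_ler_powR => //; rewrite ?nnegrE ?subr_ge0 ltW.
apply: (@le_trans _ _ (5 * (A * k2 + Cb ^+ 2 * k1 `^ (- (theta - 1))) * r `^ g)).
  rewrite -[leRHS]mulrA ler_pM2l// [leRHS]mulrDl; apply: lerD Kb.
  apply: (@le_trans _ _ (A * (K%:R * r))); last by rewrite -[leRHS]mulrA ler_pM2l.
  rewrite /A; move: T1 T2 T3 T4 hD; rewrite !(mulrDl _ _ (K%:R * r)) mul1r.
  by move=> h1 h2 h3 h4 h5; lra.
rewrite /c -[leRHS]mulrA; apply: ler_wpM2l.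
  apply: mulr_ge0 => //; apply: addr_ge0; first by apply: ltW; exact: mulr_gt0.
  by rewrite mulr_ge0 ?sqr_ge0 ?powR_ge0.
have rr0 : 0 <= risk_rate alpha delta n.
  by rewrite /risk_rate le_max invr_ge0 ltW.
rewrite -powRM ?ler0n//; apply: (ge0_ler_powR (ltW g0)).
- by rewrite nnegrE ltW.
- by rewrite nnegrE mulr_ge0 ?ler0n.
- exact: bandwidth_rate_le.
Qed.

Theorem theorem2 (R : realType) (s L : R) (hs : 2^-1 < s) (hL : 0 < L) :
  (forall (L0 M k1 k2 : R), 0 < L0 -> 0 < M ->
    (forall sigma, W_infty s L0 L sigma -> (abs_sum sigma < M%:E)%E) ->
    0 < k1 -> k1 <= k2 ->
    exists c1 : R, 0 < c1 /\
    forall alpha delta : R, 0 < alpha -> 0 < delta ->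
    exists n0 : nat, forall (n K : nat) (w : R),
      (n0 <= n)%N -> (K < n)%N -> - pi <= w <= pi ->
      k1 * bandwidth_rate alpha delta n `^ (- (2 * s + 1)^-1) <= K%:R
        <= k2 * bandwidth_rate alpha delta n `^ (- (2 * s + 1)^-1) ->
      (worst_risk (W_infty s L0 L) alpha delta n K w
         <= (c1 * risk_rate alpha delta n `^ (2 * s / (2 * s + 1)))%:E)%E)
  /\
  (forall (M k1 k2 : R), 0 < M ->
    (forall sigma, W_2 s L sigma -> (abs_sum sigma < M%:E)%E) ->
    0 < k1 -> k1 <= k2 ->
    exists c2 : R, 0 < c2 /\
    forall alpha delta : R, 0 < alpha -> 0 < delta ->
    exists n0 : nat, forall (n K : nat) (w : R),
      (n0 <= n)%N -> (K < n)%N -> - pi <= w <= pi ->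
      k1 * bandwidth_rate alpha delta n `^ (- (2 * s)^-1) <= K%:R
        <= k2 * bandwidth_rate alpha delta n `^ (- (2 * s)^-1) ->
      (worst_risk (W_2 s L) alpha delta n K w
         <= (c2 * risk_rate alpha delta n `^ ((2 * s - 1) / (2 * s)))%:E)%E).
Proof.
have s0 : 0 < s by apply: lt_trans hs; rewrite invr_gt0.
split=> [L0 M k1 k2 L00 M0 classM k10 k12|M k1 k2 M0 classM k10 k12].
  have theta1 : 1 < 2 * s + 1 by rewrite ltrDr mulr_gt0.
  have [||sigma K w sigmaN sigmaM K1 cs|c [c0 H]] := @worst_risk_le R (W_infty s L0 L)
    M k1 k2 (2 * s + 1) (4 * (289 `^ s * 289 * (2 * L0) * 3 `^ s)) M0 k10 k12 theta1.
  - by move=> sigma [].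
  - exact: classM.
  - have -> : (2 * s + 1 - 1) / 2 = s by field.
    exact: (bias_W_infty sigmaN sigmaM w s0 L00 K1 cs).
  - exists c; split=> // alpha delta alpha0 delta0.
    have [n0 Hn] := H alpha delta alpha0 delta0.
    exists n0 => n K w n0n Kn _ hK; have := Hn n K w n0n Kn hK.
    by rewrite addrK.
have theta1 : 1 < 2 * s by rewrite mulrC -ltr_pdivrMr// mul1r.
have [||sigma K w sigmaN sigmaM K1 cs|c [c0 H]] := @worst_risk_le R (W_2 s L)
  M k1 k2 (2 * s) ((L + (2 * s - 1)^-1) * 3 `^ (s - 2^-1)) M0 k10 k12 theta1.
- by move=> sigma [].
- exact: classM.
- have -> : (2 * s - 1) / 2 = s - 2^-1 by field.
  exact: (bias_W_2 sigmaN sigmaM w hs hL K1 cs).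
- exists c; split=> // alpha delta alpha0 delta0.
  have [n0 Hn] := H alpha delta alpha0 delta0.
  by exists n0 => n K w n0n Kn _ hK; exact: Hn.
Qed.
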